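(* Let $\alpha=[a_0;a_1,a_2,\ldots]$ be a real algebraic number of degree at least three. Then the sequence of partial quotients $(a_\ell)_{\ell\ge1}$ of $\alpha$ is not generated by a recurrent morphism.
   Context: For a finite set $\mathcal{A}$, $\mathcal{A}^*$ is the free monoid of finite words over $\mathcal{A}$. A morphism from $\mathcal{A}$ to $\mathcal{B}$ is a monoid homomorphism $\mathcal{A}^*\to\mathcal{B}^*$ (determined by its values on letters); a coding is a map $\mathcal{A}\to\mathcal{B}$ extended to a homomorphism $\mathcal{A}^*\to\mathcal{B}^*$ (letter-to-letter). A morphism $\sigma$ from a finite set $\mathcal{A}$ into itself is prolongable if there is a letter $a$ with $\sigma(a)=aW$, where $W$ is a word such that $\sigma^n(W)$ is non-empty for every $n\ge0$; then $\sigma^n(a)$ converges (in the product topology) to an infinite word $\mathbf{a}$, a fixed point of $\sigma$. A sequence $\mathbf{b}$ is generated by the morphism $\sigma$ if there is a coding $\varphi$ with $\mathbf{b}=\varphi(\mathbf{a})$ for such a fixed point $\mathbf{a}$; it is generated by a recurrent morphism if moreover every letter appearing in $\mathbf{a}$ occurs at least twice in $\mathbf{a}$. *)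

(* Defs.v *)
From HB Require Import structures.
From mathcomp Require Import all_boot all_order all_algebra.
From mathcomp Require Import all_classical all_reals all_analysis.

Set Implicit Arguments.
Unset Strict Implicit.
Unset Printing Implicit Defensive.

Import Order.TTheory GRing.Theory Num.Theory.
Import numFieldNormedType.Exports.

Local Open Scope classical_set_scope.
Local Open Scope ring_scope.

Definition minimal_polynomial (R : realType) (x : R) (p : {poly rat}) : Prop :=
  [/\ p \is monic, root (map_poly ratr p) x
    & forall q : {poly rat}, root (map_poly ratr q) x -> (p %| q)%R].

Definition algebraic_of_degree (R : realType) (x : R) (d : nat) : Prop :=
  exists p : {poly rat}, minimal_polynomial x p /\ size p = d.+1.

(* [cfrac R a n] is the finite continued fraction [a_0; a_1, ..., a_n]. *)
Fixpoint cfrac (R : realType) (a : nat -> int) (n : nat) : R :=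
  match n with
  | 0 => (a 0%N)%:~R
  | n'.+1 => (a 0%N)%:~R + (cfrac R (fun i => a i.+1) n')^-1
  end.

(* x = [a_0; a_1, a_2, ...], an infinite regular continued fraction. *)
Definition continued_fraction (R : realType) (x : R) (a : nat -> int) : Prop :=
  (forall n : nat, 0 < a n.+1) /\ cfrac R a @ \oo --> x.

Definition word_morphism (A B : finType) (f : seq A -> seq B) : Prop :=
  f [::] = [::] /\ forall u v : seq A, f (u ++ v) = f u ++ f v.

Definition prolongable_at (A : finType) (sigma : seq A -> seq A) (c : A) :
    Prop :=
  exists W : seq A,
    sigma [:: c] = c :: W /\ forall n : nat, iter n sigma W <> [::].

(* Convergence in the product topology of finite words to an infinite word:
   a finite word w is viewed as the sequence [onth w] over the discrete
   alphabet [option A], the value [None] marking the positions beyond the end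
   of w; convergence then means that each position is eventually constant. *)
Definition words_converge (A : finType) (w : nat -> seq A) (x : nat -> A) :
    Prop :=
  forall k : nat, exists N : nat, forall n : nat, (N <= n)%N ->
    onth (w n) k = Some (x k).

Definition recurrent_word (A : finType) (x : nat -> A) : Prop :=
  forall k : nat, exists i j : nat, [/\ i <> j, x i = x k & x j = x k].

(* The target alphabet of the coding is the finite set phi(A), so that b may
   take its values in any type T. *)
Definition generated_by_recurrent_morphism (T : Type) (b : nat -> T) : Prop :=
  exists (A : finType) (sigma : seq A -> seq A) (c : A) (x : nat -> A)
         (phi : A -> T),
    [/\ word_morphism sigma,
        prolongable_at sigma c,
        words_converge (fun n => iter n sigma [:: c]) x,
        recurrent_word x
      & forall k : nat, b k = phi (x k)].

(* Main.v *)
(** Put [theta = 1/(alpha - a_0)].  A recurrent morphism returns to its prefixes: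
    there are [l] of every order of magnitude such that the [l]-th complete
    quotient [theta_l] agrees with [theta] on a number of partial quotients
    proportional to [l].  If [M_l] is the matrix of convergents with
    [theta = M_l theta_l] and [Q_l] its denominator, then [theta_l - theta] is
    smaller than a fixed negative power of [Q_l], while the partial quotients are
    bounded.

    The four entries of [M_l] form the integer point [m] of a hyperplane in
    dimension 4.  Its integer points [Y] correspond to integer triples [y]
    through [Y = M_l^-T N(y)] with [N(y)] of trace zero, and four linear forms with
    coefficients in [Z[theta]] are simultaneously small at [Y] as soon as [y] is
    close to a multiple of [(1, theta, -theta^2)].  The Davenport-Schmidt argument
    on exact uniform approximation, run with exponents 4 and 11, together with an
    elementary transference principle, produces three independent such [y]; it
    needs that [theta] is badly approximable and not quadratic.

    Hence for infinitely many [l], as sparse as desired, three independent vectors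
    of the hyperplane make the product of the four forms at most [Q_l^-delta].
    Siegel's lemma and a Chebyshev estimate yield a nonzero symmetric integral
    tensor that vanishes on the products of these vectors, and after restriction to
    two coordinates a polynomial of large index at the points
    [-Q_(l-1)/Q_l], which contradicts Roth's lemma. *)

Require Import Defs.
From HB Require Import structures.
From mathcomp Require Import all_boot all_order all_algebra all_fingroup.
From mathcomp Require Import all_classical all_reals all_analysis.
From mathcomp Require Import zify ring lra.

Set Implicit Arguments.
Unset Strict Implicit.
Unset Printing Implicit Defensive.

Import Order.TTheory GRing.Theory Num.Theory.
Import numFieldNormedType.Exports.

Local Open Scope ring_scope.

(** * Wronskians *)

(** The exponents 4 and 11 are constrained from both sides. A short [y] has size about [Z^11] and
    lies within about [Z^-4] of the line; at the corresponding [Y] three of the forms carry a factor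
    [Z^-4] and one a factor [Z^11], while the powers of [Q_l] cancel. The product is about [Z^-1],
    so a gain requires 11/4 < 3. With [w] the ratio of the two exponents, the Davenport-Schmidt
    argument closes only if [w^2 - 3w + 1 > 0], that is 11/4 > (3 + sqrt 5)/2. Bounded partial
    quotients and the proportional length of the repetitions keep [Q_l] below a fixed power of [Z],
    which turns [Z^-1] into [Q_l^-delta].

    A single small point would not be enough, since small points may lie in an unknown subspace of
    lower dimension. Three independent ones span the hyperplane itself. Its normal vector
    [(Q_l, Q_(l-1), P_l, P_(l-1))] is known and has height comparable to [Q_l], and the quotient of
    its first two coordinates gives a reduced fraction with denominator [Q_l]. This is the
    arithmetic input that Roth's lemma requires. *)

Definition torsion_free (R : zmodType) := forall n (x : R), x *+ n.+1 = 0 -> x = 0.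

Lemma torsion_free_poly (R : nzRingType) :
  torsion_free R -> torsion_free {poly R}.
Proof.
move=> tfR n p /polyP pn0; apply/polyP=> i; rewrite coef0.
by apply: (tfR n); move: (pn0 i); rewrite coefMn coef0.
Qed.

Lemma torsion_free_mulrnI (R : zmodType) n (x y : R) :
  torsion_free R -> (0 < n)%N -> x *+ n = y *+ n -> x = y.
Proof.
case: n => // n tfR _ /eqP; rewrite -subr_eq0 -mulrnBl => /eqP /tfR /eqP.
by rewrite subr_eq0 => /eqP.
Qed.

Lemma natr_inj_torsion_free (R : nzRingType) :
  torsion_free R -> injective (fun n => n%:R : R).
Proof.
move=> tfR; suff le m n : (m <= n)%N -> m%:R = n%:R :> R -> m = n.
  by move=> m n /=; case/orP: (leq_total m n) => h e; [|apply: esym]; apply: le.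
move=> mn /eqP; rewrite eq_sym -subr_eq0 -natrB //; case E: (n - m)%N => [|k].
  by move=> _; apply/eqP; rewrite eqn_leq mn -subn_eq0 E.
by move=> /eqP/tfR/eqP; rewrite oner_eq0.
Qed.

Lemma coef_size_le (R : nzSemiRingType) (p : {poly R}) n i :
  (size p <= n)%N -> (n <= i)%N -> p`_i = 0.
Proof. by move=> sp ni; rewrite nth_default // (leq_trans sp). Qed.

Section Wronskian.
Variable R : idomainType.
Hypothesis tfR : torsion_free R.

Definition combination k (c : 'I_k -> R) (g : 'I_k -> {poly R}) :=
  \sum_i c i *: g i.

(** Fraction-free Gaussian elimination on one degree at a time: a pivot clears the coefficient of
    degree [e] in the other polynomials, and the elements of [K] without this coefficient have their
    degrees in a shorter list. *)
Lemma dependent_few_degrees (rts : seq nat) (K : {poly R} -> Prop) :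
  (forall c d p q, K p -> K q -> K (c *: p + d *: q)) ->
  (forall p, K p -> p != 0 -> (size p).-1 \in rts) ->
  forall k (g : 'I_k -> {poly R}), (size rts < k)%N -> (forall i, K (g i)) ->
  exists2 c : 'I_k -> R, (exists i, c i != 0) & combination c g = 0.
Proof.
elim: rts K => [|e rts IH] K Kcl Kdeg [//|k] g ltk gK.
  exists (fun=> 1); first by exists ord0; rewrite oner_eq0.
  rewrite /combination big1 // => i _; rewrite scale1r.
  by case: (eqVneq (g i) 0) => // /(Kdeg _ (gK i)).
pose K' p := K p /\ p`_e = 0.
have K'cl c d p q : K' p -> K' q -> K' (c *: p + d *: q).
  move=> [Kp pe] [Kq qe]; split; first exact: Kcl.
  by rewrite coefD !coefZ pe qe !mulr0 addr0.
have K'deg p : K' p -> p != 0 -> (size p).-1 \in rts.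
  move=> [Kp pe] p0; move: (Kdeg _ Kp p0); rewrite inE => /orP[/eqP E|//].
  by move: p0; rewrite -lead_coef_eq0 lead_coefE E pe eqxx.
case: (boolP [exists i, (g i)`_e != 0]) => [/existsP[i0 gi0]|]; last first.
  rewrite negb_exists => /forallP h; apply: (IH K') => //; first exact: ltnW.
  by move=> i; split=> //; apply/eqP; move: (h i); rewrite negbK.
pose a := (g i0)`_e.
pose g' j := a *: g (lift i0 j) + (- (g (lift i0 j))`_e) *: g i0.
have [j|c [j0 cj0] cE] := IH K' K'cl K'deg k g' ltk.
  by split; [exact: Kcl | rewrite coefD !coefZ mulNr mulrC subrr].
pose b := - \sum_j c j * (g (lift i0 j))`_e.
pose c' i := if unlift i0 i is Some j then c j * a else b.
exists c'; first by exists (lift i0 j0); rewrite /c' liftK mulf_neq0.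
rewrite /combination (bigD1_ord i0) //= {1}/c' unlift_none.
under eq_bigr => j _ do rewrite /c' liftK.
rewrite -[RHS]cE /combination /b scaleNr scaler_suml -sumrN -big_split /=.
apply: eq_bigr => j _; rewrite /g' scalerDr !scalerA mulrN scaleNr addrC.
by [].
Qed.

Lemma coef_mul_nderivn (v g : {poly R}) a n i :
  (size g <= n.+1)%N -> (a <= n)%N -> (n - a <= i)%N ->
  (size v <= (i - (n - a)).+1)%N ->
  (v * g^`N(a))`_i = v`_(i - (n - a)) * (g`_n *+ 'C(n, a)).
Proof.
move=> sg an ni sv; rewrite coefM.
have lt : (i - (n - a) < i.+1)%N by rewrite ltnS leq_subr.
rewrite (bigD1 (Ordinal lt)) //= coef_nderivn.
have -> : (a + (i - (i - (n - a))) = n)%N by rewrite subKn // subnKC.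
rewrite big1 ?addr0 // => j; rewrite -val_eqE /= => nej.
have ji := ltn_ord j.
case: (ltnP j (i - (n - a))) => hj.
  by rewrite coef_nderivn (coef_size_le sg) ?mul0rn ?mulr0 //; lia.
by rewrite (coef_size_le sv) ?mul0r //; lia.
Qed.

(** The indicial polynomial at infinity of a differential operator: the divided derivative of order
    [a] multiplies the leading term of a polynomial of degree [n] by ['C(n, a)]. *)
Definition binomial_comb k (c : 'I_k -> R) (n : nat) := \sum_a c a *+ 'C(n, a).

Lemma binomial_comb_roots k (c : 'I_k -> R) (s : seq nat) :
  (exists a, c a != 0) -> uniq s -> all (fun n => binomial_comb c n == 0) s ->
  (size s < k)%N.
Proof.
move=> [a0 ca0] us alls.
pose ff a : {poly R} := \prod_(j <- iota 0 a) ('X - j%:R%:P).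
have ffE a n : (ff a).[n%:R] = 'C(n, a)%:R * a`!%:R.
  rewrite /ff horner_prod -natrM bin_ffact.
  elim: a => [|a IH]; first by rewrite big_nil ffactn0.
  rewrite -[a.+1]addn1 iotaD add0n big_cat big_seq1 /= IH hornerXsubC addn1 ffactnSr natrM.
  case: (leqP a n) => h; first by rewrite natrB.
  by rewrite ffact_small // !mul0r.
have sff a : size (ff a) = a.+1 by rewrite size_prod_XsubC size_iota.
have mff a : ff a \is monic by exact: monic_prod_XsubC.
(* The factor k factorial clears the denominators of the binomial coefficients, so that the indicial
   polynomial has coefficients in [R]; its degree is less than [k]. *)
pose chi := \sum_(a < k) (c a *+ (k`! %/ a`!)) *: ff a.
have kga (a : 'I_k) : ((k`! %/ a`!) * a`! = k`!)%N.
  rewrite divnK //; have := ffact_fact (leq_subr a k).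
  by rewrite subKn ?(ltnW (ltn_ord a)) // => <-; rewrite dvdn_mull.
have chiE n : chi.[n%:R] = binomial_comb c n *+ k`!.
  rewrite horner_sum /binomial_comb -sumrMnl; apply: eq_bigr => a _.
  rewrite hornerZ ffE -natrM mulr_natr -!mulrnA; congr (_ *+ _).
  by rewrite mulnCA kga.
have chi0 : chi != 0.
  have [a1 ca1 maxa] := @arg_maxnP _ a0 (fun a => c a != 0) (fun a : 'I_k => a : nat) ca0.
  apply/eqP => /polyP /(_ a1); rewrite coef0 coef_sum (bigD1 a1) //= big1.
    have := monicP (mff a1); rewrite lead_coefE sff /= addr0 coefZ => ->.
    rewrite mulr1 => /eqP; apply/negP.
    case E: (k`! %/ a1`!)%N => [|n]; last by apply: contraNN ca1 => /eqP /tfR ->.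
    by have := fact_gt0 k; rewrite -(kga a1) E.
  move=> a nea; rewrite coefZ; case: (eqVneq (c a) 0) => [->|ca].
    by rewrite mul0rn mul0r.
  rewrite nth_default ?mulr0 // sff ltn_neqAle (inj_eq val_inj) nea.
  exact: maxa.
have := @max_poly_roots _ chi [seq n%:R | n <- s] chi0.
rewrite size_map (map_inj_uniq (natr_inj_torsion_free tfR)) us.
have -> : all (root chi) [seq n%:R | n <- s].
  rewrite all_map; apply: sub_all alls => n /eqP h /=.
  by rewrite rootE chiE h mul0rn.
move=> /(_ isT isT) h; apply: (leq_trans h); apply: (leq_trans (size_sum _ _ _)).
apply/bigmax_leqP => a _; apply: leq_trans (size_scale_leq _ _) _.
by rewrite sff.
Qed.

(** A left kernel vector of the matrix is a linear differential equation of order less than [k]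
    solved by every [g s]. The degree of a nonzero solution is a root of the indicial polynomial, so
    there are fewer than [k] possible degrees, and [k] solutions must be dependent. *)
Lemma wronskian_neq0 k (g : 'I_k -> {poly R}) :
  (forall c : 'I_k -> R, combination c g = 0 -> forall i, c i = 0) ->
  \det (\matrix_(a < k, s < k) (g s)^`N(a)) != 0.
Proof.
move=> indep; apply/negP => /det0P [v v0 vE].
have [a0 va0] : exists a0, v 0 a0 != 0.
  apply/existsP; move: v0; apply: contraNT; rewrite negb_exists => /forallP h.
  by apply/eqP/rowP => a; rewrite mxE; apply/eqP; move: (h a); rewrite negbK.
pose mu (a : 'I_k) := (size (v 0%R a) + (k - a))%N.
have [a1 va1 maxa] := @arg_maxnP _ a0 (fun a => v 0 a != 0) mu va0.
pose c a := if (v 0 a != 0) && (mu a == mu a1) then lead_coef (v 0 a) else 0.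
pose B := \max_s size (g s).
pose K (p : {poly R}) := (size p <= B)%N /\ \sum_a v 0 a * p^`N(a) = 0.
pose rts := [seq n <- iota 0 B | binomial_comb c n == 0].
have szr : (size rts < k)%N.
  apply: (binomial_comb_roots (c := c)); rewrite ?filter_uniq ?iota_uniq ?filter_all //.
  by exists a1; rewrite /c va1 eqxx lead_coef_eq0.
have Kcl x y p q : K p -> K q -> K (x *: p + y *: q).
  move=> [sp Lp] [sq Lq]; split.
    apply: leq_trans (size_polyD _ _) _; rewrite geq_max.
    by rewrite !(leq_trans (size_scale_leq _ _)).
  under eq_bigr => a _ do rewrite nderivnD !nderivnZ mulrDr -!scalerAr.
  by rewrite big_split /= -!scaler_sumr Lp Lq !scaler0 addr0.
have Kdeg p : K p -> p != 0 -> (size p).-1 \in rts.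
  move=> [sp Lp] p0; pose n := (size p).-1.
  have sn : size p = n.+1 by rewrite prednK // lt0n size_poly_eq0.
  suff chi0 : binomial_comb c n = 0.
    by rewrite mem_filter chi0 eqxx mem_iota /= add0n -/n -sn.
  case: (boolP [exists a, (c a != 0) && (a <= n)%N]); last first.
    rewrite negb_exists => /forallP h; rewrite /binomial_comb big1 // => a _.
    move: (h a); rewrite negb_and negbK => /orP[/eqP ->|]; first by rewrite mul0rn.
    by rewrite -ltnNge => an; rewrite bin_small.
  case/existsP => a2 /andP [ca2 a2n].
  have [va2 mua2] : v 0 a2 != 0 /\ mu a2 = mu a1.
    move: ca2; rewrite /c; case: (eqVneq (mu a2) (mu a1)) => [->|_]; rewrite ?andbF ?eqxx //.
    by rewrite andbT; case: (boolP (v 0 a2 != 0)) => //; rewrite eqxx.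
  (* The highest degree that the equation applied to [p] can reach; its coefficient there is the
     leading coefficient of [p] times the indicial polynomial at [n]. *)
  pose i := ((size (v 0%R a2)).-1 + (n - a2))%N.
  have sa2 : (0 < size (v 0%R a2))%N by rewrite lt0n size_poly_eq0.
  have a2k := ltn_ord a2.
  have term (a : 'I_k) : (v 0 a * p^`N(a))`_i = p`_n * (c a *+ 'C(n, a)).
    have ak := ltn_ord a.
    have [an|an] := leqP a n; last first.
      rewrite bin_small // mulr0n mulr0.
      suff -> : p^`N(a) = 0 by rewrite mulr0 coef0.
      apply/polyP => j; rewrite coef_nderivn coef0 (@coef_size_le _ p n.+1) ?sn ?mul0rn //.
      by rewrite (leq_trans an) // leq_addr.
    have [va|va] := eqVneq (v 0 a) 0.
      by rewrite /c va eqxx /= mul0r coef0 mul0rn mulr0.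
    have sa : (0 < size (v 0%R a))%N by rewrite lt0n size_poly_eq0.
    have := maxa a va; rewrite -mua2 /mu => mua.
    rewrite (@coef_mul_nderivn _ _ _ n) ?sn //; try by rewrite /i; lia.
    rewrite /c va /= -mua2 /mu; case: eqP => E.
      have -> : (i - (n - a))%N = (size (v 0%R a)).-1 by rewrite /i; lia.
      by rewrite -lead_coefE mulrnAr mulrC -mulrnAr.
    by rewrite (@coef_size_le _ (v 0 a) (size (v 0 a))) ?mul0r ?mul0rn ?mulr0 // /i; lia.
  move/polyP/(_ i): Lp; rewrite coef0 coef_sum.
  under eq_bigr => a _ do rewrite term.
  rewrite -mulr_sumr => /eqP; rewrite mulf_eq0.
  by rewrite -lead_coefE lead_coef_eq0 (negPf p0) /= => /eqP.
have [s|cc [s cs] /indep /(_ s) E] := @dependent_few_degrees rts K Kcl Kdeg k g szr.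
  split; first by rewrite /B (@leq_bigmax _ (fun s => size (g s))).
  by move/rowP/(_ s): vE; rewrite mxE [RHS]mxE => E; rewrite -[RHS]E; apply: eq_bigr => a _; rewrite mxE.
by rewrite E eqxx in cs.
Qed.
End Wronskian.

(** * Roth's lemma *)

(** Polynomials in [m] variables, with variable 0 outermost: every notion below peels off variable
    0, and [sh] discards its weight, degree or coordinate. *)
Fixpoint MP (m : nat) : idomainType :=
  if m is m'.+1 then {poly MP m'} else rat.

Fixpoint cst (m : nat) : {rmorphism rat -> MP m} :=
  match m return {rmorphism rat -> MP m} with
  | 0 => idfun
  | m'.+1 => (@polyC (MP m') \o cst m')
  end.

Definition sh (T : Type) (w : nat -> T) := fun i => w i.+1.

(** The Taylor shift moving the point [xi] to the origin, where the order of vanishing is read off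
    from the monomials. *)
Fixpoint tr (m : nat) (xi : nat -> rat) : {rmorphism MP m -> MP m} :=
  match m return {rmorphism MP m -> MP m} with
  | 0 => idfun
  | m'.+1 => (comp_poly ('X + (cst m' (xi 0%N))%:P) \o map_poly (tr m' (sh xi)))
  end.

(** Every monomial of [F] has weighted degree at least [x], or more than [x] if [b] is set. A
    relation avoids an infinite value at 0, and the index is exactly [x] when the property holds
    without the flag and fails with it. *)
Fixpoint vg (m : nat) (b : bool) (w : nat -> rat) : MP m -> rat -> Prop :=
  match m return MP m -> rat -> Prop with
  | 0 => fun F x => F = 0 \/ (if b then x < 0 else x <= 0)
  | m'.+1 => fun F x =>
      forall i, @vg m' b (sh w) ((F : {poly MP m'})`_i) (x - i%:R * w 0%N)
  end.
Arguments vg : clear implicits.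

Fixpoint nrm (m : nat) : MP m -> rat :=
  match m return MP m -> rat with
  | 0 => fun F => `|F|
  | m'.+1 => fun F => \sum_(i < size (F : {poly MP m'})) @nrm m' ((F : {poly MP m'})`_i)
  end.
Arguments nrm : clear implicits.

Fixpoint dg (m : nat) (d : nat -> nat) : MP m -> Prop :=
  match m return MP m -> Prop with
  | 0 => fun=> True
  | m'.+1 => fun F => (size (F : {poly MP m'}) <= (d 0%N).+1)%N /\
                      forall i, @dg m' (sh d) ((F : {poly MP m'})`_i)
  end.
Arguments dg : clear implicits.

Fixpoint itg (m : nat) : MP m -> Prop :=
  match m return MP m -> Prop with
  | 0 => fun F => F \is a Num.int
  | m'.+1 => fun F => forall i, @itg m' ((F : {poly MP m'})`_i)
  end.
Arguments itg : clear implicits.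

Lemma tf_MP m : torsion_free (MP m).
Proof.
elim: m => [|m IH]; last exact: torsion_free_poly.
by move=> n x /= /eqP; rewrite mulrn_eq0 /= => /eqP.
Qed.

(** * Weighted order of vanishing *)

Section Valuation.

Lemma vg0 m b w x : vg m b w 0 x.
Proof.
elim: m w x => [|m IH] w x /=; first by left.
by move=> i; rewrite coef0; apply: IH.
Qed.

Lemma vg_weak m b w F x y : y <= x -> vg m b w F x -> vg m b w F y.
Proof.
elim: m w F x y => [|m IH] w F x y yx /=.
  by case=> [|h]; [left | right; case: b h => h; [exact: le_lt_trans h | exact: le_trans h]].
by move=> h i; apply: IH (h i); rewrite lerD2r.
Qed.

Lemma vg_strict m w F x y : y < x -> vg m false w F x -> vg m true w F y.
Proof.
elim: m w F x y => [|m IH] w F x y yx /=.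
  by case=> [|h]; [left | right; exact: lt_le_trans h].
by move=> h i; apply: IH (h i); rewrite ltrD2r.
Qed.

Lemma vg_triv m w F x : (forall i, 0 <= w i) -> x <= 0 -> vg m false w F x.
Proof.
elim: m w F x => [|m IH] w F x w0 x0 /=; first by right.
move=> i; apply: IH => [j|]; first exact: w0.
by rewrite subr_le0 (le_trans x0) // mulr_ge0 ?w0.
Qed.

Lemma vgD m b w F G x : vg m b w F x -> vg m b w G x -> vg m b w (F + G) x.
Proof.
elim: m w F G x => [|m IH] w F G x /=.
  by move=> [->|h]; [rewrite add0r | right].
by move=> h k i; rewrite coefD; apply: IH.
Qed.

Lemma vgN m b w F x : vg m b w F x -> vg m b w (- F) x.
Proof.
elim: m w F x => [|m IH] w F x /=.
  by move=> [->|h]; [left; rewrite oppr0 | right].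
by move=> h i; rewrite coefN; apply: IH.
Qed.

Lemma vgMn m b w F x n : vg m b w F x -> vg m b w (F *+ n) x.
Proof.
by move=> h; elim: n => [|n IH]; [rewrite mulr0n; exact: vg0 | rewrite mulrS; exact: vgD].
Qed.

Lemma vg_sum m b w (I : Type) (r : seq I) (P : pred I) F x :
  (forall i, P i -> vg m b w (F i) x) -> vg m b w (\sum_(i <- r | P i) F i) x.
Proof.
move=> h; elim/big_rec: _ => [|i y Pi yv]; first exact: vg0.
by apply: vgD => //; apply: h.
Qed.

Lemma vgM m b c w F G x y :
  vg m b w F x -> vg m c w G y -> vg m (b || c) w (F * G) (x + y).
Proof.
elim: m w F G x y => [|m IH] w F G x y /=.
  case=> [->|h]; first by left; rewrite mul0r.
  case=> [->|k]; first by left; rewrite mulr0.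
  by right; case: b c h k => [] [] /= h k; lra.
move=> h k i; rewrite coefM; apply: vg_sum => j _.
apply: vg_weak (IH _ _ _ _ _ (h j) (k (i - j)%N)).
have := ltn_ord j; rewrite ltnS => ji.
by rewrite natrB // le_eqVlt; apply/orP; left; apply/eqP; ring.
Qed.

Lemma vg_prod m w (I : Type) (r : seq I) (P : pred I) (F : I -> MP m) (x : I -> rat) :
  (forall i, 0 <= w i) ->
  (forall i, P i -> vg m false w (F i) (x i)) ->
  vg m false w (\prod_(i <- r | P i) F i) (\sum_(i <- r | P i) x i).
Proof.
move=> w0 h; elim/big_rec2: _ => [|i y F' Pi Fv]; first exact: vg_triv.
by apply: (@vgM _ false false) => //; apply: h.
Qed.

Lemma val_exists m w F : F != 0 ->
  exists a, vg m false w F a /\ ~ vg m true w F a.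
Proof.
elim: m w F => [|m IH] w F F0 /=.
  exists 0; split; first by right.
  by case=> [E|]; [rewrite E eqxx in F0 | rewrite ltxx].
pose n := size (F : {poly MP m}).
have /fin_all_exists [a ha] (i : 'I_n) : exists a, (F : {poly MP m})`_i != 0 ->
    vg m false (sh w) (F : {poly MP m})`_i a /\
    ~ vg m true (sh w) (F : {poly MP m})`_i a.
  case: (eqVneq (F : {poly MP m})`_i 0) => [|/(IH (sh w)) [a ha]]; first by exists 0.
  by exists a.
have n0 : (n.-1 < n)%N by rewrite ltn_predL lt0n size_poly_eq0.
have F0' : (F : {poly MP m})`_(Ordinal n0) != 0 by rewrite /= -lead_coefE lead_coef_eq0.
pose f (i : 'I_n) := a i + (i : nat)%:R * w 0%N.
have [i Fi mini] := @arg_minP _ _ _ (Ordinal n0) (fun i : 'I_n => (F : {poly MP m})`_i != 0) f F0'.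
exists (f i); split=> [j|/(_ i)].
  case: (eqVneq (F : {poly MP m})`_j 0) => [->|Fj]; first exact: vg0.
  have jn : (j < n)%N by rewrite ltnNge; apply: contra Fj => ?; rewrite nth_default.
  have [vj _] := ha (Ordinal jn) Fj; apply: vg_weak vj.
  by have := mini (Ordinal jn) Fj; rewrite /f /= lerBlDr.
rewrite /f addrK; exact: (ha i Fi).2.
Qed.

(** The index is a valuation. For each factor take the least power of the outer variable at which
    the strict bound fails; in the product, every other term contributing to the sum of these two
    powers satisfies the strict bound. *)
Lemma val_mul m w F G a b : vg m false w F a -> ~ vg m true w F a ->
  vg m false w G b -> ~ vg m true w G b -> ~ vg m true w (F * G) (a + b).
Proof.
elim: m w F G a b => [|m IH] w F G a b /=.
  move=> [E nF|ha nF]; first by case: nF; left.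
  move=> [E nG|hb nG]; first by case: nG; left.
  move=> [/eqP|h].
    rewrite mulf_eq0 => /orP[/eqP E|/eqP E]; [by apply: nF; left | by apply: nG; left].
  have [ha'|ha'] := ltP a 0; first by apply: nF; right.
  have [hb'|hb'] := ltP b 0; first by apply: nG; right.
  by lra.
have least (H : {poly MP m}) c : ~ (forall i, vg m true (sh w) H`_i (c - i%:R * w 0%N)) ->
    exists2 i, ~ vg m true (sh w) H`_i (c - i%:R * w 0%N) &
      forall j, (j < i)%N -> vg m true (sh w) H`_j (c - j%:R * w 0%N).
  move=> /existsNP [i0 ni0].
  have ex : exists i, `[< ~ vg m true (sh w) H`_i (c - i%:R * w 0%N) >].
    by exists i0; apply/asboolP.
  case: (ex_minnP ex) => i /asboolP ni mi; exists i => // j ji.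
  by apply: contrapT => nj; have := mi j (asboolT nj); rewrite leqNgt ji.
move=> Fa /least [i0 nFi mi] Gb /least [j0 nGj mj] FG.
apply: (IH _ _ _ _ _ (Fa i0) nFi (Gb j0) nGj).
have lt : (i0 < (i0 + j0).+1)%N by rewrite ltnS leq_addr.
have := FG (i0 + j0)%N; rewrite coefM (bigD1 (Ordinal lt)) //= addKn.
set r := (X in _ + X); set c := (X in vg _ _ _ _ X) => h.
have cE : a - i0%:R * w 0%N + (b - j0%:R * w 0%N) = c by rewrite /c natrD; ring.
rewrite cE; suff vr : vg m true (sh w) r c.
  by have := vgD h (vgN vr); rewrite addrK.
apply: vg_sum => k; rewrite -val_eqE /= => nek.
have kl := ltn_ord k.
have kE : a - (k : nat)%:R * w 0%N + (b - (i0 + j0 - k)%N%:R * w 0%N) = c.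
  by rewrite /c natrB ?natrD //; ring.
rewrite -kE; have [ki|ki] := ltnP k i0; first by apply: (@vgM _ true false); [apply: mi | apply: Gb].
by apply: (@vgM _ false true); [apply: Fa | apply: mj; lia].
Qed.

Lemma vg_polyC m b w (c : MP m) x :
  vg m.+1 b w (c%:P : {poly MP m}) x <-> vg m b (sh w) c x.
Proof.
split=> [/(_ 0%N)|h [|i]]; rewrite coefC /= ?mul0r ?subr0 //.
exact: vg0.
Qed.

(** Data for the variables other than variable 1. A polynomial free of variable 1 is embedded by
    [map_poly polyC]. *)
Definition skip1 (T : Type) (w : nat -> T) := fun i => if i is j.+1 then w j.+2 else w 0%N.

Lemma vg_map_polyC m b w (G : {poly MP m}) x :
  vg m.+2 b w (map_poly (@polyC (MP m)) G : {poly {poly MP m}}) x <->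
  vg m.+1 b (skip1 w) G x.
Proof.
have E i : (map_poly (@polyC (MP m)) G)`_i = (G`_i)%:P by rewrite coef_map.
split=> h i; have := h i; rewrite ?E; first by move/(@vg_polyC m b (sh w)).
by move=> h'; apply/(@vg_polyC m b (sh w)).
Qed.

Lemma vg_nderivn m b w (F : {poly MP m}) x a :
  vg m.+1 b w F x -> vg m.+1 b w (F^`N(a)) (x - a%:R * w 0%N).
Proof.
move=> h i; rewrite coef_nderivn; apply: vgMn; apply: vg_weak (h (a + i)%N).
by rewrite natrD le_eqVlt; apply/orP; left; apply/eqP; ring.
Qed.

Lemma vg_inner_nderivn m b w (F : {poly {poly MP m}}) x a :
  vg m.+2 b w F x ->
  vg m.+2 b w (map_poly (nderivn a) F) (x - a%:R * w 1%N).
Proof.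
move=> h i; rewrite coef_map_id0 ?nderivn0; last by rewrite linear0.
apply: vg_weak (vg_nderivn (m := m) (w := sh w) a (h i)).
by rewrite le_eqVlt; apply/orP; left; apply/eqP; rewrite /sh; ring.
Qed.

(** Each term of the determinant takes one entry from each column. Bounds by columns suffice since,
    in the mixed Wronskian, the column index is the order of derivation in the variable of larger
    weight. *)
Lemma vg_det m w k (M : 'M[MP m]_k) (x : 'I_k -> rat) :
  (forall i, 0 <= w i) ->
  (forall a b, vg m false w (M a b) (x b)) ->
  vg m false w (\det M) (\sum_b x b).
Proof.
move=> w0 h; apply: vg_sum => s _; rewrite -[X in vg _ _ _ _ X]add0r.
apply: (@vgM _ false false); first exact: vg_triv.
by rewrite [X in vg _ _ _ _ X](reindex_inj (@perm_inj _ s)) /=; apply: vg_prod.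
Qed.

End Valuation.

(** * Translations and divided derivatives *)

(** Multiplied by the factorial of [a], a divided derivative becomes an iterated one, for which the
    chain rule applies; the factorial is cancelled by torsion-freeness. *)
Lemma nderivn_translation (R : idomainType) (p : {poly R}) c a :
  torsion_free R -> (p \Po ('X + c%:P))^`N(a) = p^`N(a) \Po ('X + c%:P).
Proof.
move=> tfR; apply: (torsion_free_mulrnI (torsion_free_poly tfR) (fact_gt0 a)).
rewrite -nderivn_def -raddfMn /= -nderivn_def.
elim: a => [|a IH]; first by rewrite !derivn0.
by rewrite !derivnS IH deriv_comp derivD derivX derivC addr0 mulr1.
Qed.

(** [map_poly polyC h] involves only the outer variable, hence is a constant for the derivation in
    the inner one. *)
Lemma inner_nderivnM (R : idomainType) (G : {poly {poly R}}) (h : {poly R}) b :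
  map_poly (nderivn b) (G * map_poly polyC h) =
  map_poly (nderivn b) G * map_poly polyC h.
Proof.
apply/polyP => i; rewrite coef_map_id0 ?linear0 // !coefM raddf_sum.
apply: eq_bigr => j _; rewrite /= coef_map_id0 ?linear0 // !coef_map /=.
by rewrite mulrC mul_polyC nderivnZ -mul_polyC mulrC.
Qed.

Lemma inner_nderivn_translation (R : idomainType) (F : {poly {poly R}}) (c : R) b :
  map_poly (nderivn b) (F \Po ('X + c%:P%:P)) =
  map_poly (nderivn b) F \Po ('X + c%:P%:P).
Proof.
have qE : 'X + c%:P%:P = map_poly polyC ('X + c%:P) :> {poly {poly R}}.
  by rewrite rmorphD /= map_polyX map_polyC.
have DD (p q : {poly {poly R}}) :
    map_poly (nderivn b) (p + q) = map_poly (nderivn b) p + map_poly (nderivn b) q.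
  by apply/polyP => i; rewrite coefD !coef_map_id0 ?linear0 // coefD linearD.
elim/poly_ind: F => [|p u IH].
  by rewrite comp_poly0 map_poly0 comp_poly0.
have DX : map_poly (nderivn b) (p * 'X) = map_poly (nderivn b) p * 'X.
  by rewrite -(map_polyX (@polyC R)) inner_nderivnM.
have DC : map_poly (nderivn b) u%:P = (u^`N(b))%:P.
  by apply/polyP => i; rewrite coef_map_id0 ?linear0 // !coefC; case: eqP; rewrite ?linear0.
rewrite comp_polyD comp_polyM comp_polyX comp_polyC !DD DX DC.
rewrite comp_polyD comp_polyM comp_polyX comp_polyC -IH.
by rewrite {2}qE inner_nderivnM -qE.
Qed.

Lemma tr_nderivn m xi (F : {poly MP m}) a :
  tr m.+1 xi (F^`N(a)) = (tr m.+1 xi F : {poly MP m})^`N(a).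
Proof.
by rewrite /= -nderivn_map nderivn_translation //; exact: tf_MP.
Qed.

Lemma tr_inner_nderivn m xi (F : {poly {poly MP m}}) b :
  tr m.+2 xi (map_poly (nderivn b) F) =
  map_poly (nderivn b) (tr m.+2 xi F : {poly {poly MP m}}).
Proof.
rewrite [tr]lock /= -!lock [LHS]/= [X in _ = map_poly _ X]/=.
rewrite inner_nderivn_translation; congr (_ \Po _).
apply/polyP => i; rewrite coef_map coef_map_id0 ?linear0 //.
rewrite coef_map_id0 ?linear0 // coef_map.
exact: (tr_nderivn (m := m)).
Qed.

Lemma tr_polyC m xi (c : MP m) : tr m.+1 xi (c%:P : {poly MP m}) = (tr m (sh xi) c)%:P.
Proof. by rewrite /= map_polyC comp_polyC. Qed.

Lemma tr_map_polyC m xi (G : {poly MP m}) :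
  tr m.+2 xi (map_poly polyC G : {poly {poly MP m}}) =
  map_poly (@polyC (MP m)) (tr m.+1 (skip1 xi) G : {poly MP m}).
Proof.
rewrite [tr]lock /= -!lock [LHS]/= [tr m.+1 _]lock /= -lock.
rewrite [X in _ = map_poly _ X]/= map_comp_poly rmorphD /= map_polyX map_polyC /=.
congr (_ \Po _); apply/polyP => i; rewrite !coef_map.
exact: tr_polyC.
Qed.

(** * Coefficient norm, integrality and partial degrees *)

Lemma nrm_ge0 m F : 0 <= nrm m F.
Proof. by elim: m F => [|m IH] F /=; [exact: normr_ge0 | exact: sumr_ge0]. Qed.

Lemma nrm0 m : nrm m 0 = 0.
Proof. by case: m => [|m] /=; rewrite ?normr0 // size_poly0 big_ord0. Qed.

Lemma nrmE m (F : {poly MP m}) N : (size F <= N)%N ->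
  nrm m.+1 F = \sum_(i < N) nrm m F`_i.
Proof.
move=> sN; rewrite /= -!(big_mkord xpredT (fun i => nrm m F`_i)).
rewrite [RHS](big_cat_nat (leq0n _) sN) /= [X in _ = _ + X](_ : _ = 0) ?addr0 //.
rewrite big_nat_cond big1 // => i; move=> /andP[/andP[h _] _]; by rewrite nth_default ?nrm0.
Qed.

Lemma nrmD m F G : nrm m (F + G) <= nrm m F + nrm m G.
Proof.
elim: m F G => [|m IH] F G; first exact: ler_normD.
pose N := maxn (size (F : {poly MP m})) (size (G : {poly MP m})).
rewrite !(@nrmE _ _ N) ?leq_maxl ?leq_maxr ?(size_polyD (F : {poly MP m})) //.
by rewrite -big_split ler_sum // => i _; rewrite coefD.
Qed.

Lemma nrmN m F : nrm m (- F) = nrm m F.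
Proof.
elim: m F => [|m IH] F; first exact: normrN.
by rewrite /= size_polyN; apply: eq_bigr => i _; rewrite coefN IH.
Qed.

Lemma nrmMn m F n : nrm m (F *+ n) <= nrm m F * n%:R.
Proof.
elim: n => [|n IH]; first by rewrite mulr0n nrm0 mulr0.
by rewrite mulrS (le_trans (nrmD _ _)) // -natr1 mulrDr mulr1 addrC lerD2r.
Qed.

Lemma nrm_sum m (I : Type) (r : seq I) (P : pred I) (F : I -> MP m) :
  nrm m (\sum_(i <- r | P i) F i) <= \sum_(i <- r | P i) nrm m (F i).
Proof.
elim/big_rec2: _ => [|i x y Pi h]; first by rewrite nrm0.
by rewrite (le_trans (nrmD _ _)) // lerD2l.
Qed.

Lemma nrm_coef m (F : {poly MP m}) i : nrm m F`_i <= nrm m.+1 F.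
Proof.
case: (ltnP i (size F)) => h; last by rewrite nth_default ?nrm0 ?nrm_ge0.
rewrite /= (bigD1 (Ordinal h)) //= lerDl.
by apply: sumr_ge0 => j _; exact: nrm_ge0.
Qed.

Lemma nrm_polyC m (c : MP m) : nrm m.+1 (c%:P : {poly MP m}) = nrm m c.
Proof. by rewrite (@nrmE _ _ 1) ?size_polyC ?leq_b1 // big_ord1 coefC. Qed.

Lemma nrmM m F G : nrm m (F * G) <= nrm m F * nrm m G.
Proof.
elim: m F G => [|m IH] F G; first by rewrite /= normrM.
pose p := F : {poly MP m}; pose q := G : {poly MP m}.
have -> : F * G = \sum_(i < size p) \sum_(j < size q) (p`_i * q`_j) *: 'X^(i + j).
  rewrite -[F](coefK p) -[G](coefK q) !poly_def mulr_suml; apply: eq_bigr => i _.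
  rewrite mulr_sumr; apply: eq_bigr => j _.
  by rewrite -scalerAl -scalerAr scalerA exprD.
apply: (le_trans (nrm_sum _ _ _)).
rewrite [nrm m.+1 F]/= mulr_suml ler_sum // => i _.
apply: (le_trans (nrm_sum _ _ _)).
rewrite [nrm m.+1 G]/= mulr_sumr ler_sum // => j _.
apply: le_trans (IH _ _).
rewrite (@nrmE _ _ (i + j).+1); last first.
  by apply: leq_trans (size_scale_leq _ _) _; rewrite size_polyXn.
rewrite big_ord_recr /= big1 ?add0r => [|k _].
  by rewrite coefZ coefXn eqxx mulr1.
by rewrite coefZ coefXn (ltn_eqF (ltn_ord k)) mulr0 nrm0.
Qed.

Lemma nrm_prod_le m (I : finType) (F : I -> MP m) B :
  nrm m 1 <= 1 -> (forall i, nrm m (F i) <= B) -> nrm m (\prod_i F i) <= B ^+ #|I|.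
Proof.
move=> h1 h; rewrite -[X in _ <= X]prodr_const.
elim/big_rec2: _ => [|i x y _ hy]; first exact: h1.
apply: (le_trans (nrmM _ _)).
by apply: ler_pM => //; exact: nrm_ge0.
Qed.

Lemma nrm1 m : nrm m 1 = 1.
Proof.
elim: m => [|m IH]; first by rewrite /= normr1.
by rewrite -[X in nrm _ X]/((1%:P) : {poly MP m}) nrm_polyC.
Qed.

Lemma nrm_det m k (M : 'M[MP m]_k) B :
  (forall a b, nrm m (M a b) <= B) -> nrm m (\det M) <= k`!%:R * B ^+ k.
Proof.
move=> h; apply: (le_trans (nrm_sum _ _ _)).
apply: (@le_trans _ _ (\sum_(s : 'S_k) B ^+ k)); last by rewrite sumr_const card_Sn mulr_natl.
apply: ler_sum => s _.
have -> : nrm m ((-1) ^+ s * \prod_i M i (s i)) = nrm m (\prod_i M i (s i)).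
  by case: (odd_perm s); rewrite ?expr1 ?expr0 ?mulN1r ?mul1r ?nrmN.
have := @nrm_prod_le m 'I_k (fun i => M i (s i)) B; rewrite card_ord nrm1; exact.
Qed.

Lemma bin_leq_exp2 n k : ('C(n, k) <= 2 ^ n)%N.
Proof.
case: (leqP k n) => h; last by rewrite bin_small.
rewrite -[2%N]/(1 + 1)%N expnDn (bigD1 (Ordinal (h : (k < n.+1)%N))) //=.
by rewrite !exp1n !muln1 leq_addr.
Qed.

Lemma nrm_nderivn m (F : {poly MP m}) a d : (size F <= d.+1)%N ->
  nrm m.+1 (F^`N(a)) <= 2 ^+ d * nrm m.+1 F.
Proof.
move=> sF; rewrite (@nrmE _ _ (size F)); last first.
  by apply/leq_sizeP => j h; rewrite coef_nderivn (coef_size_le (leqnn _)) ?mul0rn //; lia.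
apply: (@le_trans _ _ (\sum_(i < size F) 2 ^+ d * nrm m F`_(a + i))).
  apply: ler_sum => i _; rewrite coef_nderivn.
  case: (ltnP (a + i) (size F)) => h; last first.
    by rewrite (coef_size_le (leqnn _) h) mul0rn nrm0 mulr0.
  rewrite (le_trans (nrmMn _ _)) // mulrC ler_wpM2r ?nrm_ge0 //.
  rewrite -natrX ler_nat; have : (a + i <= d)%N by lia.
  move=> /(leq_pexp2l (isT : (0 < 2)%N)); apply: leq_trans.
  exact: bin_leq_exp2.
rewrite -mulr_sumr ler_wpM2l ?exprn_ge0 //.
rewrite (@nrmE _ _ (a + size F)) ?leq_addl // big_split_ord /= ler_wpDl //.
by apply: sumr_ge0 => j _; exact: nrm_ge0.
Qed.

Lemma nrm_inner_nderivn m (F : {poly {poly MP m}}) b d :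
  (forall i, (size (F`_i)%R <= d.+1)%N) ->
  nrm m.+2 (map_poly (nderivn b) F) <= 2 ^+ d * nrm m.+2 F.
Proof.
move=> h; rewrite (@nrmE _ _ (size F)); last first.
  by apply/leq_sizeP => j hj; rewrite coef_map_id0 ?linear0 // nth_default ?linear0.
rewrite mulr_sumr ler_sum // => i _; rewrite coef_map_id0 ?linear0 //.
exact: nrm_nderivn.
Qed.

Lemma itg0 m : itg m 0.
Proof. by elim: m => [|m IH] //= i; rewrite coef0. Qed.

Lemma itgD m F G : itg m F -> itg m G -> itg m (F + G).
Proof.
elim: m F G => [|m IH] F G /=; first by move=> h1 h2; exact: rpredD.
by move=> hF hG i; rewrite coefD; apply: IH.
Qed.

Lemma itgN m F : itg m F -> itg m (- F).
Proof.
elim: m F => [|m IH] F /=; first by rewrite rpredN.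
by move=> hF i; rewrite coefN; apply: IH.
Qed.

Lemma itgMn m F n : itg m F -> itg m (F *+ n).
Proof.
by move=> h; elim: n => [|n IH]; [rewrite mulr0n; exact: itg0 | rewrite mulrS; exact: itgD].
Qed.

Lemma itg_sum m (I : Type) (r : seq I) (P : pred I) (F : I -> MP m) :
  (forall i, P i -> itg m (F i)) -> itg m (\sum_(i <- r | P i) F i).
Proof.
move=> h; elim/big_rec: _ => [|i x Pi hx]; first exact: itg0.
by apply: itgD => //; apply: h.
Qed.

Lemma itgM m F G : itg m F -> itg m G -> itg m (F * G).
Proof.
elim: m F G => [|m IH] F G /=; first by move=> h1 h2; exact: rpredM.
by move=> hF hG i; rewrite coefM; apply: itg_sum => j _; apply: IH.
Qed.

Lemma itg1 m : itg m 1.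
Proof.
elim: m => [|m IH] /=; first exact: rpred1.
by case=> [|i]; rewrite coef1 //=; exact: itg0.
Qed.

Lemma itg_prod m (I : Type) (r : seq I) (P : pred I) (F : I -> MP m) :
  (forall i, P i -> itg m (F i)) -> itg m (\prod_(i <- r | P i) F i).
Proof.
move=> h; elim/big_rec: _ => [|i x Pi hx]; first exact: itg1.
by apply: itgM => //; apply: h.
Qed.

Lemma itg_det m k (M : 'M[MP m]_k) : (forall a b, itg m (M a b)) -> itg m (\det M).
Proof.
move=> h; apply: itg_sum => s _; apply: itgM; last by apply: itg_prod.
by case: (odd_perm s); rewrite ?expr1 ?expr0; [apply: itgN|]; exact: itg1.
Qed.

Lemma itg_nderivn m (F : {poly MP m}) a : itg m.+1 F -> itg m.+1 (F^`N(a)).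
Proof. by move=> h i; rewrite coef_nderivn; apply: itgMn; exact: h. Qed.

Lemma itg_inner_nderivn m (F : {poly {poly MP m}}) b :
  itg m.+2 F -> itg m.+2 (map_poly (nderivn b) F).
Proof.
move=> h i; rewrite coef_map_id0 ?linear0 //.
by apply: (@itg_nderivn m); exact: h.
Qed.

Lemma nrm_ge1 m F : itg m F -> F != 0 -> 1 <= nrm m F.
Proof.
elim: m F => [|m IH] F /=; first by move=> /intrP [z ->] h; rewrite intr_eq0 in h; rewrite -intr_norm ler1z; lia.
move=> h F0; apply: (le_trans (IH (lead_coef (F : {poly MP m})) _ _)).
- by rewrite lead_coefE; exact: h.
- by rewrite lead_coef_eq0.
exact: (@nrm_coef m F).
Qed.

Lemma dg0 m d : dg m d 0.
Proof. by elim: m d => [|m IH] d //=; split; rewrite ?size_poly0 // => i; rewrite coef0. Qed.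

Lemma dgD m d F G : dg m d F -> dg m d G -> dg m d (F + G).
Proof.
elim: m d F G => [|m IH] d F G //= [sF hF] [sG hG]; split.
  by rewrite (leq_trans (size_polyD _ _)) // geq_max sF.
by move=> i; rewrite coefD; apply: IH.
Qed.

Lemma dgN m d F : dg m d F -> dg m d (- F).
Proof.
elim: m d F => [|m IH] d F //= [sF hF]; split; first by rewrite size_polyN.
by move=> i; rewrite coefN; apply: IH.
Qed.

Lemma dgMn m d F n : dg m d F -> dg m d (F *+ n).
Proof.
by move=> h; elim: n => [|n IH]; [rewrite mulr0n; exact: dg0 | rewrite mulrS; exact: dgD].
Qed.

Lemma dg_sum m d (I : Type) (r : seq I) (P : pred I) (F : I -> MP m) :
  (forall i, P i -> dg m d (F i)) -> dg m d (\sum_(i <- r | P i) F i).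
Proof.
move=> h; elim/big_rec: _ => [|i x Pi hx]; first exact: dg0.
by apply: dgD => //; apply: h.
Qed.

Lemma dgM m d d' F G : dg m d F -> dg m d' G -> dg m (fun i => d i + d' i)%N (F * G).
Proof.
elim: m d d' F G => [|m IH] d d' F G //= [sF hF] [sG hG]; split.
  rewrite (leq_trans (size_polyMleq _ _)) // -subn1 leq_subLR.
  by rewrite (leq_trans (leq_add sF sG)) //; lia.
by move=> i; rewrite coefM; apply: dg_sum => j _; apply: IH.
Qed.

Lemma dg1 m : dg m (fun=> 0%N) 1.
Proof.
elim: m => [|m IH] //=; split; first by rewrite size_poly1.
by case=> [|i]; rewrite coef1 //=; exact: dg0.
Qed.

Lemma dg_det m d k (M : 'M[MP m]_k) :
  (forall a b, dg m d (M a b)) -> dg m (fun i => k * d i)%N (\det M).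
Proof.
move=> h; apply: dg_sum => s _.
suff hp : dg m (fun i => k * d i)%N (\prod_i M i (s i)).
  by case: (odd_perm s); rewrite ?expr1 ?expr0 ?mulN1r ?mul1r //; apply: dgN.
suff : forall r : seq 'I_k, dg m (fun i => size r * d i)%N (\prod_(i <- r) M i (s i)).
  by move=> /(_ (index_enum 'I_k)); rewrite /index_enum -enumT size_enum_ord.
elim=> [|a r IH]; first by rewrite big_nil; exact: dg1.
rewrite big_cons; have := dgM (h a (s a)) IH.
by congr (dg m _ _).
Qed.

Lemma dg_nderivn m d (F : {poly MP m}) a : dg m.+1 d F -> dg m.+1 d (F^`N(a)).
Proof.
move=> [sF hF]; split; last by move=> i; rewrite coef_nderivn; apply: dgMn; exact: hF.
apply/leq_sizeP => j hj; rewrite coef_nderivn (coef_size_le sF) ?mul0rn //.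
by rewrite (leq_trans hj) // leq_addl.
Qed.

Lemma dg_inner_nderivn m d (F : {poly {poly MP m}}) b :
  dg m.+2 d F -> dg m.+2 d (map_poly (nderivn b) F).
Proof.
move=> [sF hF]; split; last first.
  by move=> i; rewrite coef_map_id0 ?linear0 //; apply: (@dg_nderivn m); exact: hF.
apply/leq_sizeP => j hj; rewrite coef_map_id0 ?linear0 //.
by rewrite (coef_size_le sF) // linear0.
Qed.

(** Gauss's lemma: [q X - p] is primitive because its content divides both [p] and [q], and
    primitive parts are multiplicative. *)
Lemma lead_coef_zprimitive_XsubC_exp (p : int) (q a : nat) : (0 < q)%N ->
  coprimez p q -> `|lead_coef (zprimitive ((q%:Z *: 'X - p%:P) ^+ a))|%N = (q ^ a)%N.
Proof.
move=> q0 cpq; set L := _ - _.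
have lL : lead_coef L = q.
  rewrite /L -[- _%:P]polyCN lead_coefDl ?lead_coefZ ?lead_coefX ?mulr1 //.
  by rewrite size_scale ?size_polyX ?size_polyC; [case: (_ != _)|lia].
have L0 : L != 0 by rewrite -lead_coef_eq0 lL; lia.
have lzL : `|lead_coef (zprimitive L)|%N = q.
  have := dvdz_contents (zcontents L) L; rewrite dvdzz => /esym /polyOverP h.
  have h1 : (zcontents L %| q%:Z)%Z.
    by have := h 1%N; rewrite coefB coefZ coefX coefC subr0 mulr1.
  have h0 : (zcontents L %| p)%Z.
    by have := h 0%N; rewrite coefB coefZ coefX coefC mulr0 sub0r rpredN.
  have c1 : (`|zcontents L| = 1)%N.
    have : (zcontents L %| gcdz p q%:Z)%Z by rewrite dvdz_gcd h0.
    by move: cpq; rewrite /coprimez => /eqP ->; rewrite dvdz1 => /eqP.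
  have := congr1 (fun z => `|lead_coef z|%N) (zpolyEprim L).
  by rewrite /= lL lead_coefZ abszM c1 mul1n => <-.
elim: a => [|a IH]; first by rewrite expr0 zprimitive_monic ?monic1 ?lead_coef1.
by rewrite exprS zprimitiveM lead_coefM abszM lzL IH expnS.
Qed.

(** Vanishing to order [a] at [p / q] makes the primitive polynomial [(q X - p) ^ a] divide [F] over
    the integers, so [q ^ a] divides the leading coefficient. *)
Lemma multiplicity_le_nrm (F : {poly rat}) (p : int) (q a : nat) :
  (0 < q)%N -> coprimez p q -> itg 1 F -> F != 0 ->
  (forall i, (i < a)%N -> (F \Po ('X + (p%:~R / q%:R)%:P))`_i = 0) ->
  q%:R ^+ a <= nrm 1 F.
Proof.
move=> q0 cpq iF F0 ha; set xi := p%:~R / q%:R in ha.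
have qn0 : q%:R != 0 :> rat by rewrite pnatr_eq0 -lt0n.
have [F1 EF] : exists F1 : {poly int}, F = map_poly intr F1.
  exists (map_poly numq F); apply/polyP => i; rewrite coef_map /= coef_map_id0 ?numq_int //.
  by rewrite numqK //; exact: iF.
have dv : ('X - xi%:P) ^+ a %| F.
  have dv0 : 'X^a %| F \Po ('X + xi%:P).
    rewrite -(poly_take_drop a (F \Po _)) (_ : take_poly a _ = 0) ?add0r ?dvdp_mull //.
    by apply/polyP => i; rewrite coef_take_poly coef0; case: ifP => // /ha.
  have := dvdp_comp_poly ('X - xi%:P) dv0; rewrite comp_Xn_poly -comp_polyA.
  by rewrite comp_polyD comp_polyX comp_polyC subrK comp_polyXr.
have EL : map_poly intr ((q%:Z *: 'X - p%:P) ^+ a) = q%:R ^+ a *: ('X - xi%:P) ^+ a.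
  rewrite rmorphXn rmorphB /= map_polyZ map_polyX map_polyC /= -exprZn; congr (_ ^+ _).
  rewrite scalerBr; congr (_ - _); apply/polyP => i; rewrite coefZ !coefC.
  by case: ifP => _; rewrite ?mulr0 // /xi mulrC divfK.
have : (q%:Z *: 'X - p%:P) ^+ a %| F1.
  by rewrite -dvdp_rat_int -EF EL dvdpZl // expf_neq0.
move=> /dvdpP_int [r Er].
have lc : `|lead_coef F1|%N = (q ^ a * `|lead_coef r|)%N.
  by rewrite Er lead_coefM abszM lead_coef_zprimitive_XsubC_exp.
have F10 : F1 != 0 by apply: contraNneq F0 => E; rewrite EF E rmorph0.
have : (q ^ a <= `|lead_coef F1|)%N.
  rewrite lc leq_pmulr //; move: F10; rewrite -lead_coef_eq0 -absz_eq0 lc muln_eq0.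
  by rewrite negb_or lt0n => /andP[].
rewrite -(ler_nat rat) natrX => /le_trans; apply.
have := @nrm_coef 0 F (size F1).-1.
by rewrite EF /= coef_map /= -lead_coefE -intr_norm -abszE.
Qed.

Lemma nrm_skip m (W : {poly {poly MP m}}) j :
  nrm m.+1 (map_poly (coefp j) W) <= nrm m.+2 W.
Proof.
rewrite (@nrmE _ _ (size W)); last first.
  by apply/leq_sizeP => i h; rewrite coef_map /= (coef_size_le (leqnn _) h) coef0.
by apply: ler_sum => i _; rewrite coef_map /=; exact: (@nrm_coef m).
Qed.

Lemma itg_skip m (W : {poly {poly MP m}}) j : itg m.+2 W ->
  itg m.+1 (map_poly (coefp j) W).
Proof. by move=> h i; rewrite coef_map /=; exact: (h i j). Qed.

Lemma dg_skip m d (W : {poly {poly MP m}}) j : dg m.+2 d W ->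
  dg m.+1 (skip1 d) (map_poly (coefp j) W).
Proof.
move=> [sW hW]; split=> [|i].
  by apply/leq_sizeP => i h; rewrite coef_map /= (coef_size_le sW h) coef0.
by rewrite coef_map /=; exact: (hW i).2.
Qed.

Lemma vg_scale m b w F x (k : rat) : 0 < k ->
  vg m b (fun i => w i / k) F x <-> vg m b w F (k * x).
Proof.
move=> k0; elim: m w F x => [|m IH] w F x /=.
  split=> [][->|h]; [by left | | by left|]; right; case: b h => h.
  - by rewrite pmulr_rlt0.
  - by rewrite pmulr_rle0.
  - by rewrite pmulr_rlt0 in h.
  - by rewrite pmulr_rle0 in h.
have kE i : k * (x - i%:R * (w 0%N / k)) = k * x - i%:R * w 0%N.
  by rewrite mulrBr; congr (_ - _); field; rewrite gt_eqF.
split=> h i; first by rewrite -kE; apply/IH; exact: h.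
by apply/(IH (sh w)); rewrite kE; exact: h.
Qed.

(** * Mixed Wronskians *)

(** A sum of [k] products of a polynomial in variable 0 by one in variable 1, over the field of
    fractions in the remaining variables; [rho] is a common denominator. *)
Definition splits m (F : {poly {poly MP m}}) (k : nat) :=
  exists (rho : MP m) (g psi : 'I_k -> {poly MP m}), rho != 0 /\
  rho%:P%:P * F = \sum_s map_poly polyC (g s) * (psi s)%:P.

Lemma splits_size m (F : {poly {poly MP m}}) n :
  (forall i, (size (F`_i)%R <= n)%N) -> splits F n.
Proof.
move=> h; exists 1, (fun s => map_poly (coefp s) F), (fun s => 'X^s).
split; first exact: oner_neq0.
rewrite !polyC1 mul1r; apply/polyP => i; rewrite coef_sum.
have E (s : 'I_n) : (map_poly polyC (map_poly (coefp s) F) * ('X^s)%:P)`_i = F`_i`_s *: 'X^s.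
  rewrite coefMC coef_map -mul_polyC; congr (polyC _ * _).
  exact: (@coef_map _ _ (coefp s) F i).
rewrite (eq_bigr _ (fun s _ => E s)).
apply/polyP => j; rewrite coef_sumMXn.
case: (ltnP j n) => hj; last first.
  rewrite (coef_size_le (h i) hj) big1 // => s /eqP Es.
  by move: (ltn_ord s); rewrite Es ltnNge hj.
by rewrite (big_pred1 (Ordinal hj)) // => s; rewrite -val_eqE.
Qed.

Lemma splits_dependent m (F : {poly {poly MP m}}) k (rho : MP m)
    (g psi : 'I_k.+1 -> {poly MP m}) c i0 :
  rho != 0 -> rho%:P%:P * F = \sum_s map_poly polyC (g s) * (psi s)%:P ->
  c i0 != 0 -> combination c g = 0 \/ combination c psi = 0 -> splits F k.
Proof.
move=> rho0 E ci0 dep.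
pose ci := (c i0)%:P%:P : {poly {poly MP m}}.
have zE (x : MP m) (p : {poly MP m}) : map_poly polyC (x *: p) = x%:P%:P * map_poly polyC p.
  by rewrite -mul_polyC rmorphM /= map_polyC.
have zE' (x : MP m) (p : {poly MP m}) : (x *: p)%:P = x%:P%:P * p%:P :> {poly {poly MP m}}.
  by rewrite -mul_polyC polyCM.
case: dep => dep.
  exists (c i0 * rho), (fun j => g (lift i0 j)),
    (fun j => c i0 *: psi (lift i0 j) - c (lift i0 j) *: psi i0).
  split; first exact: mulf_neq0.
  rewrite !polyCM -mulrA E mulr_sumr (bigD1_ord i0) //=.
  have gi0 : ci * map_poly polyC (g i0) =
      - \sum_j (c (lift i0 j))%:P%:P * map_poly polyC (g (lift i0 j)).
    move: dep => /(congr1 (map_poly (@polyC (MP m)))).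
    rewrite /combination rmorph0 rmorph_sum (bigD1_ord i0) //= zE => /eqP.
    rewrite addr_eq0 => /eqP ->; congr (- _); apply: eq_bigr => j _; exact: zE.
  rewrite mulrA -/ci gi0 mulNr mulr_suml addrC -sumrB; apply: eq_bigr => j _.
  by rewrite polyCB !zE'; rewrite /ci; ring.
exists (c i0 * rho), (fun j => c i0 *: g (lift i0 j) - c (lift i0 j) *: g i0),
  (fun j => psi (lift i0 j)).
split; first exact: mulf_neq0.
rewrite !polyCM -mulrA E mulr_sumr (bigD1_ord i0) //=.
have pi0 : ci * (psi i0)%:P =
    - \sum_j (c (lift i0 j))%:P%:P * (psi (lift i0 j))%:P.
  move: dep => /(congr1 (@polyC {poly MP m})).
  rewrite /combination raddf0 raddf_sum (bigD1_ord i0) //= zE' => /eqP.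
  rewrite addr_eq0 => /eqP ->; congr (- _); apply: eq_bigr => j _; exact: zE'.
rewrite mulrCA -/ci pi0 mulrN mulr_sumr addrC -sumrB; apply: eq_bigr => j _.
by rewrite rmorphB /= !zE; rewrite /ci; ring.
Qed.

Definition mixed_wronskian m (F : {poly {poly MP m}}) k :=
  \det (\matrix_(a < k, b < k) (map_poly (nderivn b) F)^`N(a)).

(** For minimal [k] both families of factors are independent, and up to a power of [rho] the mixed
    Wronskian matrix is the product of their Wronskian matrices, so its determinant is a product
    [U V] with separated variables. No arithmetic bound is known for [U] and [V]; the factorization
    is therefore stated with slices of [W], which inherit integrality, norm and degrees from it. *)
Lemma mixed_wronskian_rank1 m (F : {poly {poly MP m}}) k :
  splits F k -> (forall l, (l < k)%N -> ~ splits F l) ->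
  mixed_wronskian F k != 0 /\
  forall i j, let W := mixed_wronskian F k in
    W * (W`_i`_j)%:P%:P = (W`_i)%:P * map_poly polyC (map_poly (coefp j) W).
Proof.
move=> [rho [g [psi [rho0 E]]]] mink.
have indep h : h = g \/ h = psi ->
    forall c : 'I_k -> MP m, combination c h = 0 -> forall i, c i = 0.
  move=> hh c dep i; apply: contrapT => /eqP ci.
  case: k g psi E mink h hh c dep i ci => [|k] g psi E mink h hh c dep i ci.
    by case: i ci.
  apply: (mink k) => //; apply: splits_dependent rho0 E ci _.
  by case: hh => <-; [left|right].
have := wronskian_neq0 (@tf_MP m) (indep g (or_introl erefl)).
set U := \det _ => U0.
have := wronskian_neq0 (@tf_MP m) (indep psi (or_intror erefl)).
set V := \det _ => V0.
pose W := mixed_wronskian F k.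
have WE : (rho ^+ k)%:P%:P * W = map_poly polyC U * V%:P.
  rewrite /U /V -(det_map_mx (map_poly (@polyC (MP m)))) -(det_map_mx (@polyC {poly MP m})).
  rewrite -[X in _ = _ * X]det_tr -det_mulmx !rmorphXn /= -detZ; congr (\det _).
  apply/matrixP => a b; rewrite !mxE.
  have rE : map_poly polyC rho%:P = rho%:P%:P :> {poly {poly MP m}} by rewrite map_polyC.
  rewrite mul_polyC -nderivnZ -mul_polyC -rE mulrC -inner_nderivnM mulrC rE E.
  have DD : {morph map_poly (@nderivn (MP m) b) : p q / p + q}.
    by move=> p q; apply/polyP => i; rewrite coefD !coef_map_id0 ?linear0 // coefD linearD.
  rewrite (big_morph _ DD (map_poly0 _)) raddf_sum; apply: eq_bigr => s _ /=.
  rewrite mulrC inner_nderivnM !mxE.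
  have -> : map_poly (nderivn b) (psi s)%:P = ((psi s)^`N(b))%:P.
    by apply/polyP => i; rewrite coef_map_id0 ?linear0 // !coefC; case: eqP; rewrite ?linear0.
  by rewrite mul_polyC nderivnZ -mul_polyC mulrC nderivn_map.
have coefW i j : rho ^+ k * W`_i`_j = U`_i * V`_j.
  have := congr1 (fun P : {poly {poly MP m}} => P`_i`_j) WE.
  by rewrite coefCM coefMC coefCM coef_map /= coefCM.
have rk0 : rho ^+ k != 0 by rewrite expf_neq0.
split.
  apply/eqP => W0; move: WE; rewrite (W0 : W = 0) mulr0 => /esym /eqP; rewrite mulf_eq0.
  by rewrite polyC_eq0 (negPf V0) map_polyC_eq0 (negPf U0).
move=> i j; rewrite -/W /=; apply/polyP => i'; apply/polyP => j'.
have ME : (map_poly (coefp j) W)`_i' = W`_i'`_j by exact: (@coef_map _ _ (coefp j) W i').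
rewrite coefMC coefMC coefCM coef_map coefMC ME.
apply: (mulfI rk0); apply: (mulfI rk0).
have e (r x y : MP m) : r * (r * (x * y)) = (r * x) * (r * y) by ring.
by rewrite !e !coefW; ring.
Qed.

(** The columns with [b <= d1 / (4 E)] contribute at least [1 / (2 E)] each, since [k / d0] and
    [b / d1] are both at most [1 / (4 E)]; there are at least [k / (8 E)] such columns among the
    [k]. *)
Lemma sum_index_ge (k d0 d1 E : nat) : (0 < E)%N -> (0 < d1)%N -> (0 < d0)%N ->
  (k <= d1.+1)%N -> (8 * E * d1 <= d0)%N ->
  k%:R / (16%:R * E%:R ^+ 2) <=
  \sum_(b < k) Num.max 0 (E%:R^-1 - k%:R / d0%:R - (b : nat)%:R / d1%:R) :> rat.
Proof.
move=> E0 d10 d00 kd Ed.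
have Ep : 0 < E%:R :> rat by rewrite ltr0n.
have d1p : 0 < d1%:R :> rat by rewrite ltr0n.
have d0p : 0 < d0%:R :> rat by rewrite ltr0n.
pose n0 := (d1 %/ (4 * E)).+1.
apply: (@le_trans _ _ (\sum_(b < k | (b < n0)%N) (2 * E%:R)^-1)).
  rewrite sumr_const -[_ *+ #|_|]mulr_natl.
  have -> : #|[pred b : 'I_k | (b < n0)%N]| = minn k n0.
    have [h|h] := leqP k n0.
      rewrite -[RHS]card_ord; apply: eq_card => b; rewrite !inE.
      by rewrite (leq_trans (ltn_ord b)).
    rewrite -[RHS]card_ord -(fintype.card_image (f := widen_ord (ltnW h))); last first.
      by move=> x y /(congr1 val) /= ?; apply: val_inj.
    apply: eq_card => b; rewrite !inE; apply/idP/fintype.imageP => [hb|[c _ ->]]; last exact: (ltn_ord c).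
    by exists (Ordinal hb) => //; apply: val_inj.
  have key : k%:R <= (minn k n0)%:R * (8 * E%:R) :> rat.
    rewrite -(natrM _ 8) -natrM ler_nat.
    have : (d1 < n0 * (4 * E))%N by rewrite /n0 ltn_ceil //; lia.
    rewrite /minn; case: ifP => _; nia.
  rewrite ler_pdivrMr; last by nra.
  apply: (le_trans key); rewrite le_eqVlt; apply/orP; left; apply/eqP.
  by field; rewrite gt_eqF.
rewrite [X in _ <= X](bigID (fun b : 'I_k => (b < n0)%N)) /= ler_wpDr //.
  by apply: sumr_ge0 => b _; rewrite le_max lexx.
apply: ler_sum => b hb; rewrite le_max; apply/orP; right.
have h1 : k%:R / d0%:R <= (4 * E%:R)^-1 :> rat.
  rewrite ler_pdivrMr // mulrC ler_pdivlMr; last by nra.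
  by rewrite -(natrM _ 4) -natrM ler_nat; nia.
have h2 : (b : nat)%:R / d1%:R <= (4 * E%:R)^-1 :> rat.
  rewrite ler_pdivrMr // mulrC ler_pdivlMr; last by nra.
  rewrite -(natrM _ 4) -natrM ler_nat.
  by move: hb; rewrite /n0 ltnS leq_divRL; lia.
have e4 : (4 * E%:R)^-1 = E%:R^-1 / 4 :> rat by field; rewrite gt_eqF.
have e2 : (2 * E%:R)^-1 = E%:R^-1 / 2 :> rat by field; rewrite gt_eqF.
by rewrite e2; move: h1 h2; rewrite e4; lra.
Qed.

(** Roth's lemma in [m.+1] variables, with index bound [1 / e.+1]. The power of 2 next to the norm
    is there to absorb binomial coefficients and factorials during the induction. *)
Definition small_index_property (m e Om : nat) :=
  forall (d q : nat -> nat) (p : nat -> int) (F : MP m.+1),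
  (forall h, (h < m.+1)%N -> (0 < d h)%N) ->
  (forall h, (h.+1 < m.+1)%N -> (d h.+1 * Om <= d h)%N) ->
  (forall h, (h < m.+1)%N -> (0 < q h)%N /\ coprimez (p h) (q h)) ->
  (forall h, (h < m.+1)%N ->
     (nrm m.+1 F * 2 ^+ (\sum_(i < m.+1) d i)) ^+ Om <= (q h)%:R ^+ d h) ->
  itg m.+1 F -> F != 0 -> dg m.+1 d F ->
  ~ vg m.+1 false (fun h => (d h)%:R^-1)
       (tr m.+1 (fun h => (p h)%:~R / (q h)%:R) F) (e.+1%:R^-1).

Lemma small_index_base e : small_index_property 0 e e.+1.
Proof.
move=> d q p F d0 _ hq hF iF F0 _ hv.
have [q0 cpq] := hq 0%N isT; have dp := d0 0%N isT.
(* The quotient of [d 0] by [e.+1] rounded up: the multiplicity forced by an index of at least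
   [1 / e.+1]. *)
pose a := ((d 0%N + e) %/ e.+1)%N.
have ae : (d 0%N <= a * e.+1)%N.
  by have := ltn_ceil (d 0%N + e) (isT : (0 < e.+1)%N); rewrite -/a; lia.
have := @multiplicity_le_nrm F (p 0%N) (q 0%N) a q0 cpq iF F0.
have -> : F \Po ('X + ((p 0%N)%:~R / (q 0%N)%:R)%:P) =
    tr 1 (fun h => (p h)%:~R / (q h)%:R) F.
  by rewrite /= map_poly_id.
move=> /(_ _) h.
have {}h : (q 0%N)%:R ^+ a <= nrm 1 F.
  apply: h => i ia; have [//|] := hv i; rewrite subr_le0 => hi.
  have dR : 0 < (d 0%N)%:R :> rat by rewrite ltr0n.
  move: hi; rewrite ler_pdivlMr // mulrC ler_pdivrMr ?ltr0n // -natrM ler_nat.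
  have : (a * e.+1 <= d 0%N + e)%N by rewrite /a leq_trunc_div.
  nia.
have n1 := nrm_ge1 iF F0.
have := hF 0%N isT; rewrite big_ord1 => h2.
have h3 : (nrm 1 F * 2 ^+ d 0%N) ^+ e.+1 <= nrm 1 F ^+ e.+1.
  apply: (le_trans h2); apply: (@le_trans _ _ (((q 0%N)%:R ^+ a) ^+ e.+1)).
    by rewrite -exprM ler_weXn2l // ler1n.
  by rewrite lerXn2r // nnegrE ?exprn_ge0 // (le_trans _ n1).
have h4 : nrm 1 F * 2 ^+ d 0%N <= nrm 1 F.
  by rewrite -(@ler_pXn2r _ e.+1) // nnegrE ?mulr_ge0 ?exprn_ge0 // (le_trans _ n1).
have : (2 : rat) <= 2 ^+ d 0%N by rewrite -{1}(expr1 2) ler_weXn2l ?ler1n.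
by move: n1 h4; set X := nrm 1 F; set Y := 2 ^+ _; nra.
Qed.

Lemma leq_skip_sum m (d : nat -> nat) k :
  (\sum_(i < m.+1) k * skip1 d i <= k * \sum_(i < m.+2) d i)%N.
Proof.
rewrite -big_distrr leq_mul2l; apply/orP; right.
by rewrite !big_ord_recl /= leq_add2l leq_addl.
Qed.

Lemma leq_sh_sum m (d : nat -> nat) k :
  (\sum_(i < m.+1) k * sh d i <= k * \sum_(i < m.+2) d i)%N.
Proof.
rewrite -big_distrr leq_mul2l; apply/orP; right.
by rewrite [X in (_ <= X)%N]big_ord_recl leq_addl.
Qed.

(** If the index of [F] were at least [1 / e.+1], that of its mixed Wronskian would be at least
    [k / (16 e.+1^2)]. The Wronskian, up to a factor free of variables 0 and 1, is a product of two
    slices in one variable fewer, and the induction hypothesis bounds the index of each by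
    [k / (64 e.+1^2)]. *)
Lemma small_index_step m e Om :
  (0 < Om)%N -> small_index_property m (64 * e.+1 ^ 2).-1 Om ->
  small_index_property m.+1 e (3 * Om + 8 * e.+1).
Proof.
move=> Om0 IH d q p F d0 dO hq hF iF F0 dF hv.
set w := (fun h => (d h)%:R^-1) in hv; set xi := (fun h => _) in hv.
set Om' := (3 * Om + 8 * e.+1)%N in dO hF.
have w0 i : 0 <= w i by rewrite invr_ge0 ler0n.
pose G := F : {poly {poly MP m}}.
have sG i : (size (G`_i)%R <= (d 1%N).+1)%N by have [_ /(_ i) []] := dF.
have exk : exists k, `[< splits G k >] by exists (d 1%N).+1; apply/asboolP; exact: splits_size.
case: (ex_minnP exk) => k /asboolP spk mink.
have kd : (k <= (d 1%N).+1)%N by apply: mink; apply/asboolP; exact: splits_size.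
have k0 : (0 < k)%N.
  case: k spk {mink kd} => // -[rho [g [psi [rho0 /eqP]]]].
  by rewrite big_ord0 mulf_eq0 !polyC_eq0 (negPf rho0) (negPf (F0 : G != 0)).
have [W0 WE] : mixed_wronskian G k != 0 /\ forall i j, let W := mixed_wronskian G k in
    W * (W`_i`_j)%:P%:P = (W`_i)%:P * map_poly polyC (map_poly (coefp j) W).
  apply: mixed_wronskian_rank1 => // l lk sl.
  by have := mink l (asboolT sl); rewrite leqNgt lk.
set W := mixed_wronskian G k in W0 WE.
have [i Wi0] : exists i, W`_i != 0 by exists (size W).-1; rewrite -lead_coefE lead_coef_eq0.
have [j Wij0] : exists j, W`_i`_j != 0.
  by exists (size (W`_i)).-1; rewrite -lead_coefE lead_coef_eq0.
pose Wi := W`_i; pose Wj := map_poly (coefp j) W.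
have Wj0 : Wj != 0.
  by apply: contraNneq Wij0 => /polyP /(_ i); rewrite coef0 /Wj (@coef_map _ _ (coefp j) W i) /= => ->.
have {WE} WE : W * (W`_i`_j)%:P%:P = Wi%:P * map_poly polyC Wj := WE i j.
have d0p := d0 0%N isT; have d1p := d0 1%N isT.
have d10 : (8 * e.+1 * d 1%N <= d 0%N)%N by have := dO 0%N isT; rewrite /Om'; nia.
pose D := (\sum_(i < m.+2) d i)%N.
have d01D : (d 0%N + d 1%N <= D)%N by rewrite /D !big_ord_recl /= addnA leq_addr.
have iW : itg m.+2 W.
  apply: itg_det => a b; rewrite mxE; apply: (@itg_nderivn m.+1).
  exact: (@itg_inner_nderivn m).
have dW : dg m.+2 (fun i => k * d i)%N W.
  apply: dg_det => a b; rewrite mxE; apply: (@dg_nderivn m.+1).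
  exact: (@dg_inner_nderivn m).
have n1 := nrm_ge1 iF F0.
pose X := nrm m.+2 F * 2 ^+ D.
have p2 (n : nat) : 1 <= 2 ^+ n :> rat by rewrite exprn_ege1 ?ler1n.
have X1 : 1 <= X by rewrite -[1]mulr1 ler_pM.
(* The three factors [2 ^+ D] in [X ^+ 3] pay for the factorial of [k], for the derivatives, and for
   the power of 2 demanded by the induction hypothesis. *)
have nW : nrm m.+2 W * 2 ^+ (k * D) <= (X ^+ 3) ^+ k.
  pose B := 2 ^+ d 0%N * (2 ^+ d 1%N * nrm m.+2 F).
  have B0 : 0 <= B by rewrite !mulr_ge0 ?exprn_ge0 ?nrm_ge0.
  have hB : nrm m.+2 W <= k`!%:R * B ^+ k.
    apply: nrm_det => a b; rewrite mxE.
    apply: (le_trans (@nrm_nderivn m.+1 _ a (d 0%N) _)).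
      by have [] := @dg_inner_nderivn m d G b dF.
    rewrite ler_wpM2l ?exprn_ge0 //; exact: (@nrm_inner_nderivn m).
  have kk : k`!%:R <= (2 ^+ d 1%N) ^+ k :> rat.
    apply: (@le_trans _ _ (k%:R ^+ k)).
      rewrite -natrX ler_nat -ffactnn ffact_prod.
      rewrite -[X in (_ <= _ ^ X)%N]card_ord -prod_nat_const leq_prod // => s _; exact: leq_subr.
    rewrite lerXn2r ?nnegrE ?exprn_ge0 // -natrX ler_nat (leq_trans kd) // ltn_expl //.
  rewrite exprM -exprM.
  apply: (@le_trans _ _ ((2 ^+ d 1%N) ^+ k * B ^+ k * 2 ^+ (k * D))).
    rewrite ler_wpM2r ?exprn_ge0 // (le_trans hB) // ler_wpM2r ?exprn_ge0 //.
  rewrite mulnC [2 ^+ (D * k)]exprM -!exprMn lerXn2r ?nnegrE ?mulr_ge0 ?exprn_ge0 ?nrm_ge0 //.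
  have hp : 2 ^+ d 0%N * 2 ^+ d 1%N <= 2 ^+ D :> rat by rewrite -exprD ler_weXn2l ?ler1n.
  have hp1 : 2 ^+ d 1%N <= 2 ^+ D :> rat by rewrite ler_weXn2l ?ler1n //; lia.
  rewrite /B /X; move: hp hp1 n1 (p2 D) (p2 (d 0%N)) (p2 (d 1%N)).
  set Y := 2 ^+ D; set u := 2 ^+ d 0%N; set v := 2 ^+ d 1%N; set z := nrm _ _.
  move=> uvY vY z1 Y1 u1 v1.
  have -> : v * (u * (v * z)) * Y = (v * (u * v) * Y) * z by ring.
  have -> : (z * Y) ^+ 3 = (Y * Y * Y) * z ^+ 3 by ring.
  apply: ler_pM; rewrite ?mulr_ge0 //; try lra.
    apply: ler_wpM2r; first lra.
    by apply: ler_pM => //; [lra|nra].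
  by rewrite -{1}(expr1 z) ler_weXn2l.
have hX h : (h < m.+2)%N -> ((X ^+ 3) ^+ k) ^+ Om <= (q h)%:R ^+ (k * d h).
  move=> hh; have -> : ((X ^+ 3) ^+ k) ^+ Om = (X ^+ (3 * Om)) ^+ k.
    by rewrite -!exprM; congr (_ ^+ _); lia.
  rewrite [(k * d h)%N]mulnC [_%:R ^+ _]exprM lerXn2r ?nnegrE ?exprn_ge0 ?ler0n ?(le_trans _ X1) //.
  by apply: le_trans (hF h hh); rewrite ler_weXn2l // /Om'; lia.
(* Common to both slices: the induction hypothesis is used with degrees [k * d' h], and returning to
   the weights [1 / d' h] multiplies the index bound by [k]. *)
have sub (v : MP m.+1) (d' q' : nat -> nat) (p' : nat -> int) :
    itg m.+1 v -> v != 0 -> nrm m.+1 v <= nrm m.+2 W ->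
    dg m.+1 (fun i => k * d' i)%N v ->
    (\sum_(i < m.+1) k * d' i <= k * D)%N ->
    (forall h, (h < m.+1)%N -> (0 < d' h)%N) ->
    (forall h, (h.+1 < m.+1)%N -> (d' h.+1 * Om <= d' h)%N) ->
    (forall h, (h < m.+1)%N -> (0 < q' h)%N /\ coprimez (p' h) (q' h)) ->
    (forall h, (h < m.+1)%N -> ((X ^+ 3) ^+ k) ^+ Om <= (q' h)%:R ^+ (k * d' h)) ->
    exists2 a, a < k%:R / (64%:R * e.+1%:R ^+ 2) &
      let T := tr m.+1 (fun h => (p' h)%:~R / (q' h)%:R) v in
      vg m.+1 false (fun h => (d' h)%:R^-1) T a /\
      ~ vg m.+1 true (fun h => (d' h)%:R^-1) T a.
  move=> iv v0 nv dv sD d'0 d'O hq' hX'.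
  set T := tr _ _ _.
  have E64 : (64 * e.+1 ^ 2).-1.+1 = (64 * e.+1 ^ 2)%N by rewrite prednK // muln_gt0 expn_gt0.
  have nT : ~ vg m.+1 false (fun h => (k * d' h)%:R^-1) T ((64 * e.+1 ^ 2).-1.+1%:R^-1).
    apply: IH => //.
    - by move=> h hh; rewrite muln_gt0 k0 d'0.
    - by move=> h hh; rewrite -mulnA leq_mul2l d'O ?orbT.
    move=> h hh; apply: le_trans (hX' h hh).
    rewrite lerXn2r ?nnegrE ?mulr_ge0 ?exprn_ge0 ?nrm_ge0 ?(le_trans _ X1) //.
    apply: le_trans nW; apply: ler_pM; rewrite ?nrm_ge0 ?exprn_ge0 //.
    by rewrite ler_weXn2l ?ler1n.
  have kR : 0 < k%:R :> rat by rewrite ltr0n.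
  have {}nT : ~ vg m.+1 false (fun h => (d' h)%:R^-1) T (k%:R / (64%:R * e.+1%:R ^+ 2)).
    move=> h; apply: nT; rewrite E64.
    have -> : (fun h => (k * d' h)%:R^-1) = (fun h => (d' h)%:R^-1 / k%:R) :> (nat -> rat).
      by apply/funext => s; rewrite natrM invfM mulrC.
    by apply/(vg_scale _ _ _ _ kR); rewrite natrM natrX.
  have T0 : T != 0.
    by apply/eqP => T0; apply: nT; rewrite T0; exact: vg0.
  have [a [va nva]] := val_exists (fun h => (d' h)%:R^-1) T0.
  exists a => //; rewrite ltNge; apply/negP => ha; apply: nT; exact: vg_weak va.
have [a1 ha1 /= [va1 nva1]] : exists2 a, a < k%:R / (64%:R * e.+1%:R ^+ 2) &
      let T := tr m.+1 (sh xi) Wi in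
      vg m.+1 false (sh w) T a /\ ~ vg m.+1 true (sh w) T a.
  apply: (sub Wi (sh d) (sh q) (sh p)) => //.
  - exact: iW.
  - exact: (@nrm_coef m.+1).
  - exact: dW.2.
  - exact: leq_sh_sum.
  - by move=> h hh; apply: d0.
  - by move=> h hh; apply: leq_trans (dO h.+1 hh); rewrite leq_mul2l /Om'; lia.
  - by move=> h hh; apply: hq.
  - by move=> h hh; apply: hX.
have [a2 ha2 /= [va2 nva2]] : exists2 a, a < k%:R / (64%:R * e.+1%:R ^+ 2) &
      let T := tr m.+1 (skip1 xi) Wj in
      vg m.+1 false (skip1 w) T a /\ ~ vg m.+1 true (skip1 w) T a.
  have := sub Wj (skip1 d) (skip1 q) (skip1 p).
  have -> : (fun h => (skip1 p h)%:~R / (skip1 q h)%:R) = skip1 xi by apply/funext => -[].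
  have -> : (fun h => (skip1 d h)%:R^-1) = skip1 w by apply/funext => -[].
  apply => //.
  - exact: itg_skip.
  - exact: nrm_skip.
  - have := dg_skip j dW; congr (dg _ _ _); by apply/funext => -[].
  - exact: leq_skip_sum.
  - by case=> [|h] hh; apply: d0.
  - case=> [|h] hh /=; last by apply: leq_trans (dO h.+2 hh); rewrite leq_mul2l /Om'; lia.
    have := dO 0%N isT; have := dO 1%N hh; rewrite /Om'; nia.
  - by case=> [|h] hh; apply: hq.
  - by case=> [|h] hh; apply: hX.
have vW : vg m.+2 false w (tr m.+2 xi W)
    (\sum_(b < k) Num.max 0 (e.+1%:R^-1 - k%:R / (d 0%N)%:R - (b : nat)%:R / (d 1%N)%:R)).
  rewrite /W /mixed_wronskian -det_map_mx; apply: vg_det => // a b; rewrite !mxE.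
  rewrite tr_nderivn tr_inner_nderivn.
  have [h|h] := lerP (e.+1%:R^-1 - k%:R / (d 0%N)%:R - (b : nat)%:R / (d 1%N)%:R) 0.
    exact: vg_triv.
  have := vg_nderivn (m := m.+1) a (@vg_inner_nderivn m false w _ _ b hv).
  apply: vg_weak; rewrite /w /=.
  have : (a : nat)%:R / (d 0%N)%:R <= k%:R / (d 0%N)%:R :> rat.
    by rewrite ler_wpM2r ?invr_ge0 // ler_nat ltnW.
  by set u := (a : nat)%:R / _; set v := k%:R / _; set z := (b : nat)%:R / _; set y := e.+1%:R^-1; lra.
have hs := @sum_index_ge k (d 0%N) (d 1%N) e.+1 isT d1p d0p kd d10.
have trE : tr m.+2 xi W * tr m.+2 xi (W`_i`_j)%:P%:P =
    (tr m.+1 (sh xi) Wi)%:P * map_poly polyC (tr m.+1 (skip1 xi) Wj : {poly MP m}).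
  by rewrite -tr_map_polyC -(tr_polyC (m := m.+1)) -!rmorphM WE.
have big : vg m.+2 true w ((tr m.+1 (sh xi) Wi)%:P *
    map_poly polyC (tr m.+1 (skip1 xi) Wj : {poly MP m})) (a1 + a2).
  rewrite -trE; apply: vg_strict (@vgM m.+2 false false w _ _ _ 0 vW (vg_triv _ w0 (lexx 0))).
  rewrite addr0; apply: lt_le_trans hs.
  have -> : k%:R / (16%:R * e.+1%:R ^+ 2) = 4%:R * (k%:R / (64%:R * e.+1%:R ^+ 2)) :> rat.
    have : e.+1%:R != 0 :> rat by rewrite pnatr_eq0.
    by move: (e.+1%:R : rat) (k%:R : rat) => s t s0; field.
  have : 0 < k%:R / (64%:R * e.+1%:R ^+ 2) :> rat.
    by rewrite divr_gt0 ?mulr_gt0 ?exprn_gt0 ?ltr0n.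
  move: ha1 ha2; set y := k%:R / _; lra.
apply: (@val_mul m.+2 w _ _ a1 a2 _ _ _ _ big).
- exact/(@vg_polyC m.+1).
- by move=> /(@vg_polyC m.+1).
- exact/(@vg_map_polyC m).
- by move=> /(@vg_map_polyC m).
Qed.

Theorem roth_lemma m e : exists2 Om, (0 < Om)%N & small_index_property m e Om.
Proof.
elim: m e => [|m IH] e; first by exists e.+1 => //; exact: small_index_base.
have [Om Om0 h] := IH (64 * e.+1 ^ 2).-1.
by exists (3 * Om + 8 * e.+1)%N; [lia | exact: small_index_step].
Qed.

(** * Siegel's lemma and tensors *)

(** Pigeonhole on vectors with entries in 0..B, [B = 2 N A]. Adding [A B] to each term places every
    value in 0..B^2, and [B^2 + 1 < (B + 1)^2] together with twice as many unknowns as equations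
    forces a collision. *)
Lemma siegel (X E : finType) (c : E -> X -> int) (A : nat) :
  (0 < A)%N -> (0 < #|X|)%N -> (2 * #|E| <= #|X|)%N ->
  (forall e x, `|c e x| <= A%:Z) ->
  exists z : X -> int, [/\ exists i, z i != 0,
    forall i, `|z i| <= (2 * #|X| * A)%:Z & forall e, \sum_i c e i * z i = 0].
Proof.
move=> A0 X0 EX hc; set N := #|X|; pose B := (2 * N * A)%N.
pose v (z : {ffun X -> 'I_B.+1}) e : int :=
  \sum_i (c e i * (z i : nat)%:Z + (A * B)%:Z).
have vr z e : 0 <= v z e <= (B * B)%:Z.
  have term i : 0 <= c e i * (z i : nat)%:Z + (A * B)%:Z <= (2 * A * B)%:Z.
    have := hc e i; have := ltn_ord (z i); rewrite ltnS.
    by move: (nat_of_ord (z i)) (c e i) => n x nB hx; apply/andP; split; nia.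
  apply/andP; split; first by apply: sumr_ge0 => i _; case/andP: (term i).
  apply: (@le_trans _ _ (\sum_(i : X) (2 * A * B)%:Z)).
    by apply: ler_sum => i _; case/andP: (term i).
  by rewrite sumr_const -/N -mulr_natl /B; lia.
pose f (z : {ffun X -> 'I_B.+1}) : {ffun E -> 'I_(B * B).+1} := [ffun e => inord `|v z e|%N].
have fv z z' e : f z = f z' -> v z e = v z' e.
  move=> /ffunP /(_ e); rewrite !ffunE => /(congr1 val) /=.
  have /andP[h1 h2] := vr z e; have /andP[h3 h4] := vr z' e.
  by rewrite !inordK; lia.
have B0 : (0 < B)%N by rewrite /B !muln_gt0 /= X0.
have nif : ~ injective f.
  move=> /leq_card; rewrite !card_ffun !card_ord -/N leqNgt => /negP; apply.
  have h1 : (B * B + 1 < (B + 1) ^ 2)%N by nia.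
  have [E0|E0] := posnP #|E|.
    by rewrite E0 expn0 (leq_trans (_ : 1 < B.+1)%N) // -{1}(expn1 B.+1) leq_pexp2l.
  apply: (@leq_trans ((B.+1 ^ 2) ^ #|E|)%N).
    by rewrite ltn_exp2r //; lia.
  by rewrite -expnM leq_pexp2l.
have /injectivePn [z [z' nez fz]] : ~~ injectiveb f by apply/injectiveP.
exists (fun i => (z i : nat)%:Z - (z' i : nat)%:Z); split.
- apply/existsP; move: nez; apply: contraNT; rewrite negb_exists => /forallP h.
  by apply/eqP/ffunP => i; apply: val_inj => /=; move: (h i); rewrite negbK subr_eq0 => /eqP [].
- by move=> i; have := ltn_ord (z i); have := ltn_ord (z' i); rewrite -/B; lia.
move=> e; have := fv _ _ e fz; rewrite /v !big_split /= => /addIr E'.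
by under eq_bigr do rewrite mulrBr; rewrite sumrB E' subrr.
Qed.

(** Elements of corresponding fibres are matched by their rank in the enumerations. *)
Lemma perm_of_fibers (S T : finType) (f g : S -> T) :
  (forall t, #|[set s | f s == t]| = #|[set s | g s == t]|) ->
  exists sigma : {perm S}, forall s, f (sigma s) = g s.
Proof.
move=> h.
pose F t := enum [set s | f s == t]; pose G t := enum [set s | g s == t].
have sFG t : size (F t) = size (G t) by rewrite -!cardE.
pose sg s := nth s (F (g s)) (index s (G (g s))).
have hs s : (index s (G (g s)) < size (F (g s)))%N.
  by rewrite sFG index_mem mem_enum inE.
have fs s : f (sg s) = g s.
  by have := mem_nth s (hs s); rewrite mem_enum inE => /eqP.
have sgi : injective sg.
  move=> s s' E; have gE : g s = g s' by rewrite -!fs E.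
  move: E; rewrite /sg gE (set_nth_default s') -?gE ?hs // gE => /eqP.
  rewrite nth_uniq ?enum_uniq // -?gE ?hs ?gE ?hs // => /eqP ie.
  rewrite -(nth_index s (_ : s \in G (g s'))) ?mem_enum ?inE ?gE // ie.
  by rewrite (set_nth_default s') ?index_mem ?mem_enum ?inE // nth_index // mem_enum inE.
by exists (perm sgi) => s; rewrite permE.
Qed.

(** * Tensors indexed by words *)

(** One slot per tensor factor, with [d h] factors in block [h]. A function on words gives the
    coordinates of a tensor; if it depends only on [cnt], it is symmetric in each block, as are
    multihomogeneous forms of degree [d h] in the four variables of block [h]. *)
Definition slot (m : nat) (d : nat -> nat) : finType := {h : 'I_m & 'I_(d h)}.
Definition blk m d (s : slot m d) : 'I_m := tag s.
Definition word m d := {ffun slot m d -> 'I_4}.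
Definition wtype m d := {ffun 'I_m * 'I_4 -> 'I_#|slot m d|.+1}.

Lemma card_blk m d (h : 'I_m) : #|[set s : slot m d | blk s == h]| = d h.
Proof.
rewrite -[RHS]card_ord -(fintype.card_image (f := fun i : 'I_(d h) => (Tagged (fun h : 'I_m => 'I_(d h)) i : slot m d))); last first.
  by move=> i j /= /eqP; rewrite -tag_eqE /tag_eq eqxx /= tagged_asE => /eqP.
apply: eq_card => s; rewrite inE; apply/eqP/fintype.imageP => [E|[i _ ->]] //.
by case: s E => h' i /= E; subst h'; exists i.
Qed.

Lemma card_slot m d : #|slot m d| = (\sum_(h < m) d h)%N.
Proof.
rewrite -sum1_card (partition_big (@blk m d) xpredT) //=.
apply: eq_bigr => h _; rewrite -[RHS](@card_blk m d h) -sum1_card.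
by apply: eq_bigl => s; rewrite inE.
Qed.

Definition cnt m d (w : word m d) : wtype m d :=
  [ffun x => inord #|[set s | (blk s == x.1) && (w s == x.2)]|].

Lemma cntE m d (w : word m d) h i :
  cnt w (h, i) = #|[set s | (blk s == h) && (w s == i)]| :> nat.
Proof. by rewrite ffunE /= inordK // ltnS max_card. Qed.

Lemma sum_cnt m d (w : word m d) h : (\sum_i (cnt w (h, i) : nat))%N = d h.
Proof.
rewrite -(@card_blk m d h) -sum1_card (partition_big w xpredT) //=.
apply: eq_bigr => i _; rewrite cntE -sum1_card.
by apply: eq_bigl => s; rewrite !inE.
Qed.

Lemma cnt_perm m d (w w' : word m d) : cnt w = cnt w' ->
  exists sigma : {perm slot m d}, forall s, blk (sigma s) = blk s /\ w (sigma s) = w' s.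
Proof.
move=> E; have [[h i]|sg hs] := @perm_of_fibers _ _ (fun s => (blk s, w s)) (fun s => (blk s, w' s)).
  have := congr1 (fun t : wtype m d => t (h, i) : nat) E; rewrite !cntE => E'.
  have e (v : word m d) : #|[set s | (blk s, v s) == (h, i)]| =
      #|[set s | (blk s == h) && (v s == i)]|.
    by apply: eq_card => s; rewrite !inE xpair_eqE.
  by rewrite !e.
by exists sg => s; have [-> ->] := hs s.
Qed.

Section Tensor.
Variables (K : comNzRingType) (m : nat) (d : nat -> nat).
Implicit Types (p : word m d -> K) (g : 'I_m -> 'I_4 -> 'I_4 -> K).

(** The value of the multilinear form [p] when the vector in slot [s] is column [w' s] of the matrix
    of its block. *)
Definition act g p : word m d -> K :=
  fun w' => \sum_w p w * \prod_s g (blk s) (w s) (w' s).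

Lemma act_comp A B p w :
  act B (act A p) w = act (fun h k j => \sum_i A h k i * B h i j) p w.
Proof.
rewrite /act; under eq_bigr => w'' _ do rewrite mulr_suml.
rewrite exchange_big /=; apply: eq_bigr => w1 _.
under eq_bigr => w'' _ do rewrite -mulrA -big_split /=.
rewrite -mulr_sumr; congr (_ * _); rewrite bigA_distr_bigA /=.
by [].
Qed.

Lemma act_sym g p w w' : (forall u v, cnt u = cnt v -> p u = p v) ->
  cnt w = cnt w' -> act g p w = act g p w'.
Proof.
move=> psym /cnt_perm [sg hs].
pose r (u : word m d) : word m d := [ffun s => u (sg s)].
have rinj : injective r.
  move=> u v /ffunP E; apply/ffunP => s.
  by have := E (sg^-1 s)%g; rewrite !ffunE permKV.
have cr u : cnt (r u) = cnt u.
  apply/ffunP => -[h i]; apply: val_inj; rewrite /= !cntE.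
  rewrite -(card_imset _ (@perm_inj _ sg)); apply: eq_card => s; rewrite inE.
  apply/imsetP/andP => [[s' + ->]|[/eqP <- /eqP <-]].
    by rewrite inE ffunE (hs s').1 => /andP[/eqP <- /eqP <-].
  exists (sg^-1 s)%g; last by rewrite permKV.
  by rewrite inE ffunE permKV -(hs _).1 permKV !eqxx.
rewrite /act [RHS](reindex_inj rinj) /=; apply: eq_bigr => u _.
rewrite (psym (r u) u (cr u)); congr (_ * _).
rewrite (reindex_inj (@perm_inj _ sg)) /=; apply: eq_bigr => s _.
by rewrite ffunE; have [-> ->] := hs s.
Qed.

(* Letter 3 stands for the vector outside the hyperplane. *)
Lemma act_triangular (wt : 'I_m -> rat) x g p :
  (forall h, 0 <= wt h) -> (forall h j, j != ord_max -> g h ord_max j = 0) ->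
  (forall w : word m d, \sum_(s | w s == ord_max) wt (blk s) < x -> p w = 0) ->
  forall w : word m d, \sum_(s | w s == ord_max) wt (blk s) < x -> act g p w = 0.
Proof.
move=> wt0 hg hp w hw; rewrite /act big1 // => u _.
case: (boolP [forall s, (u s == ord_max) ==> (w s == ord_max)]) => [/forallP h|].
  rewrite hp ?mul0r //; apply: le_lt_trans hw.
  rewrite [X in _ <= X](bigID (fun s => u s == ord_max)) /= ler_wpDr ?sumr_ge0 //.
  rewrite le_eqVlt; apply/orP; left; apply/eqP; apply: eq_bigl => s.
  by have := h s; case: (u s == ord_max) => /=; rewrite ?andbT ?andbF.
rewrite negb_forall => /existsP [s]; rewrite negb_imply => /andP[/eqP us ws].
by rewrite (bigD1 s) //= us hg // mul0r mulr0.
Qed.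
End Tensor.

(** * Chebyshev estimate on types *)

Section Chebyshev.
Variables (R : realFieldType) (m : nat) (d : nat -> nat) (sw : 'I_m -> 'I_4 -> R).

Definition types : {set wtype m d} := [set cnt w | w in {: word m d}].

(** All types are given equal weight, because they are the unknowns of a symmetric tensor; for this
    measure a letter has mean multiplicity [d h / 4] in block [h]. *)
Definition dev (h : 'I_m) (t : wtype m d) : R :=
  \sum_i ((t (h, i) : nat)%:R - (d h)%:R / 4) * sw h i.

Definition total_dev (t : wtype m d) : R := \sum_h dev h t.

(** A cyclic shift of the four letters inside one block. Averaging over this symmetry of the set of
    types replaces a computation of expectations. *)
Definition rot (h0 : 'I_m) (t : wtype m d) : wtype m d :=
  [ffun x => if x.1 == h0 then t (x.1, x.2 + 1) else t x].

Lemma iter_rotE h0 n t h i :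
  iter n (rot h0) t (h, i) = if h == h0 then t (h, i + n%:R) else t (h, i).
Proof.
elim: n i => [|n IH] i; first by rewrite addr0 if_same.
by rewrite iterS ffunE /= !IH; case: eqP => // _; rewrite -addrA -nat1r.
Qed.

Lemma rot4 h0 : iter 4 (rot h0) =1 id.
Proof.
move=> t; apply/ffunP => -[h i]; rewrite iter_rotE.
have -> : (4%:R : 'I_4) = 0 by rewrite Zp_nat; apply: val_inj.
by rewrite addr0 if_same.
Qed.

Lemma rot_inj h0 : injective (rot h0).
Proof. by apply: (can_inj (g := iter 3 (rot h0))) => t; rewrite -iterSr rot4. Qed.

Lemma rot_types h0 t : t \in types -> rot h0 t \in types.
Proof.
move=> /imsetP [w _ ->]; apply/imsetP.
exists [ffun s => if blk s == h0 then w s - 1 else w s] => //.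
apply/ffunP => -[h i]; apply: val_inj; rewrite /= cntE ffunE /=.
case: (eqVneq h h0) => [->|nh]; rewrite cntE; apply: eq_card => s; rewrite !inE ffunE.
  by case: (eqVneq (blk s) h0) => //= _; rewrite subr_eq.
by case: (eqVneq (blk s) h) => //= ->; rewrite (negPf nh).
Qed.

Lemma rot_typesE h0 t : (rot h0 t \in types) = (t \in types).
Proof.
apply/idP/idP => [h|]; last exact: rot_types.
by rewrite -[t](rot4 h0) iterSr; do 3! apply: rot_types.
Qed.

Lemma sum_rot h0 (f : wtype m d -> R) :
  \sum_(t in types) f (rot h0 t) = \sum_(t in types) f t.
Proof.
rewrite [RHS](reindex_inj (@rot_inj h0)) /=.
by apply: eq_bigl => t; rewrite rot_typesE.
Qed.

Lemma sum_types h t : t \in types -> (\sum_i (t (h, i) : nat))%N = d h.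
Proof. by case/imsetP => w _ ->; exact: sum_cnt. Qed.

Lemma sum_dev_rot h t : t \in types -> \sum_(r < 4) dev h (iter r (rot h) t) = 0.
Proof.
move=> tT; rewrite exchange_big /= big1 // => i _; rewrite -mulr_suml.
rewrite [X in X * _](_ : _ = 0) ?mul0r //.
rewrite sumrB sumr_const card_ord -[_ *+ 4]mulr_natr divfK ?pnatr_eq0 //.
rewrite -(sum_types h tT) natr_sum; apply/eqP; rewrite subr_eq0; apply/eqP.
rewrite [RHS](reindex_inj (addrI i)) /=; apply: eq_bigr => r _.
rewrite iter_rotE eqxx; congr ((nat_of_ord (t (h, i + _)))%:R).
by rewrite Zp_nat; apply: val_inj; rewrite /= modn_small.
Qed.

(** The rotations of block [h] leave [dev h'] unchanged, and [dev h] sums to zero over the four of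
    them. *)
Lemma cross_dev h h' : h != h' -> \sum_(t in types) dev h t * dev h' t = 0.
Proof.
move=> nh; set S := \sum_(_ in _) _.
have dh' t : dev h' (rot h t) = dev h' t.
  by apply: eq_bigr => i _; rewrite ffunE /= eq_sym (negPf nh).
have Sr r : S = \sum_(t in types) dev h (iter r (rot h) t) * dev h' t.
  elim: r => [//|r IH]; rewrite IH -(sum_rot h); apply: eq_bigr => t _.
  by rewrite -iterSr dh'.
have : \sum_(r < 4) S = 0.
  rewrite (eq_bigr _ (fun (r : 'I_4) _ => Sr r)) exchange_big /= big1 // => t tT.
  by rewrite -mulr_suml sum_dev_rot // mul0r.
by rewrite sumr_const card_ord => /eqP; rewrite mulrn_eq0 => /eqP.
Qed.

(** The cross terms vanish, so the second moment grows only linearly in the number of blocks,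
    whereas the square of an admissible [lam] will grow quadratically. *)
Lemma chebyshev (Phi lam : R) : 0 < lam ->
  (forall h t, t \in types -> `|dev h t| <= Phi) ->
  #|[set t in types | lam < total_dev t]|%:R * lam ^+ 2 <= #|types|%:R * m%:R * Phi ^+ 2.
Proof.
move=> lam0 hPhi; set bad := [set t in _ | _].
apply: (@le_trans _ _ (\sum_(t in types) total_dev t ^+ 2)).
  rewrite (big_setID bad) /= ler_wpDr //.
    by apply: sumr_ge0 => t _; exact: sqr_ge0.
  have -> : types :&: bad = bad by apply/setP => t; rewrite !inE; case: (t \in types).
  rewrite mulr_natl -sumr_const; apply: ler_sum => t; rewrite inE => /andP[_ ht].
  by rewrite lerXn2r ?nnegrE ?(ltW lam0) ?(ltW (lt_trans lam0 ht)) ?(ltW ht).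
have -> : \sum_(t in types) total_dev t ^+ 2 = \sum_(t in types) \sum_h dev h t ^+ 2.
  transitivity (\sum_(t in types) \sum_h \sum_h' dev h t * dev h' t).
    by apply: eq_bigr => t _; rewrite expr2 /total_dev mulr_suml; apply: eq_bigr => h _; rewrite mulr_sumr.
  rewrite exchange_big /= [RHS]exchange_big /=; apply: eq_bigr => h _.
  rewrite exchange_big /= (bigD1 h) //= [X in _ + X]big1 ?addr0 // => h' nh.
  by rewrite cross_dev // eq_sym.
apply: (@le_trans _ _ (\sum_(t in types) \sum_(h < m) Phi ^+ 2)).
  apply: ler_sum => t tT; apply: ler_sum => h _.
  have := hPhi h t tT; rewrite ler_norml => /andP[]; move: (dev h t) => x; nra.
by rewrite !sumr_const card_ord -[_ *+ #|_|]mulr_natl -[Phi ^+ 2 *+ m]mulr_natl mulrA.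
Qed.

Lemma prod_weights (w : word m d) :
  \sum_s sw (blk s) (w s) = total_dev (cnt w) + \sum_(h < m) (d h)%:R / 4 * \sum_i sw h i.
Proof.
rewrite /total_dev -big_split /= (partition_big (@blk m d) xpredT) //=.
apply: eq_bigr => h _; rewrite (partition_big w xpredT) //=.
rewrite /dev mulr_sumr -big_split /=; apply: eq_bigr => i _.
rewrite -mulrDl subrK cntE (eq_bigr (fun=> sw h i)); last by move=> s /andP[/eqP -> /eqP ->].
by rewrite sumr_const mulr_natl; congr (_ *+ _); apply: eq_card => s; rewrite inE.
Qed.
End Chebyshev.

(** * The auxiliary tensor *)

Section AuxiliaryTensor.
Variables (R : realFieldType) (theta : R).

(** Powers of [theta], cleared of denominators, written with integer coordinates of at most
    exponential size: one equation over [Z[theta]] is implied by [dd] integer equations. *)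
Definition power_reduction (dd : nat) (f0 : int) (C : nat) :=
  [/\ (0 < dd)%N, f0 != 0, (0 < C)%N, `|f0| <= C%:Z &
   forall n, exists2 c : 'I_dd -> int,
     f0%:~R ^+ n * theta ^+ n = \sum_j (c j)%:~R * theta ^+ j &
     forall j, `|c j| <= (C ^ n)%:Z].

Lemma power_reduction_exists (f : {poly int}) : f != 0 -> root (map_poly intr f) theta ->
  exists dd f0 C, power_reduction dd f0 C.
Proof.
move=> fn0 rf; pose f0 := lead_coef f.
have [dd sf] : exists dd, size f = dd.+1.
  by exists (size f).-1; rewrite prednK // lt0n size_poly_eq0.
have f00 : f0 != 0 by rewrite lead_coef_eq0.
have fdd : f`_dd = f0 by rewrite /f0 lead_coefE sf.
have dd0 : (0 < dd)%N.
  rewrite lt0n; apply/eqP => E; move: rf; rewrite rootE.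
  have -> : f = f0%:P by rewrite [LHS]size1_polyC ?sf ?E //; congr (_%:P); rewrite -fdd E.
  by rewrite map_polyC hornerC /= intr_eq0 (negPf f00).
have rel : f0%:~R * theta ^+ dd = - \sum_(j < dd) (f`_j)%:~R * theta ^+ j.
  move: rf; rewrite rootE horner_coef size_map_poly_id0 ?intr_eq0 ?lead_coef_eq0 // sf.
  rewrite big_ord_recr /= coef_map /= fdd addrC addr_eq0 => /eqP ->; congr (- _).
  by apply: eq_bigr => j _; rewrite coef_map.
pose M := (\sum_(j < dd) absz (f`_j)%R)%N.
have fM (j : 'I_dd) : `|f`_j| <= M%:Z.
  by rewrite -abszE lez_nat /M (bigD1 j) //= leq_addr.
(* Multiplying by [f0 * theta] scales and shifts the coordinates by [f0], then rewrites the top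
   power with the other coefficients of [f]: the bound grows by at most [|f0| + M]. *)
pose C := (`|f0|%N + M)%N.
exists dd, f0, C; split => //; [by rewrite /C; lia | by rewrite /C; lia |].
elim=> [|n [c cE cC]].
  exists (fun j : 'I_dd => ((j : nat) == 0%N)%:R) => [|j]; last by case: eqP; rewrite ?expn0.
  rewrite !expr0 mulr1 (bigD1 (Ordinal dd0)) //= big1 ?addr0 ?expr0 ?mulr1 // => j.
  by rewrite -val_eqE /= => /negPf ->; rewrite mul0r.
case: dd dd0 sf fdd rel @M fM @C c cE cC => // e _ sf fdd rel M fM C c cE cC.
pose c' (j : 'I_e.+1) : int :=
  (if (j : nat) is i.+1 then f0 * c (inord i) else 0) - c ord_max * f`_j.
exists c'.
  rewrite !exprSr mulrACA cE [f0%:~R * theta]mulrC mulr_suml.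
  transitivity (\sum_(j < e.+1) (f0 * c j)%:~R * theta ^+ j.+1).
    by apply: eq_bigr => j _; rewrite intrM exprSr; ring.
  rewrite big_ord_recr /= intrM mulrAC rel.
  have -> : \sum_j (c' j)%:~R * theta ^+ j =
      \sum_(j < e.+1) (if (j : nat) is i.+1 then f0 * c (inord i) else 0)%:~R * theta ^+ j
      - (c ord_max)%:~R * \sum_(j < e.+1) (f`_j)%:~R * theta ^+ j.
    rewrite mulr_sumr -sumrB; apply: eq_bigr => j _.
    by rewrite /c' intrB intrM; ring.
  rewrite mulNr [in LHS]mulrC; congr (_ - _).
  rewrite [RHS]big_ord_recl /= mul0r add0r; apply: eq_bigr => j _.
  rewrite /bump /=; congr ((f0 * c _)%:~R * _); apply: val_inj.
  by rewrite /= add0n inordK // ltnS ltnW // ltn_ord.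
move=> j; rewrite /c'.
have h1 : `|(if (j : nat) is i.+1 then f0 * c (inord i) else 0)| <= (`|f0|%N * C ^ n)%:Z.
  case: (nat_of_ord j) => [|i]; first by rewrite normr0.
  by rewrite normrM PoszM abszE ler_wpM2l ?normr_ge0.
have h2 : `|c ord_max * f`_j| <= (M * C ^ n)%:Z.
  by rewrite normrM PoszM mulrC ler_pM ?normr_ge0.
apply: (le_trans (ler_normB _ _)); apply: (le_trans (lerD h1 h2)).
by rewrite -PoszD -mulnDl expnS.
Qed.

(** Siegel's lemma with one unknown per type and [dd] equations per type of deviation above [lam];
    the hypothesis on [lam] and Chebyshev's estimate make the equations at most half as many as the
    unknowns. Each slot contributes an exponent at most 2, so the factor [f0 ^ (2 D)] suffices to
    clear denominators. *)
Lemma auxiliary_tensor dd f0 C (sg : 'I_4 -> 'I_4 -> int) (ex : 'I_4 -> 'I_4 -> nat)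
    m d (sw : 'I_m -> 'I_4 -> R) (lam Phi : R) :
  power_reduction dd f0 C ->
  (forall i j, `|sg i j| <= 1) -> (forall i j, (ex i j <= 2)%N) ->
  0 < lam -> (forall h t, t \in types m d -> `|dev sw h t| <= Phi) ->
  2 * dd%:R * m%:R * Phi ^+ 2 <= lam ^+ 2 ->
  let D := #|slot m d| in
  exists p : word m d -> int,
  [/\ forall u v, cnt u = cnt v -> p u = p v,
      exists w, p w != 0,
      forall w, `|p w| <= (2 * 16 ^ D * C ^ (2 * D))%:Z &
      forall w, lam < total_dev sw (cnt w) ->
        act (fun _ k i => (sg k i)%:~R * theta ^+ ex k i) (fun w => (p w)%:~R) w = 0].
Proof.
move=> [dd0 f00 C0 f0C hred] hsg hex lam0 hPhi hlam D.
have /choice [cN cNP] n : exists c : 'I_dd -> int,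
    f0%:~R ^+ n * theta ^+ n = \sum_j (c j)%:~R * theta ^+ j /\
    forall j, `|c j| <= (C ^ n)%:Z by have [c h1 h2] := hred n; exists c.
pose bad := [set t in types m d | lam < total_dev sw t].
pose X : finType := {t : wtype m d | t \in types m d}.
pose E : finType := {x : wtype m d * 'I_dd | x \in finset.setX bad [set: 'I_dd]}.
have cX : #|X| = #|types m d| by rewrite card_sig; apply: eq_card => t; rewrite !inE.
have cE : #|E| = (#|bad| * dd)%N.
  by rewrite card_sig -[RHS](_ : #|finset.setX bad [set: 'I_dd]| = _) ?cardsX ?cardsT ?card_ord //;
     apply: eq_card => x; rewrite !inE.
have cW : #|{: word m d}| = (4 ^ D)%N by rewrite card_ffun card_ord.
have cXW : (#|X| <= 4 ^ D)%N by rewrite cX -cW leq_imset_card.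
have X0 : (0 < #|X|)%N.
  rewrite cX card_gt0; apply/set0Pn; exists (cnt [ffun=> ord0]).
  by apply/imsetP; exists [ffun=> ord0].
have EX : (2 * #|E| <= #|X|)%N.
  rewrite cX cE -(ler_nat R) !natrM.
  have lam2 : 0 < lam ^+ 2 by rewrite exprn_gt0.
  rewrite -(ler_pM2r lam2).
  have := @chebyshev R m d sw Phi lam lam0 hPhi; rewrite -/bad => ch.
  have d0R : 0 <= dd%:R :> R by rewrite ler0n.
  have := ler_wpM2l (ler0n R #|types m d|) hlam; move: ch d0R.
  move: (#|bad|%:R : R) (#|types m d|%:R : R) (m%:R : R) (dd%:R : R) (lam ^+ 2) (Phi ^+ 2).
  by move=> b t x y l P ch y0 ht; have := ler_wpM2l y0 ch; lra.
pose nn (w w' : word m d) := (\sum_s ex (w s) (w' s))%N.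
have nnD (w w' : word m d) : (nn w w' <= 2 * D)%N.
  rewrite /nn -[X in (_ <= X)%N](_ : \sum_(s : slot m d) 2 = _)%N; last first.
    by rewrite sum_nat_const mulnC.
  by apply: leq_sum.
pose cc (w w' : word m d) j : int :=
  (\prod_s sg (w s) (w' s)) * f0 ^+ (2 * D - nn w w') * cN (nn w w') j.
have ccE (w w' : word m d) : f0%:~R ^+ (2 * D) * \prod_s ((sg (w s) (w' s))%:~R * theta ^+ ex (w s) (w' s))
    = \sum_j (cc w w' j)%:~R * theta ^+ j.
  rewrite big_split /= -rmorph_prod prodrXr -/(nn w w').
  have -> : f0%:~R ^+ (2 * D) = f0%:~R ^+ (2 * D - nn w w') * f0%:~R ^+ nn w w' :> R.
    by rewrite -exprD subnK.
  transitivity ((\prod_s sg (w s) (w' s))%:~R * f0%:~R ^+ (2 * D - nn w w') *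
     (f0%:~R ^+ nn w w' * theta ^+ nn w w')); first by ring.
  rewrite (cNP _).1 mulr_sumr; apply: eq_bigr => j _.
  by rewrite /cc !intrM rmorphXn /=; ring.
have ccC (w w' : word m d) j : `|cc w w' j| <= (C ^ (2 * D))%:Z.
  rewrite /cc !normrM.
  have h1 : `|\prod_s sg (w s) (w' s)| <= 1.
    by rewrite normr_prod; apply: prodr_ile1 => s _; rewrite normr_ge0 hsg.
  have h2 : `|f0 ^+ (2 * D - nn w w')| <= (C ^ (2 * D - nn w w'))%:Z.
    by rewrite normrX -[X in _ <= X]natz natrX natz lerXn2r ?nnegrE ?normr_ge0.
  have h3 := (cNP (nn w w')).2 j.
  have -> : (C ^ (2 * D))%:Z = 1 * (C ^ (2 * D - nn w w'))%:Z * (C ^ nn w w')%:Z.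
    by rewrite mul1r -PoszM -expnD subnK.
  by do 2! (apply: ler_pM; rewrite ?mulr_ge0 ?normr_ge0 //).
(* The transformed tensor is again symmetric, so its vanishing need only be imposed on one word of
   each type. *)
pose rep (t : wtype m d) : word m d := odflt [ffun=> ord0] [pick w | cnt w == t].
have repE t : t \in types m d -> cnt (rep t) = t.
  move=> /imsetP [w _ tE]; rewrite /rep; case: pickP => [u /eqP //|/(_ w)].
  by rewrite tE eqxx.
pose c (e : E) (x : X) : int :=
  \sum_(w | cnt w == val x) cc w (rep (val e).1) (val e).2.
have hc e x : `|c e x| <= (4 ^ D * C ^ (2 * D))%N%:Z.
  apply: (le_trans (ler_norm_sum _ _ _)).
  apply: (@le_trans _ _ (\sum_(w : word m d) (C ^ (2 * D))%:Z)).
    rewrite [X in _ <= X](bigID (fun w => cnt w == val x)) /= ler_wpDr ?sumr_ge0 //.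
    exact: ler_sum.
  by rewrite sumr_const cW -[_ *+ _]mulr_natl natz -PoszM.
have A0 : (0 < 4 ^ D * C ^ (2 * D))%N by rewrite muln_gt0 !expn_gt0 C0.
have [z [[x zx] zC zE]] := siegel A0 X0 EX hc.
have memt (w : word m d) : cnt w \in types m d by apply/imsetP; exists w.
pose xc (w : word m d) : X := exist _ (cnt w) (memt w).
exists (fun w => z (xc w)); split.
- by move=> u v uv; congr (z _); apply: val_inj.
- case: x zx => t tT zx; have /imsetP [w _ tE] := tT; exists w.
  by have -> : xc w = exist _ t tT by apply: val_inj; rewrite /= tE.
- move=> w; apply: (le_trans (zC _)); rewrite lez_nat.
  have -> : (16 = 4 * 4)%N by []; rewrite expnMn.
  by move: cXW; move: (4 ^ D)%N (C ^ (2 * D))%N => a b; nia.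
move=> w hw; have wT := memt w.
pose p (u : word m d) : R := (z (xc u))%:~R.
rewrite -[X in act _ X _]/p.
have psym u v : cnt u = cnt v -> p u = p v.
  by move=> uv; rewrite /p; congr ((z _)%:~R); apply: val_inj.
rewrite (act_sym _ psym (w' := rep (cnt w))) ?repE //.
have f0R : f0%:~R ^+ (2 * D) != 0 :> R by rewrite expf_neq0 ?intr_eq0.
apply: (mulfI f0R); rewrite mulr0 /act mulr_sumr.
transitivity (\sum_j (\sum_u z (xc u) * cc u (rep (cnt w)) j)%:~R * theta ^+ j).
  under eq_bigr => u _ do rewrite mulrCA ccE mulr_sumr.
  rewrite exchange_big /=; apply: eq_bigr => j _; rewrite rmorph_sum mulr_suml.
  by apply: eq_bigr => u _; rewrite /p /= intrM mulrA.
rewrite big1 // => j _.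
have eE : (cnt w, j) \in finset.setX bad [set: 'I_dd] by rewrite !inE wT hw.
have := zE (exist _ (cnt w, j) eE); rewrite /c /=.
rewrite (partition_big xc xpredT) //= => h0.
rewrite [X in X%:~R](_ : _ = 0) ?mul0r // -[RHS]h0; apply: eq_bigr => y _.
rewrite mulr_suml; apply: eq_big => [u|u /eqP <-]; last by rewrite mulrC.
by rewrite -val_eqE.
Qed.
End AuxiliaryTensor.

(** * Variables and coefficients of iterated polynomials *)

Fixpoint Xv (m h : nat) : MP m :=
  match m return MP m with
  | 0 => 0
  | m'.+1 => if h is h'.+1 then (Xv m' h')%:P else 'X
  end.

Lemma vg_Xv m h b w x : (h < m)%N -> (if b then x < w h else x <= w h) -> vg m b w (Xv m h) x.
Proof.
elim: m h w x => // m IH [|h] w x hm hx /=.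
  case=> [|[|i]]; rewrite coefX /=; [exact: vg0| |exact: vg0].
  have {}hx : (if b then x - 1%:R * w 0%N < 0 else x - 1%:R * w 0%N <= 0).
    by move: hx; case: (b) => hx; rewrite mul1r ?subr_lt0 ?subr_le0.
  elim: m {IH hm} (sh w) (x - 1%:R * w 0%N) hx => [|m IH] w' y hy /=; first by right.
  case=> [|i]; rewrite coef1 /=; last exact: vg0.
  by rewrite mul0r subr0; apply: IH.
by apply/vg_polyC; apply: IH.
Qed.

Lemma tr_Xv m h xi : (h < m)%N -> tr m xi (Xv m h) = Xv m h + cst m (xi h).
Proof.
elim: m h xi => // m IH [|h] xi hm; first by rewrite /= map_polyX comp_polyX.
rewrite [Xv _ _]/= tr_polyC IH // polyCD.
by [].
Qed.

Lemma tr_cst m xi c : tr m xi (cst m c) = cst m c.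
Proof. by elim: m xi => // m IH xi; rewrite [cst _ _]/= tr_polyC IH. Qed.

Lemma nrm_Xv m h : nrm m (Xv m h) <= 1.
Proof.
elim: m h => [|m IH] [|h]; rewrite ?nrm0 ?ler01 //; last by rewrite nrm_polyC.
rewrite (@nrmE m 'X 2) ?size_polyX // !big_ord_recl big_ord0 !coefX /= nrm0 nrm1.
by rewrite add0r addr0.
Qed.

Lemma itg_Xv m h : itg m (Xv m h).
Proof.
elim: m h => [|m IH] [|h] //=; first by case=> [|[|i]]; rewrite coefX; [exact: itg0|exact: itg1|exact: itg0].
by case=> [|i]; rewrite coefC //=; exact: itg0.
Qed.

Lemma itg_cst m (z : int) : itg m (cst m z%:~R).
Proof.
elim: m => [|m IH] /=; first exact: intr_int.
by case=> [|i]; rewrite coefC //=; exact: itg0.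
Qed.

Lemma nrm_cst m c : nrm m (cst m c) = `|c|.
Proof. by elim: m => [|m IH] //; rewrite nrm_polyC. Qed.

Lemma dg_weak m d d' F : (forall h, (d h <= d' h)%N) -> dg m d F -> dg m d' F.
Proof.
elim: m d d' F => // m IH d d' F hd [sF hF]; split.
  by rewrite (leq_trans sF) // ltnS.
by move=> i; apply: IH (hF i) => h; exact: hd.
Qed.

Lemma dg_Xv m h : dg m (fun k => k == h : nat) (Xv m h).
Proof.
elim: m h => [//|m IH] [|h]; split => /=; rewrite ?size_polyX //.
- case=> [|[|i]]; rewrite coefX; try exact: dg0.
  by apply: dg_weak (dg1 m).
- by rewrite size_polyC; case: (_ != 0).
by case=> [|i]; rewrite coefC /=; [exact: IH|exact: dg0].
Qed.

Lemma dg_cst m d c : dg m d (cst m c).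
Proof.
elim: m d => // m IH d; split => /=; first by rewrite size_polyC; case: (_ != 0).
by case=> [|i]; rewrite coefC /=; [exact: IH|exact: dg0].
Qed.

Lemma dg_prod_seq m (S : Type) (r : seq S) (f : S -> nat) (G : S -> MP m) :
  (forall s, dg m (fun k => k == f s : nat) (G s)) ->
  dg m (fun k => count (fun s => k == f s) r) (\prod_(s <- r) G s).
Proof.
move=> h; elim: r => [|s r IH]; first by rewrite big_nil; exact: dg1.
by rewrite big_cons; have := dgM (h s) IH.
Qed.

Fixpoint cf (m : nat) : MP m -> (nat -> nat) -> rat :=
  match m return MP m -> (nat -> nat) -> rat with
  | 0 => fun F _ => F
  | m'.+1 => fun F e => @cf m' ((F : {poly MP m'})`_(e 0%N)) (sh e)
  end.
Arguments cf : clear implicits.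

Lemma cf0 m e : cf m 0 e = 0.
Proof. by elim: m e => // m IH e /=; rewrite coef0 IH. Qed.

Lemma cfD m F G e : cf m (F + G) e = cf m F e + cf m G e.
Proof. by elim: m F G e => // m IH F G e /=; rewrite coefD IH. Qed.

Lemma cf_sum m (I : Type) (r : seq I) (P : pred I) (F : I -> MP m) e :
  cf m (\sum_(i <- r | P i) F i) e = \sum_(i <- r | P i) cf m (F i) e.
Proof. exact: (big_morph (fun F => cf m F e) (fun F G => cfD F G e) (cf0 m e)). Qed.

Lemma cf_cst m c F e : cf m (cst m c * F) e = c * cf m F e.
Proof. by elim: m F e => // m IH F e /=; rewrite coefCM IH. Qed.

Lemma cf_Xv m h F e : (h < m)%N -> cf m (Xv m h * F) e =
  if (0 < e h)%N then cf m F (fun k => if k == h then (e k).-1 else e k) else 0.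
Proof.
elim: m h F e => // m IH [|h] F e hm /=.
  rewrite coefXM; case: (e 0%N) => [|i] /=; first exact: cf0.
  by congr (cf _ _ _); apply/funext.
by rewrite coefCM IH.
Qed.

Lemma cf1 m e : cf m 1 e = ([forall h : 'I_m, e h == 0%N])%:R.
Proof.
elim: m e => [|m IH] e; first by rewrite (introT forallP) // => -[].
rewrite /= coef1; case: (eqVneq (e 0%N) 0%N) => E.
  rewrite IH; congr (_%:R); apply: congr1; apply/forallP/forallP => h i.
    case: (unliftP ord0 i) => [j ->|->]; last by rewrite /= E.
    exact: h j.
  exact: (h (lift ord0 i)).
rewrite cf0; case: forallP => // /(_ ord0) /=.
by rewrite (negPf E).
Qed.

Lemma cf_prod m (S : Type) (r : seq S) (f : S -> 'I_m) e :
  cf m (\prod_(s <- r) Xv m (f s)) e =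
  ([forall h : 'I_m, e h == count (fun s => f s == h) r])%:R.
Proof.
elim: r e => [|s r IH] e; first by rewrite big_nil cf1.
rewrite big_cons cf_Xv // IH /=; case: (posnP (e (f s))) => E.
  case: forallP => // /(_ (f s)); rewrite E eqxx add1n //.
congr (_%:R); apply: congr1; apply/forallP/forallP => h i; have := h i.
  case: (eqVneq (i : nat) (f s)) => [ie|ie].
    have -> : f s = i by apply: val_inj.
    by rewrite eqxx /= add1n ie => /eqP <-; rewrite prednK.
  have -> : (f s == i) = false by apply/negP => /eqP fs; rewrite fs eqxx in ie.
  by rewrite add0n.
case: (eqVneq (i : nat) (f s)) => [ie|ie].
  have -> : f s = i by apply: val_inj.
  by rewrite eqxx /= add1n ie => /eqP ->.
have -> : (f s == i) = false by apply/negP => /eqP fs; rewrite fs eqxx in ie.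
by rewrite add0n.
Qed.

(* Columns 0, 1, 2 span the hyperplane orthogonal to [mv]. *)
Definition cmat (mv : 'I_4 -> int) (k j : 'I_4) : rat :=
  if (j : nat) == 3%N then ((k : nat) == 0%N)%:R
  else if (k : nat) == 0%N then - (mv (inord j.+1))%:~R
  else if (k : nat) == j.+1 then (mv ord0)%:~R else 0.

Lemma count_index_enum (T : finType) (P : pred T) :
  count P (index_enum T) = #|[set s | P s]|.
Proof. by rewrite -sum1_count -sum1_card; apply: eq_bigl => s; rewrite inE. Qed.

(** * Restriction of a tensor to two coordinates *)

Section Reduction.
Variables (m : nat) (d : nat -> nat) (mv : 'I_m.+1 -> 'I_4 -> int) (p : word m.+1 d -> int).
Let S := slot m.+1 d.
Hypothesis mv0 : forall h, 0 < mv h ord0.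
Hypothesis psym : forall u v, cnt u = cnt v -> p u = p v.
Variable w0 : word m.+1 d.
Hypothesis pw0 : p w0 != 0.
Hypothesis w0min : forall w, p w != 0 ->
  (#|[set s | (1 < w0 s)%N]| <= #|[set s | (1 < w s)%N]|)%N.

(** At the slots of [z] the letter of [w0] is frozen; the other slots only carry letters 0 and 1,
    coded by a boolean that is true for letter 0. In [wu], a frozen slot receives the column
    involving only letters 0 and [w0 s]; another slot receives column 3, the direction of
    derivation, or column 0, proportional to [(xi, 1, 0, 0)]. *)
Let z (s : S) := (1 < w0 s)%N.
Let wv (v : {ffun S -> bool}) : word m.+1 d :=
  [ffun s => if z s then w0 s else if v s then ord0 else inord 1].
Let vw (w : word m.+1 d) : {ffun S -> bool} := [ffun s => ~~ z s && (w s == ord0)].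
Let wu (u : {ffun S -> bool}) : word m.+1 d :=
  [ffun s => if z s then inord (w0 s).-1 else if u s then ord_max else ord0].
Let xi (h : 'I_m.+1) : rat := - (mv h (inord 1))%:~R / (mv h ord0)%:~R.
Let hh (s : S) (a b : bool) : rat :=
  if z s then (~~ a)%:R else if a then (if b then 1 else xi (blk s)) else (if b then 0 else 1).
Let mm (s : S) (b : bool) : rat :=
  if z s then (mv (blk s) ord0)%:~R else if b then 1 else (mv (blk s) ord0)%:~R.
(** The coefficients of the Taylor expansion at [xi] of the polynomial [F] below, before words
    giving the same monomial are grouped. *)
Let kap (u : {ffun S -> bool}) : rat := \sum_v (p (wv v))%:~R * \prod_s hh s (v s) (u s).

Let wu3 u s : (wu u s == ord_max) = ~~ z s && u s.
Proof.
rewrite ffunE; case: ifP => zs; last by case: (u s); rewrite ?eqxx.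
have := ltn_ord (w0 s); move: zs; rewrite /z -val_eqE /= => z1 z4.
by rewrite inordK; lia.
Qed.

Let vw_wv v : (vw (wv v) == v) = [forall s, z s ==> ~~ v s].
Proof.
apply/eqP/forallP => [E s|h].
  by apply/implyP => zs; rewrite -E ffunE zs.
apply/ffunP => s; rewrite !ffunE; have := h s; case: (z s) => /=; first by move/negPf.
by case: (v s) => //=; rewrite -val_eqE /= inordK.
Qed.

(** Columns 0 and 3 only involve letters 0 and 1, so a contributing word has letters above 1 at
    frozen slots only. If it had letter 0 at one of those, it would have fewer such letters than
    [w0], against minimality. *)
Let supp w u : p w != 0 -> \prod_s cmat (mv (blk s)) (w s) (wu u s) != 0 -> wv (vw w) = w.
Proof.
move=> pw /prodf_neq0 hprod.
have hs s : [\/ z s /\ (w s = ord0 \/ w s = w0 s) | ~~ z s /\ (w s < 2)%N].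
  have := hprod s isT; rewrite /cmat ffunE.
  have := ltn_ord (w0 s); have := ltn_ord (w s).
  case: (boolP (z s)) => zs w4 w04 h.
    left; split=> //; move: h; rewrite inordK; last by move: zs; rewrite /z; lia.
    have -> : ((w0 s).-1 == 3%N) = false by move: zs; rewrite /z; lia.
    rewrite /=; case: (eqVneq (w s : nat) 0%N) => [E _|nE]; first by left; apply: val_inj.
    case: (eqVneq (w s : nat) (w0 s).-1.+1) => [E _|nE2]; last by rewrite eqxx.
    by right; apply: val_inj; rewrite /= E prednK // ltnW.
  right; split=> //; move: h; case: (u s) => /=.
    by case: (nat_of_ord (w s)) => [|n]; rewrite ?eqxx.
  by move: (nat_of_ord (w s)) => [|[|n]].
have sub : [set s | (1 < w s)%N] \subset [set s | z s].
  apply/fintype.subsetP => s; rewrite !inE; case: (hs s) => [[-> //]|[_ lt] gt].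
  by move: lt gt; lia.
have /eqP eqs : [set s | (1 < w s)%N] == [set s | z s].
  by rewrite eqEcard sub; apply: w0min.
apply/ffunP => s; rewrite !ffunE; case: ifP => zs.
  case: (hs s) => [[_ [E|//]]|[]]; last by rewrite zs.
  by have := congr1 (fun A : {set S} => s \in A) eqs; rewrite !inE zs E.
case: (hs s) => [[]|[_ lt]]; first by rewrite zs.
rewrite zs /=; case: (eqVneq (w s) ord0) => [-> //|ne].
apply: val_inj; rewrite /= inordK //; move: ne lt; rewrite -val_eqE /=.
by case: (nat_of_ord (w s)) => [|[|n]].
Qed.

Let act_kap u : act (fun h => cmat (mv h)) (fun w => (p w)%:~R) (wu u) =
  (\prod_s mm s (u s)) * kap u.
Proof.
rewrite /act (bigID (fun w => wv (vw w) == w)) /= [X in _ + X]big1 ?addr0; last first.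
  move=> w nw; case: (eqVneq (p w) 0) => [->|pw]; first by rewrite mul0r.
  case: (eqVneq (\prod_s cmat (mv (blk s)) (w s) (wu u s)) 0) => [->|hp]; first by rewrite mulr0.
  by rewrite (supp pw hp) eqxx in nw.
rewrite (reindex_onto wv vw) /=; last by move=> w /eqP.
rewrite /kap mulr_sumr [RHS](bigID (fun v => vw (wv v) == v)) /= [X in _ = _ + X]big1 ?addr0.
  apply: eq_big => [v|v /andP[_]]; first by apply: andb_idl => /eqP ->.
  rewrite vw_wv => /forallP hv; rewrite mulrCA -big_split /=; congr (_ * _).
  apply: eq_bigr => s _.
  have hvs : z s -> v s = false by move=> zs; have := hv s; rewrite zs /= => /negPf.
  rewrite /mm /hh /cmat !ffunE.
  have mn0 : (mv (blk s) ord0)%:~R != 0 :> rat by rewrite intr_eq0 gt_eqF.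
  case: (boolP (z s)) => zs /=.
    rewrite (hvs zs); have := ltn_ord (w0 s); move: (zs); rewrite /z => z1 z4.
    have e1 : (w0 s).-1.+1 = w0 s by rewrite prednK // ltnW.
    have e2 : ((w0 s).-1 == 3%N) = false by apply/negP => /eqP E; move: z4; rewrite -e1 E.
    have e3 : (nat_of_ord (w0 s) == 0%N) = false by rewrite gtn_eqF // ltnW.
    rewrite inordK; last exact: leq_ltn_trans (leq_pred _) z4.
    by rewrite e2 e3 e1 eqxx mulr1.
  case: (u s); case: (v s); rewrite /= ?inordK //= ?mulr1 ?mul1r ?mulr0 //.
  by rewrite /xi mulrC divfK.
move=> v; rewrite vw_wv negb_forall => /existsP [s]; rewrite negb_imply negbK => /andP[zs vs].
by rewrite [X in _ * (_ * X)](bigD1 s) //= {1}/hh zs vs /= mul0r !mulr0.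
Qed.

(** Dehomogenization: at an unfrozen slot of block [h], letter 0 becomes variable [h] and letter 1
    becomes 1; a frozen slot admits only the boolean false. *)
Let mono (s : S) (b : bool) : MP m.+1 :=
  if z s then (~~ b)%:R else if b then Xv m.+1 (blk s) else 1.
Let F : MP m.+1 := \sum_v cst m.+1 (p (wv v))%:~R * \prod_s mono s (v s).
Let pn (h : nat) : int := - mv (inord h) (inord 1).
Let qn (h : nat) : nat := `|mv (inord h) ord0|%N.
Let xin (h : nat) : rat := (pn h)%:~R / (qn h)%:R.

Let xinE (h : 'I_m.+1) : xin h = xi h.
Proof.
rewrite /xin /xi /pn /qn inord_val intrN; congr (_ / _).
by rewrite -[RHS](_ : (`|mv h ord0|%N : int)%:~R = _) // gez0_abs // ltW.
Qed.

Let trF : tr m.+1 xin F = \sum_u cst m.+1 (kap u) * \prod_s mono s (u s).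
Proof.
have tr_mono s a : tr m.+1 xin (mono s a) = \sum_b cst m.+1 (hh s a b) * mono s b.
  have bb (f : bool -> MP m.+1) : \sum_b f b = f true + f false by rewrite big_bool.
  rewrite /mono /hh bb; case: (z s).
    by case: a; rewrite ?rmorph0 ?rmorph1 ?mulr0 ?mul0r ?mulr1 ?add0r.
  case: a; first by rewrite tr_Xv // xinE rmorph1 mul1r mulr1.
  by rewrite rmorph1 rmorph0 rmorph1 mul0r add0r mul1r.
rewrite /F rmorph_sum.
under eq_bigr => v _.
  rewrite rmorphM tr_cst rmorph_prod.
  under [\prod_(i : S) _]eq_bigr => s _ do rewrite tr_mono.
  rewrite bigA_distr_bigA mulr_sumr.
  over.
rewrite exchange_big; apply: eq_bigr => u _.
rewrite /kap rmorph_sum mulr_suml; apply: eq_bigr => v _.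
by rewrite big_split rmorphM rmorph_prod mulrA.
Qed.

(** The words contributing to the monomial of [w0] all have the type of [w0]. By symmetry their
    coefficients agree, so the total is a positive multiple of [p w0] and cannot cancel. *)
Let F_neq0 : F != 0.
Proof.
pose v0 := vw w0.
have w0E : wv v0 = w0.
  apply/ffunP => s; rewrite !ffunE; case: (boolP (z s)) => //= zs.
  case: (eqVneq (w0 s) ord0) => [-> //|ne].
  apply: val_inj; rewrite /= inordK //; move: ne zs; rewrite -val_eqE /z /=.
  by case: (nat_of_ord (w0 s)) => [|[|n]].
pose nb (v : {ffun S -> bool}) h := #|[set s | v s && (blk s == h)]|.
pose e0 (h : nat) := nb v0 (inord h).
pose okv (v : {ffun S -> bool}) := [forall s, z s ==> ~~ v s].
have cfm (v : {ffun S -> bool}) : cf m.+1 (\prod_s mono s (v s)) e0 = (okv v && [forall h, nb v0 h == nb v h])%:R.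
  case: (boolP (okv v)) => [/forallP ok|]; last first.
    rewrite negb_forall => /existsP [s]; rewrite negb_imply negbK => /andP[zs vs].
    have ms0 : mono s (v s) = 0 by rewrite /mono zs vs.
    suff -> : \prod_s mono s (v s) = 0 by rewrite cf0.
    by rewrite (bigD1 s) //= ms0 mul0r.
  have -> : \prod_s mono s (v s) = \prod_(s <- [seq s <- index_enum S | v s]) Xv m.+1 (blk s).
    rewrite big_filter [RHS]big_mkcond /=; apply: eq_bigr => s _; rewrite /mono.
    by have := ok s; case: (z s) => //= /negPf ->.
  rewrite cf_prod; congr (_%:R); apply: congr1; apply: eq_forallb => h.
  rewrite /e0 inord_val; congr (_ == _); rewrite /nb count_filter count_index_enum.
  by apply: eq_card => s; rewrite !inE andbC.
have : cf m.+1 F e0 != 0.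
  rewrite /F cf_sum.
  under eq_bigr => v _ do rewrite cf_cst cfm.
  have cntw (v : {ffun S -> bool}) : okv v -> (forall h, nb v0 h = nb v h) -> cnt (wv v) = cnt w0.
    move=> /forallP ok hn; rewrite -w0E; apply/ffunP => -[h i]; apply: val_inj; rewrite /= !cntE.
    have ok0 s : z s -> v0 s = false by move=> zs; rewrite ffunE zs.
    have okv' s : z s -> v s = false by move=> zs; have := ok s; rewrite zs => /negPf.
    have zeroE (v' : {ffun S -> bool}) : (forall s, z s -> v' s = false) ->
        [set s | (blk s == h) && (wv v' s == ord0)] = [set s | v' s && (blk s == h)].
      move=> ok'; apply/setP => s; rewrite !inE ffunE andbC; congr (_ && _).
      case: (boolP (z s)) => zs; last by case: (v' s); rewrite ?eqxx // -val_eqE /= inordK.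
      by rewrite ok' //; apply/negbTE; rewrite -val_eqE /= -lt0n; exact: ltnW zs.
    have [i0|i0] := eqVneq i ord0; first by rewrite i0 !zeroE //; exact: esym (hn h).
    have [i1|i1] := eqVneq i (inord 1); last first.
      apply: eq_card => s; rewrite !inE !ffunE; congr (_ && _).
      have a0 : (ord0 == i) = false by rewrite eq_sym (negPf i0).
      have a1 : (inord 1 == i) = false by rewrite eq_sym (negPf i1).
      by case: (z s) => //=; case: (v s); case: (w0 s == ord0); rewrite ?a0 ?a1.
    pose A := [set s | (blk s == h) && ~~ z s].
    have oneE (v' : {ffun S -> bool}) : (forall s, z s -> v' s = false) ->
        #|[set s | (blk s == h) && (wv v' s == i)]| = (#|A| - nb v' h)%N.
      move=> ok'; rewrite -(cardsID [set s | v' s] A).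
      have -> : A :&: [set s | v' s] = [set s | v' s && (blk s == h)].
        apply/setP => s; rewrite !inE; have := ok' s; case: (z s); case: (v' s);
          rewrite ?andbT ?andbF //= => /(_ isT) //.
      rewrite /nb addKn; apply: eq_card => s; rewrite !inE ffunE i1.
      have e10 : (ord0 == inord 1 :> 'I_4) = false by rewrite -val_eqE /= inordK.
      case: (boolP (z s)) => zs; last first.
        by case: (v' s); rewrite ?e10 ?eqxx ?andbT ?andbF.
      rewrite andbF andbF; apply/negbTE; rewrite negb_and; apply/orP; right.
      by rewrite -val_eqE /= inordK //; move: zs; rewrite /z; case: (nat_of_ord _) => [|[]].
    by rewrite !oneE // hn.
  rewrite (bigID (fun v => okv v && [forall h, nb v0 h == nb v h])) /= [X in _ + X]big1 ?addr0.
    rewrite (eq_bigr (fun=> (p w0)%:~R)); last first.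
      move=> v /andP[ok /forallP hn]; rewrite ok (introT forallP hn) mulr1.
      by rewrite (psym (cntw v ok _)) // => h; apply/eqP; exact: hn.
    rewrite sumr_const mulrn_eq0 intr_eq0 (negPf pw0) orbF -lt0n; apply/card_gt0P.
    exists v0; rewrite unfold_in /=; apply/andP; split; last by apply/forallP.
    by apply/forallP => s; apply/implyP => zs; rewrite ffunE zs.
  by move=> v /negPf ->; rewrite mulr0.
by apply: contraNneq => ->; rewrite cf0.
Qed.

Let itgF : itg m.+1 F.
Proof.
apply: itg_sum => v _; apply: itgM; first exact: itg_cst.
apply: itg_prod => s _; rewrite /mono; case: (z s); first by case: (v s); [exact: itg0|exact: itg1].
by case: (v s); [exact: itg_Xv|exact: itg1].
Qed.

Let dgF : dg m.+1 d F.
Proof.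
apply: dg_sum => v _.
have h : dg m.+1 (fun k => count (fun s : S => k == blk s :> nat) (index_enum S)) (\prod_s mono s (v s)).
  apply: dg_prod_seq => s; rewrite /mono; case: (z s).
    by case: (v s); [exact: dg0|apply: dg_weak (dg1 _)].
  by case: (v s); [exact: dg_Xv|apply: dg_weak (dg1 _)].
have := dgM (@dg_cst m.+1 (fun=> 0%N) (p (wv v))%:~R) h; apply: dg_weak => k; rewrite add0n.
have [km|km] := ltnP k m.+1; last first.
  rewrite (eq_count (a2 := pred0)) ?count_pred0 // => s /=; apply/negbTE.
  by rewrite neq_ltn (leq_trans (ltn_ord (blk s))) ?orbT.
have := @card_blk m.+1 d (Ordinal km); rewrite /= => <-.
rewrite count_index_enum eq_leq //; apply: eq_card => s.
by rewrite !inE -val_eqE /= eq_sym.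
Qed.

Let nrmF (P0 : nat) : (forall w, `|p w| <= P0%:Z) -> nrm m.+1 F <= 2 ^+ #|S| * P0%:R.
Proof.
move=> hp; apply: (le_trans (nrm_sum _ _ _)).
apply: (@le_trans _ _ (\sum_(v : {ffun S -> bool}) P0%:R)); last first.
  by rewrite sumr_const card_ffun card_bool -[_ *+ _]mulr_natl natrX.
apply: ler_sum => v _; apply: (le_trans (nrmM _ _)).
rewrite nrm_cst -[X in _ <= X]mulr1; apply: ler_pM; rewrite ?normr_ge0 ?nrm_ge0 //.
  by rewrite -intr_norm -[X in _ <= X](_ : (P0%:Z)%:~R = _) // ler_int.
have := @nrm_prod_le m.+1 S (fun s => mono s (v s)) 1; rewrite expr1n; apply.
  by rewrite nrm1.
move=> s; rewrite /mono; case: (z s); first by case: (v s); rewrite ?nrm0 ?nrm1.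
by case: (v s); rewrite ?nrm_Xv ?nrm1.
Qed.

(** The vanishing hypothesis kills every Taylor coefficient [kap u] whose monomial has weighted
    degree below [1 / e.+1]. Hence [F] has index at least [1 / e.+1] at a point with denominators
    [mv h ord0], which Roth's lemma forbids. *)
Lemma index_contradiction e Om (P0 : nat) :
  small_index_property m e Om ->
  (forall h, (h < m.+1)%N -> (0 < d h)%N) ->
  (forall h, (h.+1 < m.+1)%N -> (d h.+1 * Om <= d h)%N) ->
  (forall h, coprimez (mv h (inord 1)) (mv h ord0)) ->
  (forall w, `|p w| <= P0%:Z) ->
  (forall h : 'I_m.+1, (4 ^+ #|S| * P0%:R) ^+ Om <= (mv h ord0)%:~R ^+ d h :> rat) ->
  (forall w : word m.+1 d, \sum_(s | w s == ord_max) (d (blk s))%:R^-1 < e.+1%:R^-1 :> rat ->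
     act (fun h => cmat (mv h)) (fun w => (p w)%:~R) w = 0) -> False.
Proof.
move=> RL d0 dO cop hp hP hact.
have qnE (h : 'I_m.+1) : (qn h)%:R = (mv h ord0)%:~R :> rat.
  by rewrite /qn inord_val -[LHS](_ : (`|mv h ord0|%N : int)%:~R = _) // gez0_abs // ltW.
apply: (RL d qn pn F) => //.
- move=> h hm; have -> : h = Ordinal hm :> nat by [].
  rewrite /qn /pn inord_val absz_gt0 gt_eqF //; split=> //.
  have qz : (`|mv (Ordinal hm) ord0|%N : int) = mv (Ordinal hm) ord0 by rewrite gez0_abs // ltW.
  by rewrite /coprimez qz gcdNz; exact: cop.
- move=> h hm; have -> : h = Ordinal hm :> nat by [].
  rewrite qnE; apply: le_trans (hP _); rewrite -card_slot.
  rewrite lerXn2r ?nnegrE ?mulr_ge0 ?exprn_ge0 ?nrm_ge0 //.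
  rewrite -[4](_ : 2 * 2 = _ :> rat) // exprMn mulrAC ler_wpM2r ?exprn_ge0 //.
  exact: nrmF.
have -> : tr m.+1 (fun h => (pn h)%:~R / (qn h)%:R) F = tr m.+1 xin F by [].
rewrite trF; apply: vg_sum => u _.
have wt0 i : 0 <= (d i)%:R^-1 :> rat by rewrite invr_ge0 ler0n.
have [lt|ge] := ltP (\sum_(s | wu u s == ord_max) (d (blk s))%:R^-1) (e.+1%:R^-1 : rat).
  have := hact _ lt; rewrite act_kap => /eqP; rewrite mulf_eq0 => /orP[/prodf_eq0 [s _]|/eqP ->].
    rewrite /mm; case: (z s); last case: (u s); rewrite ?oner_eq0 ?intr_eq0 ?gt_eqF //.
  by rewrite rmorph0 mul0r; exact: vg0.
rewrite -[X in vg _ _ _ _ X]add0r; apply: (@vgM _ false false); first exact: vg_triv.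
apply: vg_weak ge _; rewrite [X in vg _ _ _ _ X]big_mkcond; apply: vg_prod => // s _.
rewrite wu3 /mono; case: (z s); first exact: vg_triv.
by case: (u s); [exact: vg_Xv | exact: vg_triv].
Qed.
End Reduction.

(** * The index contradiction *)

(* [amat theta] inverts the system L0 = Y0 - theta Y1 + theta Y2 - theta^2 Y3,
   L1 = Y1 + theta Y3, L2 = Y2 - theta Y3, L3 = Y3. *)
Definition asg (k i : 'I_4) : int :=
  nth 0 (nth [::] [:: [:: 1; 1; -1; -1]; [:: 0; 1; 0; -1]; [:: 0; 0; 1; 1]; [:: 0; 0; 0; 1]] k) i.
Definition aex (k i : 'I_4) : nat :=
  nth 0%N (nth [::] [:: [:: 0; 1; 1; 2]; [:: 0; 0; 0; 1]; [:: 0; 0; 0; 1]; [:: 0; 0; 0; 0]]%N k) i.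
Definition amat (R : pzRingType) (theta : R) (k i : 'I_4) : R := (asg k i)%:~R * theta ^+ aex k i.

Lemma asg_le1 k i : `|asg k i| <= 1.
Proof. by case: k i => [[|[|[|[|?]]]] ?] [[|[|[|[|?]]]] ?]. Qed.

Lemma aex_le2 k i : (aex k i <= 2)%N.
Proof. by case: k i => [[|[|[|[|?]]]] ?] [[|[|[|[|?]]]] ?]. Qed.

Lemma amat_le (R : realFieldType) (theta : R) k i : `|amat theta k i| <= 1 + theta ^+ 2.
Proof.
rewrite /amat normrM; apply: (@le_trans _ _ (1 * `|theta ^+ aex k i|)).
  by rewrite ler_wpM2r // -intr_norm -[X in _ <= X](_ : 1%:~R = _) // ler_int asg_le1.
rewrite mul1r; have := aex_le2 k i; case: (aex k i) => [|[|[|//]]] _.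
- by rewrite expr0 normr1 lerDl sqr_ge0.
- by rewrite expr1 ler_norml; apply/andP; split; have := sqr_ge0 (theta - 1); have := sqr_ge0 (theta + 1); nra.
- by rewrite ger0_norm ?sqr_ge0 // lerDr.
Qed.

(** * Small integers vanish *)

Section Vanishing.
Variables (R : realType) (theta : R) (m : nat) (d : nat -> nat).
Variables (p : word m d -> int) (P0 : nat) (sw : 'I_m -> 'I_4 -> R) (lam : R).
Variables (g : 'I_m -> 'I_4 -> 'I_4 -> int) (B : 'I_m -> 'I_4 -> 'I_4 -> R) (Gam : 'I_m -> R).
Hypothesis hp : forall w, `|p w| <= P0%:Z.
Hypothesis hgood : forall w, lam < total_dev sw (cnt w) ->
  act (fun _ => amat theta) (fun w => (p w)%:~R) w = 0.
Hypothesis gB : forall h k j, (g h k j)%:~R = \sum_i amat theta k i * B h i j.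
Hypothesis B1 : forall h i j, j != ord_max -> `|B h i j| <= expR (sw h i).
Hypothesis B2 : forall h i, `|B h i ord_max| <= expR (sw h i + Gam h).

Lemma expR_sum (I : Type) (r : seq I) (P : pred I) (f : I -> R) :
  expR (\sum_(i <- r | P i) f i) = \prod_(i <- r | P i) expR (f i).
Proof. exact: (big_morph _ (@expRD R) (@expR0 R)). Qed.

(** The value is an integer of absolute value less than 1. Once [g] is factored through the four
    forms, the auxiliary tensor removes the words of deviation above [lam]; for the others
    [prod_weights] bounds the product of the form values, with an extra [Gam] for each letter 3. *)
Lemma act_vanishes (w : word m d) : let D := #|slot m d| in
  16 ^+ D * P0%:R * (1 + theta ^+ 2) ^+ D *
    expR (lam + \sum_(h < m) (d h)%:R / 4 * \sum_i sw h i +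
          \sum_(s | w s == ord_max) Gam (blk s)) < 1 ->
  act g p w = 0.
Proof.
move=> D; set X := _ * _ * _ * expR _ => hX.
have cast : (act g p w)%:~R = act (fun h k j => (g h k j)%:~R) (fun w => (p w)%:~R) w :> R.
  rewrite /act rmorph_sum; apply: eq_bigr => u _.
  by rewrite /= intrM; congr (_ * _); rewrite rmorph_prod.
suff : `|(act g p w)%:~R : R| < 1.
  by rewrite -intr_norm -[X in _ < X](_ : 1%:~R = _) // ltr_int; lia.
apply: le_lt_trans hX; rewrite cast.
have -> : (fun h k j => (g h k j)%:~R) = (fun h k j => \sum_i amat theta k i * B h i j) :> ('I_m -> _ -> _ -> R).
  by do 3! apply/funext => ?; exact: gB.
rewrite -(act_comp (fun _ => amat theta)).
have hW : #|{: word m d}| = (4 ^ D)%N by rewrite card_ffun card_ord.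
have P0R u : `|(p u)%:~R : R| <= P0%:R.
  by rewrite -intr_norm -[X in _ <= X](_ : (P0%:Z)%:~R = _) // ler_int.
have T1 : 0 <= 1 + theta ^+ 2 by rewrite addr_ge0 ?sqr_ge0.
have hA u : `|act (fun _ => amat theta) (fun w => (p w)%:~R) u| <= 4 ^+ D * (P0%:R * (1 + theta ^+ 2) ^+ D).
  apply: (le_trans (ler_norm_sum _ _ _)).
  apply: (@le_trans _ _ (\sum_(v : word m d) P0%:R * (1 + theta ^+ 2) ^+ D)).
    apply: ler_sum => v _; rewrite normrM ler_pM ?normr_ge0 // normr_prod.
    rewrite -[X in _ <= X]prodr_const; apply: ler_prod => s _.
    by rewrite normr_ge0 amat_le.
  by rewrite sumr_const hW -[_ *+ _]mulr_natl natrX.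
set Y := lam + _ + _ in X *.
apply: (le_trans (ler_norm_sum _ _ _)).
apply: (@le_trans _ _ (\sum_(v : word m d) 4 ^+ D * (P0%:R * (1 + theta ^+ 2) ^+ D) * expR Y)).
  apply: ler_sum => v _; rewrite normrM.
  have [hv|hv] := ltP lam (total_dev sw (cnt v)).
    by rewrite hgood // normr0 mul0r !mulr_ge0 ?exprn_ge0 ?expR_ge0.
  rewrite ler_pM ?normr_ge0 // normr_prod.
  apply: (@le_trans _ _ (expR (\sum_s (sw (blk s) (v s) + if w s == ord_max then Gam (blk s) else 0)))).
    rewrite expR_sum; apply: ler_prod => s _; rewrite normr_ge0 /=.
    case: eqP => [->|/eqP ne]; first exact: B2.
    by rewrite addr0; apply: B1.
  rewrite ler_expR big_split /= -big_mkcond prod_weights /Y lerD2r lerD2r.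
  exact: hv.
rewrite sumr_const hW -[_ *+ _]mulr_natl /X natrX.
have -> : 16 ^+ D = 4 ^+ D * 4 ^+ D :> R by rewrite -exprMn; congr (_ ^+ _); ring.
by rewrite le_eqVlt; apply/orP; left; apply/eqP; ring.
Qed.
End Vanishing.

(* [cm] is normal to the hyperplane; the columns of [cg] are three integer points
   of the hyperplane and the first unit vector, [cB] lists the values of the four
   forms at these columns, [cs] the logarithms of their bounds, and [cT] expresses
   the columns of [cmat cm] in terms of those of [cg]. *)
Record config (R : realType) (theta C delta : R) := Config {
  cm : 'I_4 -> int;
  cg : 'I_4 -> 'I_4 -> int;
  cB : 'I_4 -> 'I_4 -> R;
  cT : 'I_4 -> 'I_4 -> rat;
  cs : 'I_4 -> R;
  cL := ln ((cm ord0)%:~R : R);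
  cm_gt0 : 0 < cm ord0;
  cm_coprime : coprimez (cm (inord 1)) (cm ord0);
  cgE : forall k j, (cg k j)%:~R = \sum_i amat theta k i * cB i j;
  cB1 : forall i j, j != ord_max -> `|cB i j| <= expR (cs i);
  cB2 : forall i, `|cB i ord_max| <= expR (cs i + C * cL);
  cs_le : forall i, `|cs i| <= C * cL;
  cs_sum : \sum_i cs i <= - delta * cL;
  cTE : forall k j, cmat cm k j = \sum_i (cg k i)%:~R * cT i j;
  cT0 : forall j, j != ord_max -> cT ord_max j = 0 }.

Lemma ratr_sum_inv_lt (R : realType) (I : Type) (r : seq I) (P : pred I) (d : I -> nat) e :
  \sum_(i <- r | P i) (d i)%:R^-1 < e%:R^-1 :> rat ->
  \sum_(i <- r | P i) (d i)%:R^-1 < e%:R^-1 :> R.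
Proof.
have E n : ratr (n%:R^-1) = n%:R^-1 :> R by rewrite (fmorphV (@ratr R)) /= ratr_nat.
rewrite -(ltr_rat R) rmorph_sum /= E.
by rewrite (eq_bigr _ (fun i _ => E (d i))).
Qed.

(** * Choice of parameters *)

Section Core.
Variables (R : realType) (theta : R) (dd : nat) (f0 : int) (C0 : nat).
Hypothesis pr : power_reduction theta dd f0 C0.
Variables (C delta : R).
Hypotheses (C_gt0 : 0 < C) (delta_gt0 : 0 < delta).

(** With [d h] equal to [K / L h] rounded up, the logarithmic heights [d h * L h] of all blocks
    agree up to a factor 2, and the growth of [L] gives the rapidly decreasing degrees of Roth's
    lemma. *)
Lemma degrees_exist (L : nat -> R) m (Om : R) : 1 <= Om -> 1 <= L 0%N ->
  (forall h, 2 * Om * L h <= L h.+1) ->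
  let K := L m in exists d : nat -> nat,
  [/\ forall h, (h <= m)%N -> (0 < d h)%N /\ K <= (d h)%:R * L h <= 2 * K,
      forall h, (h < m)%N -> (d h.+1)%:R * Om <= (d h)%:R &
      forall h, (h <= m)%N -> L 0%N <= L h].
Proof.
move=> Om1 L01 hL K.
have L1 h : 1 <= L h.
  elim: h => [//|h IH]; apply: le_trans (hL h); nra.
have Lmono h k : (h <= k)%N -> L h <= L k.
  move=> /subnKC <-; elim: (k - h)%N => [|n IH]; first by rewrite addn0.
  rewrite addnS (le_trans IH) // (le_trans _ (hL _)) //.
  by have := L1 (h + n)%N; nra.
pose d h := `|Num.ceil (K / L h)|%N.
have dE h : (d h)%:R = (Num.ceil (K / L h))%:~R :> R.
  rewrite -[LHS](_ : (`|Num.ceil (K / L h)|%N : int)%:~R = _) // gez0_abs //.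
  by rewrite ceil_ge0 (lt_le_trans _ (_ : 0 <= _)) ?ltrN10 // divr_ge0 ?(le_trans _ (L1 _)).
have Lp h : 0 < L h by apply: lt_le_trans (L1 h).
have dlb h : K <= (d h)%:R * L h by rewrite -ler_pdivrMr // dE ceil_ge.
have dub h : (d h)%:R * L h <= K + L h.
  have -> : K + L h = (K / L h + 1) * L h by rewrite mulrDl divfK ?gt_eqF // mul1r.
  rewrite ler_pM2r // dE; have := ceilB1_lt (K / L h); lra.
have d0 h : (0 < d h)%N.
  rewrite lt0n; apply/eqP => E; have := dlb h; rewrite E mul0r.
  by apply/negP; rewrite -ltNge Lp.
exists d; split.
- move=> h hm; split=> //; rewrite dlb /=; apply: (le_trans (dub h)).
  by have := Lmono _ _ hm; rewrite -/K; lra.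
- move=> h hm.
  have h1 : (d h.+1)%:R * L h.+1 <= 2 * K by apply: (le_trans (dub _)); have := Lmono _ _ hm; rewrite -/K; lra.
  have h2 := dlb h; have h3 := hL h; have hp := Lp h.
  rewrite -(ler_pM2r hp).
  have : (d h.+1)%:R * (2 * Om * L h) <= (d h.+1)%:R * L h.+1 by rewrite ler_wpM2l.
  by nra.
by move=> h hm; apply: Lmono.
Qed.

(** In the final exponent, in units of [eta * M * K], the mean of the form values contributes at
    most -4, while the constants, the threshold [lam] and the letters 3 contribute at most 1 each.
    This explains [eta = delta / 16]. *)
Theorem no_configurations :
  (forall x : R, exists c : config theta C delta, x <= cL c) -> False.
Proof.
move=> hcfg; have [dd0 _ C00 _ _] := pr.
pose eta := delta / 16.
have eta0 : 0 < eta by rewrite divr_gt0.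
(* Enough blocks for the Chebyshev condition with [Phi = 8 * C * K] and [lam = eta * M * K]: this is
   [hlam], where [2 * 8 ^ 2 = 128]. *)
pose m := Num.bound (128 * dd%:R * C ^+ 2 / eta ^+ 2).
have hM : 128 * dd%:R * C ^+ 2 <= m.+1%:R * eta ^+ 2.
  rewrite -ler_pdivrMr ?exprn_gt0 //; apply: (@le_trans _ _ m%:R); last by rewrite ler_nat.
  apply: ltW; apply: archi_boundP.
  by rewrite divr_ge0 ?mulr_ge0 ?exprn_ge0 ?ler0n // ltW.
(* Words of weight less than [1 / e.+1] in letter 3 lose at most [2 * C * K / e.+1], which must stay
   below [eta * K]. *)
pose e := Num.bound (32 * C / delta).
have he : 2 * C / e.+1%:R <= delta / 16.
  have h : 32 * C / delta < e%:R by apply: archi_boundP; rewrite divr_ge0 ?mulr_ge0 // ltW.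
  rewrite ler_pdivrMr ?ltr0n // -natr1; move: h; rewrite ltr_pdivrMr //.
  by move: delta_gt0; nra.
have [Om Om0 RL] := roth_lemma m e.
have Om1 : 1 <= Om%:R :> R by rewrite ler1n.
(* [W ^ D] dominates [4 ^ D * 16 ^ D * P0]; the isolated factor 2 of [P0] is paid by [2 ^ D]. *)
pose W := (4 * 2 * 16 * 16 * C0 ^ 2)%N.
pose V : R := W%:R * (1 + theta ^+ 2).
have T1 : 1 <= 1 + theta ^+ 2 by rewrite lerDl sqr_ge0.
have W1 : 1 <= W%:R :> R by rewrite ler1n /W !muln_gt0 ?expn_gt0 C00.
have V1 : 1 <= V by rewrite -[1]mulr1 ler_pM.
have V0 : 0 < V by rewrite (lt_le_trans _ V1).
pose c1 := ln V.
have c10 : 0 <= c1 by rewrite ln_ge0.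
(* The second term makes [D * c1] at most [eta * M * K]; the third makes [D * c1 * Om] at most [K],
   as the height condition of Roth's lemma requires. *)
pose L0 := 1 + 32 * c1 / delta + 2 * m.+1%:R * c1 * Om%:R.
have [f fP] := choice hcfg.
pose fix cs_ h := if h is h'.+1 then f (2 * Om%:R * cL (cs_ h')) else f L0.
pose L h := cL (cs_ h).
have L00 : L0 <= L 0%N by exact: fP.
have q1 : 0 <= 32 * c1 / delta by rewrite divr_ge0 ?mulr_ge0 // ltW.
have q2 : 0 <= 2 * m.+1%:R * c1 * Om%:R by rewrite !mulr_ge0.
have L01 : 1 <= L 0%N by apply: le_trans L00; rewrite /L0; lra.
have [h|d [dK dO L0L]] := @degrees_exist L m Om%:R Om1 L01; first exact: fP.
set K := L m in dK.
have K1 : 1 <= K by apply: le_trans L01 (L0L m (leqnn m)).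
pose M : R := m.+1%:R.
have M1 : 1 <= M by rewrite ler1n.
pose D := #|slot m.+1 d|.
have dKh (h : 'I_m.+1) : K <= (d h)%:R * L h <= 2 * K by have [_] := dK h (ltn_ord h).
have D1 : (0 < D)%N.
  rewrite /D card_slot (bigD1 ord0) //= addn_gt0; have [-> //] := dK 0%N isT.
have DL : D%:R * L 0%N <= 2 * M * K.
  rewrite /D card_slot natr_sum mulr_suml.
  apply: (@le_trans _ _ (\sum_(h < m.+1) 2 * K)); last first.
    by rewrite sumr_const card_ord -[_ *+ _]mulr_natl mulrCA mulrA.
  apply: ler_sum => h _; have /andP[_] := dKh h; apply: le_trans.
  by rewrite ler_wpM2l ?ler0n // L0L // -ltnS.
have Dc1 : D%:R * c1 <= eta * M * K.
  have h1 : 32 * c1 / delta <= L 0%N by apply: le_trans L00; rewrite /L0; lra.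
  have h2 : 32 * c1 <= L 0%N * delta by rewrite -ler_pdivrMr.
  have : D%:R * (32 * c1) <= D%:R * (L 0%N * delta) by rewrite ler_wpM2l ?ler0n.
  have : D%:R * L 0%N * delta <= 2 * M * K * delta by rewrite ler_wpM2r // ltW.
  by rewrite /eta; move: (D%:R : R) (L 0%N) => x y; lra.
have Dc2 : D%:R * c1 * Om%:R <= K.
  have h1 : 2 * M * c1 * Om%:R <= L 0%N by apply: le_trans L00; rewrite /L0 -/M; lra.
  have : D%:R * (2 * M * c1 * Om%:R) <= D%:R * L 0%N by rewrite ler_wpM2l ?ler0n.
  move: DL M1; move: (D%:R : R) (L 0%N) (Om%:R : R) => x y z h2 h3 h4.
  have : 2 * M * (x * c1 * z) <= 2 * M * K by lra.
  by rewrite ler_pM2l //; lra.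
pose sw (h : 'I_m.+1) i := cs (cs_ h) i.
have hPhi h t : t \in types m.+1 d -> `|dev sw h t| <= 8 * C * K.
  move=> tT; apply: (le_trans (ler_norm_sum _ _ _)).
  apply: (@le_trans _ _ (\sum_(i : 'I_4) (d h)%:R * (C * L h))).
    apply: ler_sum => i _; rewrite normrM; apply: ler_pM; rewrite ?normr_ge0 ?cs_le //.
    have : (t (h, i) <= d h)%N by rewrite -(sum_types h tT) (bigD1 i) //= leq_addr.
    rewrite -(ler_nat R) ler_norml => h1; have h2 : 0 <= (t (h, i) : nat)%:R :> R by [].
    by apply/andP; split; lra.
  rewrite sumr_const card_ord -[_ *+ _]mulr_natl.
  have /andP[_ h2] := dKh h; move: C_gt0 h2; nra.
have lam0 : 0 < eta * M * K by rewrite !mulr_gt0 //; lra.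
have hlam : 2 * dd%:R * m.+1%:R * (8 * C * K) ^+ 2 <= (eta * M * K) ^+ 2.
  have -> : 2 * dd%:R * m.+1%:R * (8 * C * K) ^+ 2 = M * K ^+ 2 * (128 * dd%:R * C ^+ 2).
    by rewrite /M; ring.
  have -> : (eta * M * K) ^+ 2 = M * K ^+ 2 * (M * eta ^+ 2) by ring.
  by rewrite ler_wpM2l // mulr_ge0 ?sqr_ge0 //; lra.
have [p [psym [w1 pw1] pP pgood]] :=
  auxiliary_tensor pr asg_le1 aex_le2 lam0 hPhi hlam.
rewrite -/D in pP; set P0 := (2 * 16 ^ D * C0 ^ (2 * D))%N in pP.
have [w0 pw0 w0min] := @arg_minnP _ w1 (fun w => p w != 0)
  (fun w : word m.+1 d => #|[set s | (1 < w s)%N]|) pw1.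
have lnV (n : nat) : V ^+ n = expR (n%:R * c1).
  by rewrite expRM_natl /c1 lnK // posrE.
have P0W : (4 ^ D * (16 ^ D * P0) <= W ^ D)%N.
  have -> : (W = 4 * 2 * 16 * 16 * C0 ^ 2)%N by [].
  have cE : (C0 ^ (2 * D) = C0 ^ D * C0 ^ D)%N by rewrite mul2n -addnn expnD.
  rewrite !expnMn /P0 cE.
  have : (2 <= 2 ^ D)%N by rewrite -{1}(expn1 2) leq_exp2l.
  move: (2 ^ D)%N (4 ^ D)%N (16 ^ D)%N (C0 ^ D)%N => x y z t h.
  have -> : (y * (z * (2 * z * (t * t))) = 2 * (y * z * z * t * t))%N by ring.
  have -> : (y * x * z * z * (t * t) = x * (y * z * z * t * t))%N by ring.
  by rewrite leq_mul2r h orbT.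
apply: (@index_contradiction m d (fun h => cm (cs_ h)) p _ psym w0 pw0 _ e Om P0 RL) => //.
- by move=> h; exact: cm_gt0.
- by move=> h hm; have [] := dK h hm.
- by move=> h hm; rewrite -(ler_nat R) natrM dO.
- by move=> h; exact: cm_coprime.
- move=> h; set q := cm _ ord0.
  have q0 : 0 < q by exact: cm_gt0.
  have qE (F : numDomainType) : q%:~R = (`|q|%N)%:R :> F.
    by rewrite -[RHS](_ : (`|q|%N : int)%:~R = _) // gez0_abs // ltW.
  rewrite qE -!natrX -natrM -!natrX ler_nat -(ler_nat R) natrX natrX -qE.
  apply: (@le_trans _ _ ((V ^+ D) ^+ Om)).
    rewrite lerXn2r ?nnegrE ?exprn_ge0 ?ler0n ?(ltW V0) //.
    apply: (@le_trans _ _ ((W ^ D)%:R)).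
      rewrite ler_nat (leq_trans _ P0W) // leq_mul2l; apply/orP; right.
      by rewrite leq_pmull // expn_gt0.
    rewrite natrX lerXn2r ?nnegrE ?ler0n ?(ltW V0) // /V ler_peMr //; lra.
  rewrite -exprM lnV; have -> : q%:~R = expR (L h) :> R.
    by rewrite /L /cL lnK // posrE ltr0z.
  rewrite -expRM_natl ler_expR natrM.
  have /andP[h1 _] := dKh h; apply: le_trans h1.
  by apply: le_trans Dc2; rewrite mulrAC.
move=> w hw.
have hw' : \sum_(s | w s == ord_max) (d (blk s))%:R^-1 < e.+1%:R^-1 :> R.
  exact: ratr_sum_inv_lt hw.
have fE : (fun h : 'I_m.+1 => cmat (cm (cs_ h))) =
    (fun h k j => \sum_i (cg (cs_ h) k i)%:~R * cT (cs_ h) i j).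
  by do 3! apply/funext => ?; exact: cTE.
rewrite fE -act_comp.
apply: (@act_triangular _ _ _ (fun h => (d h)%:R^-1) e.+1%:R^-1); last exact: hw.
- by move=> h; rewrite invr_ge0 ler0n.
- by move=> h j; exact: cT0.
move=> u hu.
have -> : act (fun h k i => (cg (cs_ h) k i)%:~R) (fun w => (p w)%:~R) u =
    (act (fun h => cg (cs_ h)) p u)%:~R :> rat.
  rewrite /act rmorph_sum; apply: eq_bigr => v _.
  by rewrite /= intrM; congr (_ * _); rewrite rmorph_prod.
rewrite (_ : act _ _ _ = 0) //.
have hu' : \sum_(s | u s == ord_max) (d (blk s))%:R^-1 < e.+1%:R^-1 :> R.
  exact: ratr_sum_inv_lt hu.
apply: (@act_vanishes R theta m.+1 d p P0 sw (eta * M * K) _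
   (fun h => cB (cs_ h)) (fun h => C * L h)) => //.
- by move=> h k j; exact: cgE.
- by move=> h i j; exact: cB1.
- by move=> h i; exact: cB2.
rewrite -/D.
have hs1 : \sum_(h < m.+1) (d h)%:R / 4 * (\sum_i sw h i) <= - (delta / 4) * M * K.
  apply: (@le_trans _ _ (\sum_(h < m.+1) - (delta / 4) * K)); last first.
    by rewrite sumr_const card_ord -[_ *+ _]mulr_natl /M; lra.
  apply: ler_sum => h _; have /andP[h1 _] := dKh h.
  have h2 : \sum_i sw h i <= - delta * L h by exact: cs_sum.
  have : (d h)%:R / 4 * (\sum_i sw h i) <= (d h)%:R / 4 * (- delta * L h).
    by rewrite ler_wpM2l // divr_ge0.
  move: delta_gt0 h1; move: ((d h)%:R : R) (L h) (\sum_i sw h i) => x y s h3 h4 h5; nra.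
have hs2 : \sum_(s | u s == ord_max) C * L (blk s) <= eta * K.
  apply: (@le_trans _ _ (\sum_(s | u s == ord_max) (2 * C * K) * (d (blk s))%:R^-1)).
    apply: ler_sum => s _; have /andP[_ h1] := dKh (blk s).
    have dp : 0 < (d (blk s))%:R :> R by rewrite ltr0n; have [] := dK (blk s) (ltn_ord (blk s)).
    rewrite ler_pdivlMr //; move: C_gt0 h1; nra.
  rewrite -mulr_sumr; apply: (@le_trans _ _ (2 * C * K * e.+1%:R^-1)).
    by rewrite ler_wpM2l ?ltW // !mulr_gt0 //; lra.
  by rewrite mulrAC ler_wpM2r //; lra.
apply: (@le_lt_trans _ _ (V ^+ D * expR (eta * M * K - delta / 4 * M * K + eta * K))).
  have T0 := le_trans ler01 T1; apply: ler_pM.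
  - apply: mulr_ge0; last exact: exprn_ge0.
    by apply: mulr_ge0; [exact: exprn_ge0 (ler0n _ 16) | exact: ler0n].
  - exact: expR_ge0.
  - rewrite /V exprMn; apply: ler_wpM2r; first exact: exprn_ge0.
    rewrite -natrX -natrX -natrM ler_nat; apply: leq_trans P0W.
    by apply: leq_pmull; rewrite expn_gt0.
  rewrite ler_expR; apply: (lerD _ hs2); rewrite lerD2l; apply: (le_trans hs1).
  by rewrite !mulNr.
rewrite lnV -expRD -[X in _ < X]expR0 ltr_expR.
have e1 : eta * K <= eta * M * K.
  rewrite -[leRHS]mulrA; apply: ler_wpM2l; first exact: ltW.
  by apply: ler_peMl => //; exact: le_trans ler01 K1.
have -> : delta / 4 * M * K = 4 * (eta * M * K) by rewrite /eta; field.
by move: Dc1 e1 lam0; move: (D%:R * c1) (eta * M * K) (eta * K) => x y z; lra.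
Qed.
End Core.

(** * Geometry of numbers *)

Lemma primitive3 (a b d : int) : [|| a != 0, b != 0 | d != 0] ->
  exists g a' b' d' u v w : int, [/\ g != 0, a = g * a', b = g * b', d = g * d' &
    u * a' + v * b' + w * d' = 1].
Proof.
move=> h0; have [u1 [v1 E1]] := Bezoutz b d; have [u2 [v2 E2]] := Bezoutz a (gcdz b d).
set g2 := gcdz b d in E1 E2; set g := gcdz a g2 in E2.
have ga : (g %| a)%Z by exact: dvdz_gcdl.
have gg : (g %| g2)%Z by exact: dvdz_gcdr.
have gb : (g %| b)%Z by apply: dvdz_trans gg (dvdz_gcdl _ _).
have gd : (g %| d)%Z by apply: dvdz_trans gg (dvdz_gcdr _ _).
have [a' Ea] := dvdzP ga; have [b' Eb] := dvdzP gb; have [d' Ed] := dvdzP gd.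
have g0 : g != 0.
  apply/eqP => g0; move: h0; rewrite Ea Eb Ed g0 !mulr0 eqxx //.
exists g, a', b', d', u2, (v2 * u1), (v2 * v1); split; rewrite 1?mulrC //.
apply: (mulfI g0); rewrite mulr1 -[RHS]E2 -E1 [in RHS]Ea [in RHS]Eb [in RHS]Ed; ring.
Qed.

Lemma pigeonhole (I T : finType) (M : nat) (f : I -> T) :
  (M * #|T| < #|I|)%N -> exists t, (M < #|[set i | f i == t]|)%N.
Proof.
move=> h; apply/existsP; move: h; apply: contraLR; rewrite negb_exists -leqNgt => /forallP h.
rewrite -sum1_card (partition_big f xpredT) //= mulnC -sum_nat_const.
apply: leq_sum => t _; have := h t; rewrite -leqNgt; apply: leq_trans.
by rewrite -[X in (_ <= X)%N]sum1_card; apply: eq_leq; apply: eq_bigl => i; rewrite inE.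
Qed.

Lemma absz_lt_succ (x y : int) : 0 <= x -> x <= y -> (`|x| < `|y|.+1)%N.
Proof. lia. Qed.

Lemma absz_inj_ge0 (x y : int) : 0 <= x -> 0 <= y -> `|x|%N = `|y|%N -> x = y.
Proof. lia. Qed.

Lemma norm_sub_nat_le (x y G : nat) : (x <= G)%N -> (y <= G)%N -> `|x%:Z - y%:Z| <= G%:Z.
Proof. lia. Qed.

Section Geo.
Variables (R : realType) (th : R).
Hypothesis th1 : 1 <= th.
(* [E1] and [E2] measure the distance of [(a, b, d)] to the line spanned by
   [(1, th, - th ^+ 2)]. *)
Definition E1 (a b : int) : R := th * a%:~R - b%:~R.
Definition E2 (b d : int) : R := th * b%:~R + d%:~R.
(** The value on [(1, th, - th ^+ 2)] of the dual integer form sending [(a, b, d)] to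
    [r a + q b - p d]. *)
Definition nv (p q r : int) : R := th ^+ 2 * p%:~R + th * q%:~R + r%:~R.

Lemma int_norm_ge1 (q : int) : q != 0 -> 1 <= `|q%:~R| :> R.
Proof. by move=> q0; rewrite -intr_norm -[X in X <= _](_ : 1%:~R = _) // ler_int; lia. Qed.

(* The integer [b ^+ 2 + a * d] vanishes on that line; if it is zero at [(a, b, d)],
   then [b / a] has a denominator whose square divides [a], up to sign. *)
Lemma conic (c : R) : (forall s t : int, s != 0 -> c <= `|s%:~R| * `|th * s%:~R - t%:~R|) ->
  forall a b d : int, a != 0 -> `|E1 a b| < c ->
  1 <= `|b%:~R| * `|E1 a b| + `|a%:~R| * `|E2 b d|.
Proof.
move=> hc a b d a0 hE; have [q0|q0] := eqVneq (b * b + a * d) 0; last first.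
  have qE : (b * b + a * d)%:~R = - b%:~R * E1 a b + a%:~R * E2 b d.
    by rewrite /E1 /E2 intrD !intrM; ring.
  apply: (le_trans (int_norm_ge1 q0)); rewrite qE.
  by apply: (le_trans (ler_normD _ _)); rewrite !normrM normrN.
exfalso; set g := gcdz a b; have [s Es] := dvdzP (dvdz_gcdl a b); have [t Et] := dvdzP (dvdz_gcdr a b).
rewrite -/g in Es Et.
have g0 : g != 0 by apply/eqP => g0; move: a0; rewrite Es g0 mulr0 eqxx.
have s0 : s != 0 by apply/eqP => s0; move: a0; rewrite Es s0 mul0r eqxx.
have [u [v]] := Bezoutz a b; rewrite -/g => bez.
have bz : u * s + v * t = 1.
  by apply: (mulIf g0); rewrite mul1r -[RHS]bez [in RHS]Es [in RHS]Et; ring.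
have sd : s * d = - (g * t ^+ 2).
  apply: (mulfI g0); apply/eqP; rewrite -subr_eq0; apply/eqP.
  by rewrite -[RHS]q0 Es Et; ring.
have sg : g = s * (g * (u ^+ 2 * s + 2 * u * v * t) - v ^+ 2 * d).
  have -> : s * (g * (u ^+ 2 * s + 2 * u * v * t) - v ^+ 2 * d) =
    g * ((u * s + v * t) ^+ 2) - v ^+ 2 * (g * t ^+ 2 + s * d) by ring.
  by rewrite bz sd expr1n mulr1 addrN mulr0 subr0.
have gs : `|s%:~R| <= `|g%:~R| :> R.
  have [k0 Ek] : exists k0, g = s * k0 by eexists; exact: sg.
  have -> : `|g%:~R| = `|s%:~R| * `|k0%:~R| :> R by rewrite -normrM -intrM -Ek.
  rewrite ler_peMr //; apply: int_norm_ge1; apply/eqP => k00.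
  by move: g0; rewrite Ek k00 mulr0 eqxx.
(* As [s] divides [g], this gives [|E1 a b| >= |s| * |th * s - t| >= c], against the assumption on
   [E1]. *)
have EE : E1 a b = g%:~R * (th * s%:~R - t%:~R) by rewrite /E1 Es Et !intrM; ring.
have := hc s t s0; rewrite EE normrM in hE.
have : `|s%:~R| * `|th * s%:~R - t%:~R| <= `|g%:~R| * `|th * s%:~R - t%:~R| by rewrite ler_wpM2r.
lra.
Qed.

Definition small_n (X T : R) := exists p q r : int,
  [/\ [|| p != 0, q != 0 | r != 0], `|p%:~R| <= X, `|q%:~R| <= X & `|nv p q r| <= T].

(** A form vanishing at a point close to the line is small on the line: for such a form, [a * nv] is
    the combination [lamf] of [E1] and [E2]. Pigeonhole on the first two coefficients in 0..G,
    sorted by the residue modulo [a] that makes the third coefficient integral and by cells of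
    [lamf]; the exponents match because [4 + 4 = 8]. *)
Lemma small_n_of_line (Z g0 : nat) (a : nat) (b d : int) :
  (0 < Z)%N -> 2 * (2 + th) + 1 <= g0%:R -> (0 < a)%N -> (a <= Z ^ 8)%N ->
  `|E1 a b| * Z%:R ^+ 7 <= 1 -> `|E2 b d| * Z%:R ^+ 7 <= 1 ->
  small_n (g0%:R * Z%:R ^+ 4) (Z%:R ^- 11).
Proof.
move=> Z0 hg a0 aZ hE1 hE2.
have z0 : 0 < Z%:R :> R by rewrite ltr0n.
have zn k : 0 < Z%:R ^+ k :> R by rewrite exprn_gt0.
pose G := (g0 * Z ^ 4)%N.
have GE : G%:R = g0%:R * Z%:R ^+ 4 :> R by rewrite natrM natrX.
have aR : 0 < a%:R :> R by rewrite ltr0n.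
have e1 : `|E1 a b| <= Z%:R ^- 7 by rewrite -[X in _ <= X]mul1r ler_pdivlMr.
have e2 : `|E2 b d| <= Z%:R ^- 7 by rewrite -[X in _ <= X]mul1r ler_pdivlMr.
pose lamf (x y : R) := y * E1 a b + x * (E2 b d + th * E1 a b).
pose V := G%:R * Z%:R ^- 7 * (2 + th).
have hlam (x y : nat) : (x <= G)%N -> (y <= G)%N -> `|lamf x%:R y%:R| <= V.
  rewrite -!(ler_nat R) => xG yG.
  have hy : `|y%:R * E1 a b| <= G%:R * Z%:R ^- 7 by rewrite normrM ler_pM // ger0_norm.
  have hE : `|E2 b d + th * E1 a b| <= (1 + th) * Z%:R ^- 7.
    apply: (le_trans (ler_normD _ _)); rewrite normrM (ger0_norm (le_trans ler01 th1)) mulrDl mul1r.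
    by apply: lerD => //; rewrite ler_wpM2l // (le_trans ler01).
  have hx : `|x%:R * (E2 b d + th * E1 a b)| <= G%:R * ((1 + th) * Z%:R ^- 7).
    by rewrite normrM ler_pM // ger0_norm.
  apply: (le_trans (ler_normD _ _)); apply: (le_trans (lerD hy hx)).
  by rewrite /V le_eqVlt; apply/orP; left; apply/eqP; ring.
have V0 : 0 <= V.
  by rewrite /V; apply: mulr_ge0; [apply: mulr_ge0; [exact: ler0n | rewrite invr_ge0 ltW] | have := th1; lra].
pose Tz : R := Z%:R ^+ 11.
(* Cells of width [a / Z^11] for [lamf], so that a collision gives [|nv| <= Z^-11] after division by
   [a]. *)
pose bk (x y : R) := (lamf x y + V) * Tz / a%:R.
pose Nb := `|Num.floor (2 * V * Tz / a%:R)|%N.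
have bkr (x y : nat) : (x <= G)%N -> (y <= G)%N -> 0 <= bk x%:R y%:R <= 2 * V * Tz / a%:R.
  move=> xG yG; have := hlam x y xG yG; rewrite ler_norml => /andP[h1 h2].
  rewrite /bk divr_ge0 ?mulr_ge0 ?(ltW aR) ?(ltW (zn _)) //; last by lra.
  rewrite ler_wpM2r ?invr_ge0 ?(ltW aR) // ler_wpM2r ?(ltW (zn _)) //; lra.
have Nb0 : 0 <= Num.floor (2 * V * Tz / a%:R).
  rewrite floor_ge0; apply: divr_ge0; last exact: ltW.
  apply: mulr_ge0; first exact: (mulr_ge0 (ler0n R 2) V0).
  exact: ltW (zn 11%N).
have a_gt : (0 < a%:Z)%R by lia.
have modlt (z : int) : (`|(z %% a%:Z)%Z|%N < a)%N.
  by have := ltz_pmod z a_gt; have := modz_ge0 z (lt0r_neq0 a_gt); lia.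
pose f (p : 'I_G.+1 * 'I_G.+1) : 'I_a.-1.+1 * 'I_Nb.+1 :=
  (inord `|modz ((p.2 : nat)%:Z * b - (p.1 : nat)%:Z * d) a%:Z|%N,
   inord `|Num.floor (bk (p.1 : nat)%:R (p.2 : nat)%:R)|%N).
have [|t ht] := @pigeonhole _ _ 1 f.
  rewrite mul1n !card_prod !card_ord prednK // -(ltr_nat R) !natrM.
  have hNb : Nb%:R <= 2 * V * Tz / a%:R.
    have -> : Nb%:R = (Num.floor (2 * V * Tz / a%:R))%:~R :> R.
      by rewrite -[LHS](_ : (Nb%:Z)%:~R = _) // /Nb gez0_abs.
    by have /andP[] := floor_itv (2 * V * Tz / a%:R).
  have h1 : a%:R * Nb.+1%:R <= 2 * V * Tz + a%:R.
    rewrite -natr1 mulrDr mulr1 lerD2r mulrC -ler_pdivlMr //.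
  have aZ' : a%:R <= Z%:R ^+ 8 :> R by rewrite -natrX ler_nat.
  have VT : V * Tz = g0%:R * (2 + th) * Z%:R ^+ 8.
    by rewrite /V GE /Tz; have := lt0r_neq0 z0 => zz; field.
  have h2 : 2 * V * Tz + a%:R <= G%:R * G%:R.
    rewrite -mulrA VT GE.
    have -> : g0%:R * Z%:R ^+ 4 * (g0%:R * Z%:R ^+ 4) = g0%:R ^+ 2 * Z%:R ^+ 8 :> R by ring.
    have g1 : 1 <= g0%:R :> R by have := th1; lra.
    apply: (@le_trans _ _ ((2 * (g0%:R * (2 + th)) + 1) * Z%:R ^+ 8)); first by lra.
    rewrite ler_wpM2r ?(ltW (zn _)) //; nra.
  apply: (le_lt_trans h1); apply: (le_lt_trans h2); rewrite -natr1.
  by have := ler0n R G; nra.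
have /card_gt1P [p [p' [pt p't npp]]] := ht.
move: pt p't; rewrite !inE => /eqP pt /eqP p't.
have ff : f p = f p' by rewrite pt p't.
have r1 := congr1 (fun x => val x.1) ff; have r2 := congr1 (fun x => val x.2) ff.
rewrite /= !inordK ?prednK // in r1.
have pG (q : 'I_G.+1 * 'I_G.+1) : (q.1 <= G)%N /\ (q.2 <= G)%N.
  by split; rewrite -ltnS.
have fb (q : 'I_G.+1 * 'I_G.+1) : (`|Num.floor (bk (q.1 : nat)%:R (q.2 : nat)%:R)|%N < Nb.+1)%N
    /\ 0 <= Num.floor (bk (q.1 : nat)%:R (q.2 : nat)%:R).
  have [q1 q2] := pG q; have /andP[b0 b1] := bkr _ _ q1 q2.
  have b2 := le_floor b1; have b3 : 0 <= Num.floor (bk (q.1 : nat)%:R (q.2 : nat)%:R) by rewrite floor_ge0.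
  by split=> //; exact: absz_lt_succ.
rewrite /= !inordK ?(fb p).1 ?(fb p').1 // in r2.
have {r2} fl : Num.floor (bk (p.1 : nat)%:R (p.2 : nat)%:R) = Num.floor (bk (p'.1 : nat)%:R (p'.2 : nat)%:R).
  by have [_ f1] := fb p; have [_ f2] := fb p'; exact: absz_inj_ge0.
pose n1 : int := (p.1 : nat)%:Z - (p'.1 : nat)%:Z.
pose n2 : int := (p.2 : nat)%:Z - (p'.2 : nat)%:Z.
have dv : (a%:Z %| n2 * b - n1 * d)%Z.
  have m0 (z : int) := modz_ge0 z (lt0r_neq0 a_gt).
  have := eqz_mod_dvd a%:Z ((p.2 : nat)%:Z * b - (p.1 : nat)%:Z * d) ((p'.2 : nat)%:Z * b - (p'.1 : nat)%:Z * d).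
  have -> : ((p.2 : nat)%:Z * b - (p.1 : nat)%:Z * d) - ((p'.2 : nat)%:Z * b - (p'.1 : nat)%:Z * d) = n2 * b - n1 * d.
    by rewrite /n1 /n2; ring.
  by move=> <-; apply/eqP; exact: absz_inj_ge0 (m0 _) (m0 _) r1.
have [k kE] := dvdzP dv.
exists n1, n2, (- k); split.
- apply: contraNT npp; rewrite !negb_or !negbK => /and3P[/eqP n10 /eqP n20 _].
  have d1 : (p.1 : nat) = p'.1 by move: n10; rewrite /n1 => /eqP; rewrite subr_eq0 eqz_nat => /eqP.
  have d2 : (p.2 : nat) = p'.2 by move: n20; rewrite /n2 => /eqP; rewrite subr_eq0 eqz_nat => /eqP.
  by apply/eqP; case: (p) (p') d1 d2 => [x y] [x' y'] /= d1 d2; congr pair; apply: val_inj.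
- have [q1 _] := pG p; have [q2 _] := pG p'; rewrite -GE -intr_norm -[X in _ <= X](_ : (G%:Z)%:~R = _) // ler_int; exact: norm_sub_nat_le.
- have [_ q1] := pG p; have [_ q2] := pG p'; rewrite -GE -intr_norm -[X in _ <= X](_ : (G%:Z)%:~R = _) // ler_int; exact: norm_sub_nat_le.
have nvE : a%:R * nv n1 n2 (- k) = lamf n1%:~R n2%:~R.
  have : (n2 * b - n1 * d)%:~R = (k * a%:Z)%:~R :> R by rewrite kE.
  rewrite intrB !intrM => h; rewrite /nv /lamf /E1 /E2 intrN.
  have -> : a%:R = (a%:Z)%:~R :> R by [].
  move: h; move: (a%:Z%:~R : R) (k%:~R : R) (n1%:~R : R) (n2%:~R : R) (b%:~R : R) (d%:~R : R) => A K N1 N2 B D h.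
  have hk : K * A = N2 * B - N1 * D by rewrite h.
  by transitivity (A * (th ^+ 2 * N1 + th * N2) - K * A); [ring | rewrite hk; ring].
have ldiff : lamf n1%:~R n2%:~R = lamf (p.1 : nat)%:R (p.2 : nat)%:R - lamf (p'.1 : nat)%:R (p'.2 : nat)%:R.
  by rewrite /lamf /n1 /n2 !intrB /=; ring.
have hl : `|lamf n1%:~R n2%:~R| * Tz / a%:R <= 1.
  have /andP[f1 f2] := floor_itv (bk (p.1 : nat)%:R (p.2 : nat)%:R).
  have /andP[f3 f4] := floor_itv (bk (p'.1 : nat)%:R (p'.2 : nat)%:R).
  rewrite fl in f1 f2; rewrite intrD in f2 f4.
  have bd : bk (p.1 : nat)%:R (p.2 : nat)%:R - bk (p'.1 : nat)%:R (p'.2 : nat)%:R =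
      lamf n1%:~R n2%:~R * Tz / a%:R by rewrite ldiff /bk; ring.
  have : `|lamf n1%:~R n2%:~R * Tz / a%:R| <= 1 by rewrite -bd ler_norml; apply/andP; split; lra.
  have T0 : 0 <= Tz by exact: ltW (zn 11%N).
  by rewrite normrM [`|_ * Tz|]normrM normfV (ger0_norm (ltW aR)) (ger0_norm T0).
rewrite -nvE normrM (ger0_norm (ltW aR)) in hl.
have : `|nv n1 n2 (- k)| * Tz <= 1.
  by apply: le_trans hl; rewrite le_eqVlt; apply/orP; left; apply/eqP; field; rewrite gt_eqF.
by rewrite -[X in _ -> _ <= X]mul1r ler_pdivlMr.
Qed.

Definition short (e T : R) (a b d : int) :=
  [/\ `|a%:~R| <= T, `|E1 a b| <= e & `|E2 b d| <= e].

Lemma plane_coordinates (F : fieldType) (u1 u2 u3 w1 w2 w3 v1 v2 v3 : F) :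
  let N1 := u2 * w3 - u3 * w2 in let N2 := u3 * w1 - u1 * w3 in let N3 := u1 * w2 - u2 * w1 in
  N1 ^+ 2 + N2 ^+ 2 + N3 ^+ 2 != 0 -> v1 * N1 + v2 * N2 + v3 * N3 = 0 ->
  exists al be, [/\ v1 = al * u1 + be * w1, v2 = al * u2 + be * w2 & v3 = al * u3 + be * w3].
Proof.
move=> N1 N2 N3; pose S := N1 ^+ 2 + N2 ^+ 2 + N3 ^+ 2; rewrite -/S => S0 hD.
pose A := (v2 * w3 - v3 * w2) * N1 + (v3 * w1 - v1 * w3) * N2 + (v1 * w2 - v2 * w1) * N3.
pose B := (u2 * v3 - u3 * v2) * N1 + (u3 * v1 - u1 * v3) * N2 + (u1 * v2 - u2 * v1) * N3.
have h (v u w N : F) : S * v = A * u + B * w + (v1 * N1 + v2 * N2 + v3 * N3) * N ->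
    v = A / S * u + B / S * w.
  rewrite hD mul0r addr0 => E; apply: (mulfI S0); rewrite E.
  move: S0 A B {E hD}; move: S => S' S0 A B.
  by transitivity (S' / S' * (A * u + B * w)); [rewrite divff // mul1r | ring].
exists (A / S), (B / S); split.
- by apply: (h _ _ _ N1); rewrite /A /B /S /N1 /N2 /N3; ring.
- by apply: (h _ _ _ N2); rewrite /A /B /S /N1 /N2 /N3; ring.
- by apply: (h _ _ _ N3); rewrite /A /B /S /N1 /N2 /N3; ring.
Qed.

Lemma norm_comb_le (x y z f g X Y : R) : `|x| <= X -> `|y| <= Y -> `|z| <= Y ->
  0 <= f <= 1 -> 0 <= g <= 1 -> `|x + f * y + g * z| <= X + 2 * Y.
Proof.
move=> hx hy hz /andP[f0 f1] /andP[g0 g1].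
have h (a b : R) : 0 <= a -> a <= 1 -> `|b| <= Y -> `|a * b| <= Y.
  by move=> a0 a1 hb; rewrite normrM (ger0_norm a0); apply: le_trans hb; rewrite ler_piMl.
have := ler_normD (x + f * y) (g * z); have := ler_normD x (f * y).
by have := h f y f0 f1 hy; have := h g z g0 g1 hz; lra.
Qed.

(** Let [n] be the primitive form vanishing at the two given points. If it is not small, some real
    point of the box has value 1 under [n]; an integer point with value 1 exists by Bezout. Their
    difference lies in the plane of the two points, and rounding its coordinates there gives an
    integer point close to the box. *)
Lemma third_point (e T : R) (a b d a' b' d' : int) : 0 < e -> 0 < T ->
  short e T a b d -> short e T a' b' d' ->
  let N1 := b * a' - a * b' in let N2 := d * a' - a * d' in let N3 := b * d' - d * b' in
  [|| N1 != 0, N2 != 0 | N3 != 0] ->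
  (exists a'' b'' d'', short ((th + 2) * e) (3 * T) a'' b'' d'' /\
     - N1 * d'' + N2 * b'' + N3 * a'' != 0) \/ small_n e^-1 T^-1.
Proof.
move=> e0 T0 [ha hE1 hE2] [ha' hE1' hE2'] N1 N2 N3 Nn0.
have th0 : 0 < th by apply: lt_le_trans th1.
have [g [n1 [n2 [n3 [u [v [w [g0 EN1 EN2 EN3 bez]]]]]]]] := primitive3 Nn0.
have [small|notsmall] := boolP [&& `|n1%:~R| <= e^-1, `|n2%:~R| <= e^-1 & `|nv n1 n2 n3| <= T^-1].
  right; exists n1, n2, n3; case/and3P: small => s1 s2 s3; split=> //.
  apply: contraT; rewrite !negb_or !negbK => /and3P[/eqP z1 /eqP z2 /eqP z3].
  by move: bez; rewrite z1 z2 z3 !mulr0.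
(* Each way of failing to be small supplies its own real point, supported on one coordinate or on
   the line itself. *)
left; have [r1 [r2 [r3 [hr1 hr2 hr3 hr]]]] : exists r1 r2 r3 : R,
  [/\ `|r1| <= T, `|th * r1 - r2| <= e, `|th * r2 + r3| <= th * e &
      - n1%:~R * r3 + n2%:~R * r2 + n3%:~R * r1 = 1].
  move: notsmall; rewrite !negb_and -!ltNge => /or3P[] h.
  - have p0 : 0 < `|n1%:~R| :> R by apply: lt_trans h; rewrite invr_gt0.
    have q0 : n1%:~R != 0 :> R by rewrite -normr_gt0.
    have q1 : `|n1%:~R|^-1 <= e by rewrite -[X in _ <= X]invrK lef_pV2 ?posrE ?invr_gt0 // ltW.
    exists 0, 0, (- n1%:~R^-1); rewrite !mulr0 subr0 add0r normrN normr0 normfV; split; rewrite ?(ltW T0) ?(ltW e0) //.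
      by apply: (le_trans q1); rewrite ler_peMl // ltW.
    by rewrite mulrNN mulfV // !addr0.
  - have p0 : 0 < `|n2%:~R| :> R by apply: lt_trans h; rewrite invr_gt0.
    have q0 : n2%:~R != 0 :> R by rewrite -normr_gt0.
    have q1 : `|n2%:~R|^-1 <= e by rewrite -[X in _ <= X]invrK lef_pV2 ?posrE ?invr_gt0 // ltW.
    exists 0, n2%:~R^-1, 0; rewrite !mulr0 sub0r !addr0 add0r normrN normr0 normrM normfV (gtr0_norm th0); split; rewrite ?(ltW T0) //.
      by rewrite ler_pM2l.
    by rewrite mulfV.
  - have p0 : 0 < `|nv n1 n2 n3| by apply: lt_trans h; rewrite invr_gt0.
    have q0 : nv n1 n2 n3 != 0 by rewrite -normr_gt0.
    have q1 : `|nv n1 n2 n3|^-1 <= T by rewrite -[X in _ <= X]invrK lef_pV2 ?posrE ?invr_gt0 // ltW.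
    pose s := (nv n1 n2 n3)^-1.
    exists s, (th * s), (- th ^+ 2 * s).
    have -> : th * s - th * s = 0 by ring.
    have -> : th * (th * s) + - th ^+ 2 * s = 0 by ring.
    rewrite normr0 normfV; split; rewrite ?(ltW e0) ?mulr_ge0 ?(ltW th0) ?(ltW e0) //.
    by rewrite -[RHS](mulVf q0) -/s /nv; ring.
have S0 : (b%:~R * a'%:~R - a%:~R * b'%:~R) ^+ 2 + (a%:~R * (- d'%:~R) - (- d%:~R) * a'%:~R) ^+ 2
   + ((- d%:~R) * b'%:~R - b%:~R * (- d'%:~R)) ^+ 2 != 0 :> R.
  have -> : b%:~R * a'%:~R - a%:~R * b'%:~R = N1%:~R :> R by rewrite /N1 intrB !intrM.
  have -> : a%:~R * (- d'%:~R) - (- d%:~R) * a'%:~R = N2%:~R :> R by rewrite /N2 intrB !intrM; ring.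
  have -> : (- d%:~R) * b'%:~R - b%:~R * (- d'%:~R) = N3%:~R :> R by rewrite /N3 intrB !intrM; ring.
  rewrite !paddr_eq0 ?addr_ge0 ?sqr_ge0 // !sqrf_eq0 !intr_eq0 !negb_and.
  by case/or3P: Nn0 => ->; rewrite ?orbT.
have vN : (u%:~R + r3) * (b%:~R * a'%:~R - a%:~R * b'%:~R) + (v%:~R - r2) * (a%:~R * (- d'%:~R) - (- d%:~R) * a'%:~R)
   + (w%:~R - r1) * ((- d%:~R) * b'%:~R - b%:~R * (- d'%:~R)) = 0 :> R.
  have -> : b%:~R * a'%:~R - a%:~R * b'%:~R = g%:~R * n1%:~R :> R.
    by have := congr1 (fun x : int => x%:~R : R) EN1; rewrite /N1 intrB !intrM.
  have -> : a%:~R * (- d'%:~R) - (- d%:~R) * a'%:~R = g%:~R * n2%:~R :> R.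
    by have := congr1 (fun x : int => x%:~R : R) EN2; rewrite /N2 intrB !intrM => <-; ring.
  have -> : (- d%:~R) * b'%:~R - b%:~R * (- d'%:~R) = g%:~R * n3%:~R :> R.
    by have := congr1 (fun x : int => x%:~R : R) EN3; rewrite /N3 intrB !intrM => <-; ring.
  have hb : u%:~R * n1%:~R + v%:~R * n2%:~R + w%:~R * n3%:~R = 1 :> R by rewrite -!intrM -!intrD bez.
  transitivity (g%:~R * ((u%:~R * n1%:~R + v%:~R * n2%:~R + w%:~R * n3%:~R)
     - (- n1%:~R * r3 + n2%:~R * r2 + n3%:~R * r1)) : R); first by ring.
  by rewrite hb hr subrr mulr0.
have [al [be [v1 v2 v3]]] := plane_coordinates S0 vN.
pose k := Num.floor al; pose k' := Num.floor be.
have /andP[fk1 fk2] := floor_itv al; have /andP[fk1' fk2'] := floor_itv be.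
rewrite -/k in fk1 fk2; rewrite -/k' in fk1' fk2'; rewrite intrD in fk2; rewrite intrD in fk2'.
have f1 : 0 <= al - k%:~R <= 1 by apply/andP; split; lra.
have f2 : 0 <= be - k'%:~R <= 1 by apply/andP; split; lra.
exists (w - k * a - k' * a'), (v - k * b - k' * b'), (- u - k * d - k' * d').
have Ea : (w - k * a - k' * a')%:~R = r1 + (al - k%:~R) * a%:~R + (be - k'%:~R) * a'%:~R :> R.
  rewrite !intrB !intrM; have -> : w%:~R = r1 + (al * a%:~R + be * a'%:~R) :> R by rewrite -v3; ring.
  by ring.
have Eb : (v - k * b - k' * b')%:~R = r2 + (al - k%:~R) * b%:~R + (be - k'%:~R) * b'%:~R :> R.
  rewrite !intrB !intrM; have -> : v%:~R = r2 + (al * b%:~R + be * b'%:~R) :> R by rewrite -v2; ring.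
  by ring.
have Ed : (- u - k * d - k' * d')%:~R = r3 + (al - k%:~R) * d%:~R + (be - k'%:~R) * d'%:~R :> R.
  rewrite !intrB !intrM intrN; have -> : u%:~R = - r3 + (al * - d%:~R + be * - d'%:~R) :> R by rewrite -v1; ring.
  by ring.
split; last first.
  have -> : - N1 * (- u - k * d - k' * d') + N2 * (v - k * b - k' * b') + N3 * (w - k * a - k' * a')
    = N1 * u + N2 * v + N3 * w by rewrite /N1 /N2 /N3; ring.
  rewrite EN1 EN2 EN3.
  have -> : g * n1 * u + g * n2 * v + g * n3 * w = g * (u * n1 + v * n2 + w * n3) by ring.
  by rewrite bez mulr1.
split.
- by rewrite Ea; apply: (le_trans (norm_comb_le hr1 ha ha' f1 f2)); lra.
- have -> : E1 (w - k * a - k' * a') (v - k * b - k' * b') =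
    (th * r1 - r2) + (al - k%:~R) * E1 a b + (be - k'%:~R) * E1 a' b'.
    by rewrite /E1 Ea Eb; ring.
  by apply: (le_trans (norm_comb_le hr2 hE1 hE1' f1 f2)); have := ler_peMl (ltW e0) th1; lra.
- have -> : E2 (v - k * b - k' * b') (- u - k * d - k' * d') =
    (th * r2 + r3) + (al - k%:~R) * E2 b d + (be - k'%:~R) * E2 b' d'.
    by rewrite /E2 Eb Ed; ring.
  by apply: (le_trans (norm_comb_le hr3 hE2 hE2' f1 f2)); lra.
Qed.

Lemma cell_close (X : nat) (x y : R) : (0 < X)%N -> 0 <= x < 1 -> 0 <= y < 1 ->
  inord `|Num.floor (X%:R * x)|%N = inord `|Num.floor (X%:R * y)|%N :> 'I_X.-1.+1 ->
  `|x - y| <= X%:R^-1.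
Proof.
move=> X0; have XR : 0 < X%:R :> R by rewrite ltr0n.
have hb (t : R) : 0 <= t < 1 -> 0 <= Num.floor (X%:R * t) /\ (`|Num.floor (X%:R * t)|%N < X)%N.
  case/andP=> t0 t1; have h0 : 0 <= Num.floor (X%:R * t) by rewrite floor_ge0 mulr_ge0 // ltW.
  split=> //; have : Num.floor (X%:R * t) < X%:Z; last by lia.
  rewrite -(ltr_int R); have /andP[h _] := floor_itv (X%:R * t); apply: (le_lt_trans h).
  by rewrite -[ltRHS]mulr1 ltr_pM2l.
move=> hx hy /(congr1 val); have [x0 x1] := hb _ hx; have [y0 y1] := hb _ hy.
rewrite /= !inordK ?prednK // => h.
have fl : Num.floor (X%:R * x) = Num.floor (X%:R * y) by move: h x0 y0; lia.
have /andP[f1 f2] := floor_itv (X%:R * x); have /andP[f3 f4] := floor_itv (X%:R * y).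
rewrite fl intrD in f1 f2; rewrite intrD in f4.
rewrite -[X in _ <= X]mul1r ler_pdivlMr // -[X in _ * X](gtr0_norm XR) -normrM ler_norml.
by apply/andP; split; nra.
Qed.

Lemma scaled_norm_le (A r x y : R) : 0 < A -> 0 <= r -> r <= A -> A * x = r * y -> `|x| <= `|y|.
Proof.
move=> A0 r0 rA E; have := congr1 (fun u => `|u|) E; rewrite !normrM (gtr0_norm A0) (ger0_norm r0) => h.
by rewrite -(ler_pM2l A0) h ler_wpM2r.
Qed.

(** Dirichlet's pigeonhole puts more than [Z^3] of the [Z^11 + 1] values of [a] in one of the [Z^8]
    cells, and differences within a cell are short. If all short points are parallel, the smallest
    positive first coordinate [a0] divides all others, so some difference is at least [Z^3 * a0]:
    hence [a0 <= Z^8], and its errors are smaller by [Z^3]. *)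
Lemma pair_or_line (Z : nat) : (0 < Z)%N ->
  let e := (Z%:R ^+ 4)^-1 in let T := Z%:R ^+ 11 in
  (exists a b d a' b' d' : int, [/\ short e T a b d, short e T a' b' d' &
     [|| b * a' - a * b' != 0, d * a' - a * d' != 0 | b * d' - d * b' != 0]]) \/
  (exists (a : nat) (b d : int), [/\ (0 < a)%N, (a <= Z ^ 8)%N,
     `|E1 a b| * Z%:R ^+ 7 <= 1 & `|E2 b d| * Z%:R ^+ 7 <= 1]).
Proof.
move=> Z0 e T; have [|nopair] := pselect (exists a b d a' b' d' : int,
  [/\ short e T a b d, short e T a' b' d' &
     [|| b * a' - a * b' != 0, d * a' - a * d' != 0 | b * d' - d * b' != 0]]); first by left.
have dep (a b d a' b' d' : int) : short e T a b d -> short e T a' b' d' -> b * a' = a * b' /\ d * a' = a * d'.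
  move=> h h'; have : ~~ [|| b * a' - a * b' != 0, d * a' - a * d' != 0 | b * d' - d * b' != 0].
    by apply/negP => hN; apply: nopair; exists a, b, d, a', b', d'.
  by rewrite !negb_or !negbK !subr_eq0 => /and3P[/eqP -> /eqP ->].
right; have zR : 0 < Z%:R :> R by rewrite ltr0n.
pose bq (a : nat) := Num.floor (th * a%:R); pose dq a := - Num.floor (th * (bq a)%:~R).
have fr1 (a : nat) : 0 <= E1 a (bq a) < 1.
  have /andP[] := floor_itv (th * a%:R); rewrite -/(bq a) intrD /E1 /= => h1 h2.
  by apply/andP; split; [move: h1 | move: h2]; rewrite -[a%:~R]/(a%:R); lra.
have fr2 (a : nat) : 0 <= E2 (bq a) (dq a) < 1.
  have /andP[] := floor_itv (th * (bq a)%:~R); rewrite /E2 /dq intrN intrD => h1 h2.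
  by apply/andP; split; lra.
pose X := (Z ^ 4)%N; have X0 : (0 < X)%N by rewrite expn_gt0 Z0.
have XE : X%:R^-1 = e :> R by rewrite natrX.
pose cell (x : R) : 'I_X.-1.+1 := inord `|Num.floor (X%:R * x)|%N.
pose f (i : 'I_(Z ^ 11).+1) := (cell (E1 (i : nat) (bq i)), cell (E2 (bq i) (dq i))).
have [|t ht] := @pigeonhole _ _ (Z ^ 3) f.
  by rewrite card_prod !card_ord prednK // /X -!expnD ltnS.
set S := [set i | f i == t] in ht.
have hS (i j : 'I_(Z ^ 11).+1) : i \in S -> j \in S ->
    short e T ((i : nat)%:Z - (j : nat)%:Z) (bq i - bq j) (dq i - dq j).
  rewrite !inE => /eqP fi /eqP fj; have fij : f i = f j by rewrite fi fj.
  have c1 := cell_close X0 (fr1 i) (fr1 j) (congr1 fst fij).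
  have c2 := cell_close X0 (fr2 i) (fr2 j) (congr1 snd fij).
  rewrite XE in c1 c2; split.
  - rewrite /T -natrX -intr_norm -[X in _ <= X](_ : ((Z ^ 11)%N%:Z)%:~R = _) // ler_int.
    by have := ltn_ord i; have := ltn_ord j; lia.
  - by rewrite (_ : E1 _ _ = E1 (i : nat) (bq i) - E1 (j : nat) (bq j)) // /E1 !intrB; ring.
  - by rewrite (_ : E2 _ _ = E2 (bq i) (dq i) - E2 (bq j) (dq j)) // /E2 !intrB; ring.
pose P (a : nat) := `[< (0 < a)%N /\ exists b d, short e T a%:Z b d >].
have hP (i j : 'I_(Z ^ 11).+1) : i \in S -> j \in S -> (j < i)%N -> P (i - j)%N.
  move=> iS jS ji; apply/asboolP; split; first by rewrite subn_gt0.
  by exists (bq i - bq j), (dq i - dq j); rewrite -subzn 1?ltnW //; exact: hS.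
have exP : exists a, P a.
  have /card_gt1P [i [j [iS jS ij]]] : (1 < #|S|)%N by apply: leq_ltn_trans ht; rewrite expn_gt0 Z0.
  have [ltij|ltji|eqij] := ltngtP i j.
  - by exists (j - i)%N; apply: hP.
  - by exists (i - j)%N; apply: hP.
  - by move: ij; rewrite (val_inj eqij) eqxx.
case: (ex_minnP exP) => a0 /asboolP[a0_gt0 [b0 [d0 sh0]]] a0min.
have aR : 0 < a0%:R :> R by rewrite ltr0n.
have [_ he1 he2] := sh0.
have scal (a : nat) (b d : int) : short e T a b d ->
    a0%:R * E1 a b = a%:R * E1 a0 b0 /\ a0%:R * E2 b d = a%:R * E2 b0 d0.
  move=> sh; have [db dd] := dep _ _ _ _ _ _ sh sh0.
  have db' : b%:~R * a0%:R = a%:R * b0%:~R :> R by have := congr1 (fun x : int => x%:~R : R) db; rewrite /= !intrM.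
  have dd' : d%:~R * a0%:R = a%:R * d0%:~R :> R by have := congr1 (fun x : int => x%:~R : R) dd; rewrite /= !intrM.
  split; rewrite /E1 /E2.
    change (a0%:R * (th * a%:R - b%:~R) = a%:R * (th * a0%:R - b0%:~R)).
    by rewrite !mulrBr [a0%:R * b%:~R]mulrC db'; ring.
  by rewrite !mulrDr [a0%:R * d%:~R]mulrC dd' mulrCA [a0%:R * b%:~R]mulrC db'; ring.
have dv (a : nat) (b d : int) : short e T a b d -> (a0 %| a)%N.
  move=> sh; rewrite /dvdn; apply: contraT; rewrite -lt0n => r0.
  have rlt := ltn_pmod a a0_gt0; have := divn_eq a a0.
  set r := (a %% a0)%N in r0 rlt *; set q := (a %/ a0)%N => aE.
  have [s1 s2] := scal _ _ _ sh.
  have rE : r%:R = a%:R - q%:R * a0%:R :> R.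
    have -> : a%:R = q%:R * a0%:R + r%:R :> R by rewrite -natrM -natrD -aE.
    by ring.
  have rle : r%:R <= a0%:R :> R by rewrite ler_nat ltnW.
  have : P r.
    apply/asboolP; split=> //; exists (b - q%:Z * b0), (d - q%:Z * d0); split.
    - have [h0 _ _] := sh0; apply: le_trans h0; rewrite -!intr_norm ler_int; lia.
    - apply: le_trans he1; apply: (@scaled_norm_le a0%:R r%:R) => //.
      transitivity (a0%:R * E1 a b - q%:R * a0%:R * E1 a0 b0); last by rewrite s1 rE; ring.
      rewrite /E1 intrB intrM -[r%:~R]/(r%:R) rE -[q%:~R]/(q%:R) -[a0%:~R]/(a0%:R) -[a%:~R]/(a%:R); ring.
    - apply: le_trans he2; apply: (@scaled_norm_le a0%:R r%:R) => //.
      transitivity (a0%:R * E2 b d - q%:R * a0%:R * E2 b0 d0); last by rewrite s2 rE; ring.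
      by rewrite /E2 !intrB !intrM -[q%:~R]/(q%:R); ring.
  by move/a0min; rewrite leqNgt rlt.
have [i1 i1S] : exists i, i \in S by apply/card_gt0P; apply: leq_ltn_trans ht.
have [i0 i0S i0min] := arg_minnP (fun i : 'I_(Z ^ 11).+1 => i : nat) i1S.
have shi (i : 'I_(Z ^ 11).+1) : i \in S -> exists b d, short e T (i - i0)%N b d.
  move=> iS; exists (bq i - bq i0), (dq i - dq i0); rewrite -subzn; last exact: i0min.
  exact: hS.
have Z3 : (0 < Z ^ 3)%N by rewrite expn_gt0 Z0.
(* The quotients by [a0] are distinct, so if all were below [Z^3] the cell would be too small. *)
have [i iS hi] : exists2 i, i \in S & (Z ^ 3 <= (i - i0) %/ a0)%N.
  apply: contrapT => nex.
  have lt (i : 'I_(Z ^ 11).+1) : i \in S -> ((i - i0) %/ a0 < Z ^ 3)%N.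
    by move=> iS; rewrite ltnNge; apply/negP => h; apply: nex; exists i.
  pose h (i : 'I_(Z ^ 11).+1) : 'I_(Z ^ 3).-1.+1 := inord ((i - i0) %/ a0).
  have inj : {in S &, injective h}.
    move=> i j iS jS /(congr1 val); rewrite /= !inordK ?prednK ?lt // => E.
    have [b [d /dv di]] := shi _ iS; have [b' [d' /dv dj]] := shi _ jS.
    have : (i - i0 = j - i0)%N by rewrite -(divnK di) -(divnK dj) E.
    have := i0min _ iS; have := i0min _ jS => h1 h2 h3; apply: val_inj => /=; move: h1 h2 h3; lia.
  by move: ht; rewrite -(card_in_imset inj) ltnNge (leq_trans (max_card _)) // card_ord prednK.
have [b [d sh]] := shi _ iS; set a := (i - i0)%N in hi sh.
have [s1 s2] := scal _ _ _ sh; have ha : (Z ^ 3 * a0 <= a)%N by rewrite -leq_divRL.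
have [_ e1 e2] := sh.
have z3 : Z%:R ^+ 3 * a0%:R <= a%:R :> R by rewrite -natrX -natrM ler_nat.
have fin (x y : R) : `|x| <= e -> a0%:R * x = a%:R * y -> `|y| * Z%:R ^+ 7 <= 1.
  move=> hx E; have := congr1 (fun u => `|u|) E; rewrite !normrM !normr_nat => E'.
  have h1 : a0%:R * (Z%:R ^+ 3 * `|y|) <= a0%:R * `|x|.
    by rewrite E' mulrA [a0%:R * _]mulrC ler_wpM2r.
  rewrite ler_pM2l // in h1.
  have h2 : Z%:R ^+ 4 * (Z%:R ^+ 3 * `|y|) <= Z%:R ^+ 4 * e.
    by apply: ler_wpM2l; [rewrite exprn_ge0 // ltW | exact: le_trans h1 hx].
  rewrite mulfV ?expf_neq0 ?gt_eqF // in h2.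
  by rewrite mulrC -[7%N]/(4 + 3)%N exprD -mulrA.
exists a0, b0, d0; split=> //.
- rewrite -(leq_pmul2l Z3) (leq_trans ha) // -expnD /a.
  by have := ltn_ord i; rewrite ltnS; apply: leq_trans; apply: leq_subr.
- exact: fin e1 s1.
- exact: fin e2 s2.
Qed.

Lemma small_n_le (X T X' T' : R) : X <= X' -> T <= T' -> small_n X T -> small_n X' T'.
Proof.
move=> hX hT [p [q [r [h1 h2 h3 h4]]]]; exists p, q, r; split=> //.
- exact: le_trans hX.
- exact: le_trans hX.
- exact: le_trans hT.
Qed.

Lemma short_le (X T X' T' : R) a b d : X <= X' -> T <= T' -> short X T a b d -> short X' T' a b d.
Proof.
move=> hX hT [h1 h2 h3]; split=> //.
- exact: le_trans hT.
- exact: le_trans hX.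
- exact: le_trans hX.
Qed.

Definition short_triple (e T : R) := exists a b d a' b' d' a'' b'' d'' : int,
  [/\ short e T a b d, short e T a' b' d', short e T a'' b'' d'' &
     - (b * a' - a * b') * d'' + (d * a' - a * d') * b'' + (b * d' - d * b') * a'' != 0].

Lemma transference (g0 Z : nat) : 2 * (2 + th) + 1 <= g0%:R -> (0 < Z)%N ->
  short_triple (g0%:R / Z%:R ^+ 4) (g0%:R * Z%:R ^+ 11) \/
  small_n (g0%:R * Z%:R ^+ 4) (g0%:R / Z%:R ^+ 11).
Proof.
move=> hg Z0; have zR : 0 < Z%:R :> R by rewrite ltr0n.
have z4 : 0 < Z%:R ^+ 4 :> R by rewrite exprn_gt0.
have z11 : 0 < Z%:R ^+ 11 :> R by rewrite exprn_gt0.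
have g1 : 1 <= g0%:R :> R by have := th1; lra.
have [[a [b [d [a' [b' [d' [s s' hN]]]]]]]|[a [b [d [a0 a8 e1 e2]]]]] := pair_or_line Z0; last first.
  right; apply: small_n_le (small_n_of_line Z0 hg a0 a8 e1 e2) => //.
  by rewrite ler_peMl // invr_ge0 ltW.
have [||[a'' [b'' [d'' [s'' hd]]]]|sm] := third_point _ _ s s' hN; rewrite ?invr_gt0 //.
  left; exists a, b, d, a', b', d', a'', b'', d''; split=> //.
  - by apply: short_le s; [rewrite ler_peMl // invr_ge0 ltW | rewrite ler_peMl // ltW].
  - by apply: short_le s'; [rewrite ler_peMl // invr_ge0 ltW | rewrite ler_peMl // ltW].
  - by apply: short_le s''; [rewrite ler_pM2r ?invr_gt0 //; have := th1; lra | rewrite ler_pM2r //; have := th1; lra].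
right; apply: small_n_le sm; first by rewrite invrK ler_peMl // ltW.
by rewrite ler_peMl // invr_ge0 ltW.
Qed.

(** * Uniform approximation by small values of dual forms *)

Section DavenportSchmidt.
Variables (C c : R).
Hypotheses (C1 : 1 <= C) (c0 : 0 < c).
Hypothesis hc : forall s t : int, s != 0 -> c <= `|s%:~R| * `|th * s%:~R - t%:~R|.
Hypothesis irr : forall p q r, nv p q r = 0 -> [/\ p = 0, q = 0 & r = 0].

Section Sequences.
Variables (n1 n2 n3 : nat -> int) (W z : nat -> nat).
Let nvk k := nv (n1 k) (n2 k) (n3 k).
Hypothesis Wz : forall k, (W k <= z k)%N.
Hypothesis WS : forall k, W k.+1 = (z k).+1.
Hypothesis hn1 : forall k, `|(n1 k)%:~R| <= C * (W k)%:R ^+ 4.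
Hypothesis hn2 : forall k, `|(n2 k)%:~R| <= C * (W k)%:R ^+ 4.
Hypothesis hnv : forall k, `|nvk k| * (z k)%:R ^+ 11 <= C.
Hypothesis prim : forall k, exists u v w, u * n1 k + v * n2 k + w * n3 k = 1.
Hypothesis dec : forall k, `|nvk k.+1| < `|nvk k|.
Let k1 := 17 * (th + 1) * C ^+ 2.
Let k2 := 64 * C ^+ 2 * (th + 1) * k1.
Let k3 := 16 * k2.
Let k4 := 16 * C * (2 + th) * k1.
Hypothesis big : forall k, [/\ k1 < c * (z k)%:R, 2 * k1 < (z k)%:R, 64 * C ^+ 3 < (z k)%:R
  & 8 * k4 ^+ 3 * k3 ^+ 4 < (z k)%:R].
(** Up to signs, the cross product of two consecutive forms; each form [n k] serves from [W k] to
    [z k]. Since both forms are small on the line, the point [(y1, y2, y3)] is close to it, with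
    errors of order [z^(4 - 11)]. *)
Let y1 k := n1 k * n2 k.+1 - n2 k * n1 k.+1.
Let y2 k := n3 k * n1 k.+1 - n1 k * n3 k.+1.
Let y3 k := - (n2 k * n3 k.+1 - n3 k * n2 k.+1).
Let zr k : R := (z k)%:R.
Let e1 k := E1 (y1 k) (y2 k).
Let e2 k := E2 (y2 k) (y3 k).

Let C_gt0 : 0 < C. Proof. by apply: lt_le_trans C1. Qed.
Let th0 : 0 < th. Proof. by apply: lt_le_trans th1. Qed.
Let k1_ge1 : 1 <= k1.
Proof. by rewrite /k1; have := th1; have := C1 => *; nra. Qed.
Let zr1 k : 1 <= zr k. Proof. by have [_ h _ _] := big k; have := k1_ge1; rewrite /zr; lra. Qed.
Let zr0 k : 0 < zr k. Proof. by apply: lt_le_trans (zr1 k). Qed.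
Let zrX k n : 1 <= zr k ^+ n. Proof. by rewrite exprn_ege1. Qed.
Let zrXS k n : zr k <= zr k ^+ n.+1.
Proof. by rewrite exprS ler_peMr // ltW. Qed.

Let hz k : zr k <= zr k.+1.
Proof. by rewrite ler_nat; have := Wz k.+1; rewrite WS; lia. Qed.

Let Wle k : (W k)%:R ^+ 4 <= zr k ^+ 4 :> R.
Proof. by rewrite lerXn2r ?nnegrE ?ler0n // ler_nat. Qed.

Let WSle k : (W k.+1)%:R ^+ 4 <= 16 * zr k ^+ 4 :> R.
Proof.
have -> : 16 * zr k ^+ 4 = (2 * zr k) ^+ 4 by ring.
rewrite lerXn2r ?nnegrE ?mulr_ge0 ?ler0n // WS -natr1.
by have := zr1 k; rewrite /zr; lra.
Qed.

Let nle k (x : int) : `|x%:~R| <= C * (W k)%:R ^+ 4 -> `|x%:~R| <= C * zr k ^+ 4.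
Proof. by move=> h; apply: (le_trans h); rewrite ler_pM2l. Qed.

Let nleS k (x : int) : `|x%:~R| <= C * (W k.+1)%:R ^+ 4 -> `|x%:~R| <= 16 * C * zr k ^+ 4.
Proof.
move=> h; apply: (le_trans h); have -> : 16 * C * zr k ^+ 4 = C * (16 * zr k ^+ 4) by ring.
by rewrite ler_pM2l.
Qed.

Let hnvS k : `|nvk k.+1| * zr k ^+ 11 <= C.
Proof.
apply: le_trans (hnv k.+1); rewrite ler_wpM2l // lerXn2r ?nnegrE ?ler0n //; exact: hz.
Qed.

Let prod_le (a b D : R) k : 0 <= D -> `|a| <= D * zr k ^+ 4 -> `|b| * zr k ^+ 11 <= C ->
  `|a * b| * zr k ^+ 7 <= D * C.
Proof.
move=> D0 ha hb; rewrite normrM -mulrA.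
apply: (@le_trans _ _ (D * zr k ^+ 4 * (`|b| * zr k ^+ 7))).
  by rewrite ler_wpM2r // mulr_ge0 // exprn_ge0 // ltW.
have -> : D * zr k ^+ 4 * (`|b| * zr k ^+ 7) = D * (`|b| * zr k ^+ 11) by ring.
by rewrite ler_wpM2l.
Qed.

Let e1E k : e1 k = (n1 k)%:~R * nvk k.+1 - (n1 k.+1)%:~R * nvk k :> R.
Proof. by rewrite /e1 /E1 /y1 /y2 /nvk /nv !intrB !intrM; ring. Qed.

Let e2E k : e2 k = (th * (n1 k.+1)%:~R + (n2 k.+1)%:~R) * nvk k - (th * (n1 k)%:~R + (n2 k)%:~R) * nvk k.+1.
Proof. by rewrite /e2 /E2 /y3 /y2 /nvk /nv !intrN !intrB !intrM; ring. Qed.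

Let e1_le k : `|e1 k| * zr k ^+ 7 <= k1.
Proof.
rewrite e1E; have z7 : 0 <= zr k ^+ 7 by rewrite exprn_ge0 // ltW.
have h1 := @prod_le (n1 k)%:~R (nvk k.+1) C k (ltW C_gt0) (nle (hn1 k)) (hnvS k).
have h2 := @prod_le (n1 k.+1)%:~R (nvk k) (16 * C) k _ (nleS (hn1 k.+1)) (hnv k).
have {}h2 := h2 (mulr_ge0 (ler0n _ 16) (ltW C_gt0)).
apply: (@le_trans _ _ ((`|(n1 k)%:~R * nvk k.+1| + `|(n1 k.+1)%:~R * nvk k|) * zr k ^+ 7)).
  by rewrite ler_wpM2r // ler_normB.
rewrite mulrDl; apply: (le_trans (lerD h1 h2)); rewrite /k1; have := th1; nra.
Qed.

Let e2_le k : `|e2 k| * zr k ^+ 7 <= k1.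
Proof.
rewrite e2E; have z7 : 0 <= zr k ^+ 7 by rewrite exprn_ge0 // ltW.
have hD (x y : int) D : `|x%:~R| <= D -> `|y%:~R| <= D -> `|th * x%:~R + y%:~R| <= (th + 1) * D :> R.
  move=> hx hy; apply: (le_trans (ler_normD _ _)); rewrite normrM (gtr0_norm th0) mulrDl mul1r lerD //.
  by rewrite ler_pM2l.
have h1 := hD _ _ _ (nle (hn1 k)) (nle (hn2 k)).
have h2 := hD _ _ _ (nleS (hn1 k.+1)) (nleS (hn2 k.+1)).
rewrite mulrA in h1; rewrite mulrA in h2.
have t1 : 0 <= th + 1 by have := th0; lra.
have {}h1 := @prod_le _ (nvk k.+1) ((th + 1) * C) k (mulr_ge0 t1 (ltW C_gt0)) h1 (hnvS k).
have {}h2 := @prod_le _ (nvk k) ((th + 1) * (16 * C)) k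
  (mulr_ge0 t1 (mulr_ge0 (ler0n _ 16) (ltW C_gt0))) h2 (hnv k).
apply: (@le_trans _ _ ((`|(th * (n1 k.+1)%:~R + (n2 k.+1)%:~R) * nvk k| +
   `|(th * (n1 k)%:~R + (n2 k)%:~R) * nvk k.+1|) * zr k ^+ 7)).
  by rewrite ler_wpM2r // ler_normB.
rewrite mulrDl; apply: (le_trans (lerD h2 h1)); rewrite /k1.
by rewrite le_eqVlt; apply/orP; left; apply/eqP; ring.
Qed.

Let lt_of_scaled (x b : R) k : `|x| * zr k ^+ 7 <= k1 -> k1 < b * zr k -> 0 < b -> `|x| < b.
Proof.
move=> h hb b0; have z7 : 0 < zr k ^+ 7 by rewrite exprn_gt0.
rewrite -(ltr_pM2r z7); apply: (le_lt_trans h); apply: (lt_le_trans hb).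
by rewrite ler_pM2l.
Qed.

Let e1_c k : `|e1 k| < c.
Proof. by have [h _ _ _] := big k; apply: lt_of_scaled (e1_le k) h c0. Qed.

Let half k : k1 < 2^-1 * zr k. Proof. by have [_ h _ _] := big k; rewrite -/(zr k) in h; lra. Qed.

Let e1_half k : `|e1 k| < 2^-1.
Proof. by apply: lt_of_scaled (e1_le k) (half k) _; rewrite invr_gt0. Qed.
Let e2_half k : `|e2 k| < 2^-1.
Proof. by apply: lt_of_scaled (e2_le k) (half k) _; rewrite invr_gt0. Qed.

Lemma int_lt1_eq0 (x : int) : `|x%:~R| < 1 :> R -> x = 0.
Proof. by move=> h; apply/eqP; apply: contraTT h => /int_norm_ge1; rewrite -leNgt. Qed.

(** If [y1] vanished, the small errors would force [y2] and [y3] to vanish as well, so that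
    [n k.+1 = lam * n k]. The decrease of [nvk] leaves only [lam = 0], which contradicts
    primitivity. *)
Let y1_neq0 k : y1 k != 0.
Proof.
apply/eqP => h1.
have h2 : y2 k = 0.
  apply: int_lt1_eq0; have := e1_half k; rewrite /e1 /E1 h1 mulr0 sub0r normrN; lra.
have h3 : y3 k = 0.
  apply: int_lt1_eq0; have := e2_half k; rewrite /e2 /E2 h2 mulr0 add0r; lra.
have [u [v [w bz]]] := prim k.
pose lam := u * n1 k.+1 + v * n2 k.+1 + w * n3 k.+1.
move: h1 h2 h3; rewrite /y1 /y2 /y3 => h1 h2 h3.
have E1' : n1 k.+1 = lam * n1 k.
  rewrite -[LHS]mulr1 -bz /lam; apply/eqP; rewrite -subr_eq0; apply/eqP.
  transitivity (v * - (n1 k * n2 k.+1 - n2 k * n1 k.+1) + w * (n3 k * n1 k.+1 - n1 k * n3 k.+1)); first by ring.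
  by rewrite h1 h2 oppr0 !mulr0 addr0.
have E2' : n2 k.+1 = lam * n2 k.
  rewrite -[LHS]mulr1 -bz /lam; apply/eqP; rewrite -subr_eq0; apply/eqP.
  transitivity (u * (n1 k * n2 k.+1 - n2 k * n1 k.+1) + w * (- (n2 k * n3 k.+1 - n3 k * n2 k.+1))); first by ring.
  by rewrite h1 h3 !mulr0 addr0.
have E3' : n3 k.+1 = lam * n3 k.
  rewrite -[LHS]mulr1 -bz /lam; apply/eqP; rewrite -subr_eq0; apply/eqP.
  transitivity (- u * (n3 k * n1 k.+1 - n1 k * n3 k.+1) - v * (- (n2 k * n3 k.+1 - n3 k * n2 k.+1))); first by ring.
  by rewrite h2 h3 !mulr0 subr0.
have nvE : nvk k.+1 = lam%:~R * nvk k by rewrite /nvk /nv E1' E2' E3' !intrM; ring.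
have nv0 : 0 < `|nvk k| by apply: le_lt_trans (dec k).
have lam0 : lam = 0.
  by apply: int_lt1_eq0; have := dec k; rewrite nvE normrM -ltr_pdivlMr // divff // gt_eqF.
have [u' [v' [w']]] := prim k.+1; rewrite E1' E2' E3' lam0 !mul0r !mulr0 !addr0.
by move/eqP; rewrite eq_sym oner_eq0.
Qed.

Let y1_le k : `|(y1 k)%:~R| <= 32 * C ^+ 2 * (W k)%:R ^+ 4 * zr k ^+ 4 :> R.
Proof.
rewrite /y1 intrB !intrM; apply: (le_trans (ler_normB _ _)); rewrite !normrM.
have h1 := ler_pM (normr_ge0 _) (normr_ge0 _) (hn1 k) (nleS (hn2 k.+1)).
have h2 := ler_pM (normr_ge0 _) (normr_ge0 _) (hn2 k) (nleS (hn1 k.+1)).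
apply: (le_trans (lerD h1 h2)).
by rewrite le_eqVlt; apply/orP; left; apply/eqP; ring.
Qed.

(** [conic] gives [|y1|] times the errors at least a constant. As [|y1|] is of order at most
    [W^4 z^4] and the errors at most [z^-7], this yields the bound on [z^3]. *)
Let step1 k : zr k ^+ 3 <= k2 * (W k)%:R ^+ 4.
Proof.
have := conic hc (y3 k) (y1_neq0 k) (e1_c k); rewrite -/(e1 k) -/(e2 k) => hcon.
have y2le : `|(y2 k)%:~R| <= th * `|(y1 k)%:~R| + `|e1 k|.
  have -> : (y2 k)%:~R = th * (y1 k)%:~R - e1 k by rewrite /e1 /E1; ring.
  by apply: (le_trans (ler_normB _ _)); rewrite normrM (gtr0_norm th0).
have a0 := normr_ge0 (e1 k); have a1 := e1_half k.
have h1 : `|(y2 k)%:~R| * `|e1 k| <= (th * `|(y1 k)%:~R| + `|e1 k|) * `|e1 k| by rewrite ler_wpM2r.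
have h2 : `|e1 k| * `|e1 k| <= 4^-1 by nra.
have h3 : 3 / 4 <= `|(y1 k)%:~R| * (th * `|e1 k| + `|e2 k|) by nra.
have z7 : 0 < zr k ^+ 7 by rewrite exprn_gt0.
have z4 : 0 < zr k ^+ 4 by rewrite exprn_gt0.
have h4 : (th * `|e1 k| + `|e2 k|) * zr k ^+ 7 <= (th + 1) * k1.
  by have := e1_le k; have := e2_le k; have := th0; nra.
have h5 : 3 / 4 * zr k ^+ 7 <= `|(y1 k)%:~R| * ((th + 1) * k1).
  apply: (@le_trans _ _ (`|(y1 k)%:~R| * (th * `|e1 k| + `|e2 k|) * zr k ^+ 7)); first by rewrite ler_pM2r.
  by rewrite -mulrA ler_wpM2l.
have t0 : 0 <= (th + 1) * k1 by rewrite mulr_ge0; have := th0; have := k1_ge1; lra.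
have h6 := ler_wpM2r t0 (y1_le k).
have h7 : 3 / 4 * zr k ^+ 7 <= 32 * C ^+ 2 * ((th + 1) * k1) * (W k)%:R ^+ 4 * zr k ^+ 4.
  by apply: (le_trans h5); apply: (le_trans h6); rewrite le_eqVlt; apply/orP; left; apply/eqP; ring.
have h8 : 3 / 4 * zr k ^+ 3 <= 32 * C ^+ 2 * ((th + 1) * k1) * (W k)%:R ^+ 4.
  by rewrite -(ler_pM2r z4) (le_trans _ h7) // le_eqVlt; apply/orP; left; apply/eqP; ring.
have -> : k2 * (W k)%:R ^+ 4 = 2 * (32 * C ^+ 2 * ((th + 1) * k1) * (W k)%:R ^+ 4) by rewrite /k2; ring.
have : 0 < zr k ^+ 3 by rewrite exprn_gt0.
by move: h8; move: (zr k ^+ 3) (32 * C ^+ 2 * ((th + 1) * k1) * (W k)%:R ^+ 4) => A B; lra.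
Qed.

Let k2_ge0 : 0 <= k2.
Proof. by rewrite /k2 !mulr_ge0 ?exprn_ge0 ?ltW //; have := th0; have := k1_ge1; lra. Qed.
Let k4_ge0 : 0 <= k4.
Proof. by rewrite /k4 !mulr_ge0 ?ltW //; have := th0; have := k1_ge1; lra. Qed.

Let step2 k : zr k.+1 ^+ 3 <= k3 * zr k ^+ 4.
Proof.
apply: (le_trans (step1 k.+1)); rewrite /k3.
have -> : 16 * k2 * zr k ^+ 4 = k2 * (16 * zr k ^+ 4) by ring.
by rewrite ler_wpM2l.
Qed.

(** By [step2], [z k.+1 ^ 4] is at most of order [z k ^ (16/3)], and 16/3 < 7: this is the
    inequality that decides which exponents are admissible. *)
Let step3 k : 2 * k4 * zr k.+1 ^+ 4 < zr k ^+ 7.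
Proof.
rewrite ltNge; apply/negP => h.
have z16 : 0 < zr k ^+ 16 by rewrite exprn_gt0.
have h1 : (zr k ^+ 7) ^+ 3 <= (2 * k4 * zr k.+1 ^+ 4) ^+ 3.
  have z70 : 0 <= zr k ^+ 7 by rewrite exprn_ge0 // ltW.
  by have h0 := le_trans z70 h; rewrite lerXn2r ?nnegrE.
have h2 : (zr k.+1 ^+ 3) ^+ 4 <= (k3 * zr k ^+ 4) ^+ 4.
  have z30 : 0 <= zr k.+1 ^+ 3 by rewrite exprn_ge0 // ltW.
  by have h0 := le_trans z30 (step2 k); rewrite lerXn2r ?nnegrE ?step2.
have k43 : 0 <= 8 * k4 ^+ 3 by rewrite mulr_ge0 ?exprn_ge0.
have h3 : zr k ^+ 5 * zr k ^+ 16 <= 8 * k4 ^+ 3 * k3 ^+ 4 * zr k ^+ 16.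
  have -> : zr k ^+ 5 * zr k ^+ 16 = (zr k ^+ 7) ^+ 3 by ring.
  apply: (le_trans h1).
  have -> : (2 * k4 * zr k.+1 ^+ 4) ^+ 3 = 8 * k4 ^+ 3 * (zr k.+1 ^+ 3) ^+ 4 by ring.
  have -> : 8 * k4 ^+ 3 * k3 ^+ 4 * zr k ^+ 16 = 8 * k4 ^+ 3 * (k3 * zr k ^+ 4) ^+ 4 by ring.
  by rewrite ler_wpM2l.
rewrite ler_pM2r // in h3; have [_ _ _] := big k; rewrite -/(zr k) ltNge => /negP; apply.
by apply: le_trans h3; exact: zrXS.
Qed.

(** The determinant of three consecutive forms is an integer; expanded along the line, all its terms
    are small and the total is less than 1. *)
Let det_eq0 k : - n1 k.+2 * y3 k + n2 k.+2 * y2 k + n3 k.+2 * y1 k = 0.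
Proof.
apply: int_lt1_eq0.
have -> : (- n1 k.+2 * y3 k + n2 k.+2 * y2 k + n3 k.+2 * y1 k)%:~R =
    (y1 k)%:~R * nvk k.+2 - (n2 k.+2)%:~R * e1 k - (n1 k.+2)%:~R * (e2 k + th * e1 k) :> R.
  rewrite /e1 /e2; move: (y1 k) (y2 k) (y3 k) => u v w.
  by rewrite /nvk /nv /E1 /E2 !intrD !intrM intrN; ring.
have z3 : 0 < zr k ^+ 3 by rewrite exprn_gt0.
have z7 : 0 < zr k ^+ 7 by rewrite exprn_gt0.
have z8 : 0 < zr k ^+ 8 by rewrite exprn_gt0.
have h1 : `|(y1 k)%:~R * nvk k.+2| < 2^-1.
  have hy : `|(y1 k)%:~R| <= 32 * C ^+ 2 * zr k ^+ 8.
    apply: (le_trans (y1_le k)).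
    have -> : 32 * C ^+ 2 * zr k ^+ 8 = 32 * C ^+ 2 * zr k ^+ 4 * zr k ^+ 4 by ring.
    by rewrite ler_pM2r ?exprn_gt0 // ler_pM2l ?mulr_gt0 ?exprn_gt0.
  have hv : `|nvk k.+2| * zr k ^+ 11 <= C.
    by apply: le_trans (hnvS k); rewrite ler_wpM2r ?exprn_ge0 ?(ltW (zr0 k)) // ltW.
  rewrite normrM -(ltr_pM2r z3).
  apply: (@le_lt_trans _ _ (32 * C ^+ 2 * (`|nvk k.+2| * zr k ^+ 11))).
    apply: (@le_trans _ _ (32 * C ^+ 2 * zr k ^+ 8 * `|nvk k.+2| * zr k ^+ 3)).
      by rewrite ler_pM2r // ler_wpM2r.
    by rewrite le_eqVlt; apply/orP; left; apply/eqP; ring.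
  apply: (@le_lt_trans _ _ (32 * C ^+ 2 * C)); first by rewrite ler_pM2l ?mulr_gt0 ?exprn_gt0.
  have [_ _ h _] := big k; rewrite -/(zr k) in h; have := zrXS k 2; have : C ^+ 2 * C = C ^+ 3 by ring.
  by rewrite -mulrA => ->; lra.
have h2 : `|(n2 k.+2)%:~R * e1 k| + `|(n1 k.+2)%:~R * (e2 k + th * e1 k)| < 2^-1.
  have b1 : `|e2 k + th * e1 k| <= `|e2 k| + th * `|e1 k|.
    by apply: (le_trans (ler_normD _ _)); rewrite normrM (gtr0_norm th0).
  have m1 := nleS (hn1 k.+2); have m2 := nleS (hn2 k.+2).
  set D := 16 * C * zr k.+1 ^+ 4 in m1 m2.
  have D0 : 0 <= D by apply: le_trans m1.
  have b2 : (`|(n2 k.+2)%:~R * e1 k| + `|(n1 k.+2)%:~R * (e2 k + th * e1 k)|) <= D * (`|e1 k| + (`|e2 k| + th * `|e1 k|)).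
    by rewrite !normrM [leRHS]mulrDr; apply: lerD; apply: ler_pM.
  apply: (le_lt_trans b2); rewrite -(ltr_pM2r z7) -mulrA.
  have b3 : (`|e1 k| + (`|e2 k| + th * `|e1 k|)) * zr k ^+ 7 <= (2 + th) * k1.
    by have := e1_le k; have := e2_le k; have := th0; nra.
  apply: (le_lt_trans (ler_wpM2l D0 b3)); have := step3 k; rewrite /D /k4.
  have -> : 16 * C * zr k.+1 ^+ 4 * ((2 + th) * k1) = 16 * C * (2 + th) * k1 * zr k.+1 ^+ 4 by ring.
  by rewrite -mulrA; move: (16 * C * (2 + th) * k1 * zr k.+1 ^+ 4) (zr k ^+ 7) => A B; lra.
apply: (le_lt_trans (ler_normB _ _)); have := ler_normB ((y1 k)%:~R * nvk k.+2) ((n2 k.+2)%:~R * e1 k).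
by move: h1 h2; lra.
Qed.

Let parallel k : y1 k * y2 k.+1 = y2 k * y1 k.+1.
Proof.
apply/eqP; rewrite -subr_eq0; apply/eqP.
transitivity (- (- n1 k.+2 * y3 k + n2 k.+2 * y2 k + n3 k.+2 * y1 k) * n1 k.+1).
  by rewrite /y1 /y2 /y3; ring.
by rewrite det_eq0 oppr0 mul0r.
Qed.

Let parallel0 k : y1 0%N * y2 k = y2 0%N * y1 k.
Proof.
elim: k => [|k IH]; first by rewrite mulrC.
apply: (mulfI (y1_neq0 k)).
transitivity (y1 0%N * (y1 k * y2 k.+1)); first by ring.
rewrite parallel; transitivity (y1 0%N * y2 k * y1 k.+1); first by ring.
by rewrite IH; ring.
Qed.

(** All the points [y k] are parallel, so [e1 k / y1 k] does not depend on [k], whereas [e1 k] tends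
    to 0 and [|y1 k| >= 1]. Hence [e1 0 = 0], a rational relation for [th]. *)
Lemma davenport_schmidt_sequences : False.
Proof.
have zk k : k%:R <= zr k.
  rewrite ler_nat; elim: k => // k IH; apply: leq_trans (Wz k.+1); rewrite WS; lia.
have e0 : e1 0%N != 0.
  apply/eqP; rewrite /e1 /E1 => h; have [|_ h1 _] := irr (p := 0) (q := y1 0%N) (r := - y2 0%N).
    by rewrite /nv mulr0 add0r intrN -[RHS]h.
  by have := y1_neq0 0%N; rewrite h1 eqxx.
have eE k : (y1 0%N)%:~R * e1 k = (y1 k)%:~R * e1 0%N.
  have := congr1 (fun x : int => x%:~R : R) (parallel0 k); rewrite /= !intrM => h.
  by rewrite /e1 /E1 !mulrBr h; ring.
have he k : `|e1 0%N| * k%:R <= `|(y1 0%N)%:~R| * k1.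
  have h := congr1 (fun u => `|u|) (eE k); rewrite /= !normrM in h.
  have h1 : `|e1 0%N| <= `|(y1 0%N)%:~R| * `|e1 k|.
    by rewrite h ler_peMl // int_norm_ge1.
  apply: (@le_trans _ _ (`|(y1 0%N)%:~R| * `|e1 k| * zr k)).
    by apply: ler_pM.
  rewrite -mulrA ler_wpM2l //; apply: le_trans (e1_le k); rewrite ler_wpM2l //; exact: zrXS.
have ep : 0 < `|e1 0%N| by rewrite normr_gt0.
have B0 : 0 <= `|(y1 0%N)%:~R| * k1 / `|e1 0%N|.
  by rewrite divr_ge0 // mulr_ge0 //; have := k1_ge1; lra.
have := archi_boundP B0; move: (Num.bound _) => m; rewrite ltr_pdivrMr // => h.
by have := he m; rewrite mulrC leNgt h.
Qed.
End Sequences.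

(** Each form is made primitive and used up to the last [Z] for which it remains good; the next one
    is chosen for the successor of that [Z]. Maximality is what makes the values [nv] strictly
    decrease. *)
Lemma davenport_schmidt : ~ exists Z0 : nat, forall Z : nat, (Z0 <= Z)%N ->
  small_n (C * Z%:R ^+ 4) (C / Z%:R ^+ 11).
Proof.
move=> [Z0 hZ0]; have C0 : 0 < C by apply: lt_le_trans C1.
have t0 : 0 < th by apply: lt_le_trans th1.
pose k1 := 17 * (th + 1) * C ^+ 2; pose k2 := 64 * C ^+ 2 * (th + 1) * k1.
pose k3 := 16 * k2; pose k4 := 16 * C * (2 + th) * k1.
have k10 : 0 <= k1 by rewrite /k1 !mulr_ge0 ?exprn_ge0 ?ltW //; lra.
have k20 : 0 <= k2 by rewrite /k2 !mulr_ge0 ?exprn_ge0 ?ltW //; lra.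
have k40 : 0 <= k4 by rewrite /k4 !mulr_ge0 ?ltW //; lra.
have p1 : 0 <= k1 / c by rewrite divr_ge0 // ltW.
have p2 : 0 <= 64 * C ^+ 3 by rewrite mulr_ge0 ?exprn_ge0 ?ltW.
have k30 : 0 <= k3 by exact: (mulr_ge0 (ler0n R 16) k20).
have p3 : 0 <= 8 * k4 ^+ 3 * k3 ^+ 4.
  apply: mulr_ge0; last exact: exprn_ge0.
  exact: (mulr_ge0 (ler0n R 8) (exprn_ge0 3 k40)).
have pS : 0 <= k1 / c + 2 * k1 + 64 * C ^+ 3 + 8 * k4 ^+ 3 * k3 ^+ 4 by lra.
have := archi_boundP pS; move: (Num.bound _) => B hB.
pose Z1 := (Z0 + B).+1.
have step (W : nat) : exists nz : int * int * int * nat, (Z1 <= W)%N ->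
   [/\ (W <= nz.2)%N, `|nz.1.1.1%:~R| <= C * W%:R ^+ 4, `|nz.1.1.2%:~R| <= C * W%:R ^+ 4 &
     [/\ `|nv nz.1.1.1 nz.1.1.2 nz.1.2| * nz.2%:R ^+ 11 <= C,
       C < `|nv nz.1.1.1 nz.1.1.2 nz.1.2| * nz.2.+1%:R ^+ 11 &
       exists u v w, u * nz.1.1.1 + v * nz.1.1.2 + w * nz.1.2 = 1]].
  (* Below [Z1] nothing is claimed; the zero tuple only makes the choice function total. *)
  have [hW|hW] := leqP Z1 W; last by exists (0, 0, 0, 0%N).
  have W0 : (0 < W)%N by apply: leq_trans hW.
  have wR : 0 < W%:R ^+ 11 :> R by rewrite exprn_gt0 // ltr0n.
  have [p [q [r [pqr hp hq hv]]]] : small_n (C * W%:R ^+ 4) (C / W%:R ^+ 11).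
    by apply: hZ0; exact: leq_trans (leqW (leq_addr _ _)) hW.
  have [g [a [b [d [u [v [w [g0 Ep Eq Er bz]]]]]]]] := primitive3 pqr.
  have g1 := int_norm_ge1 g0.
  have ha : `|a%:~R| <= C * W%:R ^+ 4.
    by apply: le_trans hp; rewrite Ep intrM normrM ler_peMl.
  have hb : `|b%:~R| <= C * W%:R ^+ 4.
    by apply: le_trans hq; rewrite Eq intrM normrM ler_peMl.
  have hd : `|nv a b d| * W%:R ^+ 11 <= C.
    rewrite -ler_pdivlMr //; apply: le_trans hv.
    have -> : nv p q r = g%:~R * nv a b d by rewrite /nv Ep Eq Er !intrM; ring.
    by rewrite normrM ler_peMl.
  have nv0 : 0 < `|nv a b d|.
    rewrite normr_gt0; apply/eqP => /irr[a0 b0 d0]; move: bz; rewrite a0 b0 d0 !mulr0 !addr0.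
    by move/eqP; rewrite eq_sym oner_eq0.
  pose P (Z : nat) := `|nv a b d| * Z%:R ^+ 11 <= C.
  have exP : exists Z, P Z by exists W.
  have q0 : 0 <= C / `|nv a b d| by rewrite divr_ge0 // ltW.
  have ubP Z : P Z -> (Z <= Num.bound (C / `|nv a b d|))%N.
    rewrite /P => hZ; rewrite -(ler_nat R); apply: le_trans (ltW (archi_boundP q0)).
    rewrite ler_pdivlMr // mulrC; apply: le_trans hZ; rewrite ler_pM2l //.
    by case: Z => [|Z]; rewrite ?exprn_ge0 // exprS ler_peMr // exprn_ege1 // ler1n.
  case: (ex_maxnP exP ubP) => Z hZ hmax; exists (a, b, d, Z) => _ /=; split=> //.
    exact: hmax.
  split=> //; last by exists u, v, w.
  by rewrite ltNge; apply/negP => /hmax; rewrite ltnn.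
have [F hF] := choice step.
pose W := fix W k := if k is k'.+1 then (F (W k')).2.+1 else Z1.
have WZ k : (Z1 <= W k)%N.
  by elim: k => //= k IH; have [h _ _ _] := hF _ IH; apply: leqW; apply: leq_trans h.
apply: (@davenport_schmidt_sequences (fun k => (F (W k)).1.1.1) (fun k => (F (W k)).1.1.2)
  (fun k => (F (W k)).1.2) W (fun k => (F (W k)).2)).
- by move=> k; have [] := hF _ (WZ k).
- by [].
- by move=> k; have [] := hF _ (WZ k).
- by move=> k; have [] := hF _ (WZ k).
- by move=> k; have [_ _ _ []] := hF _ (WZ k).
- by move=> k; have [_ _ _ []] := hF _ (WZ k).
- move=> k; have [_ _ _ [_ h _]] := hF _ (WZ k); have [h1 _ _ [h2 _ _]] := hF _ (WZ k.+1).
  have x0 : 0 < (F (W k)).2.+1%:R ^+ 11 :> R by rewrite exprn_gt0 // ltr0n.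
  rewrite -(ltr_pM2r x0); apply: le_lt_trans h; apply: le_trans h2; rewrite ler_wpM2l //.
  by rewrite lerXn2r ?nnegrE ?ler0n // ler_nat.
move=> k; have [h _ _ _] := hF _ (WZ k); have h2 := WZ k.
have hz : B%:R < (F (W k)).2%:R :> R by rewrite ltr_nat; apply: leq_trans h; apply: leq_trans h2; rewrite ltnS leq_addl.
move: hz; move: ((F (W k)).2%:R : R) => z hz.
rewrite -/k1 -/k2 -/k3 -/k4; split; try lra.
by rewrite mulrC -ltr_pdivrMr //; lra.
Qed.
End DavenportSchmidt.

Lemma short_triples_exist (c : R) : 0 < c ->
  (forall s t : int, s != 0 -> c <= `|s%:~R| * `|th * s%:~R - t%:~R|) ->
  (forall p q r, nv p q r = 0 -> [/\ p = 0, q = 0 & r = 0]) ->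
  exists2 C : R, 1 <= C & forall Z0 : nat, exists2 Z : nat, (Z0 <= Z)%N &
    short_triple (C / Z%:R ^+ 4) (C * Z%:R ^+ 11).
Proof.
move=> c0 hc irr; have t0 : 0 <= 2 * (2 + th) + 1 by have := th1; lra.
have hg := ltW (archi_boundP t0); move: (Num.bound _) hg => g0 hg.
have g1 : 1 <= g0%:R :> R by have := th1; lra.
exists g0%:R => // Z0; apply: contrapT => nex.
apply: (davenport_schmidt g1 c0 hc irr); exists Z0.+1 => Z hZ.
have Zp : (0 < Z)%N by apply: leq_trans hZ.
have [h|//] := transference hg Zp.
by case: nex; exists Z => //; apply: ltnW.
Qed.
End Geo.

(** * Repetitions in recurrent morphic words *)

Section Words.
Variables (A : finType) (sigma : seq A -> seq A) (c : A) (x : nat -> A).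
Hypothesis sigmaM : word_morphism sigma.
Hypothesis sigmaP : prolongable_at sigma c.
Hypothesis sigmaC : words_converge (fun n => iter n sigma [:: c]) x.
Hypothesis xrec : recurrent_word x.

Let w n := iter n sigma [:: c].

Lemma iter_morphism n u v : iter n sigma (u ++ v) = iter n sigma u ++ iter n sigma v.
Proof. by elim: n => //= n ->; case: sigmaM => _ ->. Qed.

(** The iterates of [W] are nonempty, so each iterate of the morphism extends the previous one by at
    least one letter. *)
Lemma iterates_extend n m : (n <= m)%N -> exists v, w m = w n ++ v /\ (size (w n) + (m - n) <= size (w m))%N.
Proof.
case: sigmaP => W [EW hW] /subnKC; move: (m - n)%N => k <- {m}.
elim: k => [|k [v [Ev hv]]]; first by exists [::]; rewrite cats0 !addn0.
exists (v ++ iter (n + k) sigma W); rewrite addnS.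
have E : w (n + k).+1 = w (n + k) ++ iter (n + k) sigma W.
  by rewrite /w iterSr EW -[c :: W]cat1s iter_morphism.
have h : (0 < size (iter (n + k) sigma W))%N by rewrite lt0n size_eq0; apply/eqP; exact: hW.
split; first by rewrite E Ev catA.
by rewrite E size_cat addnS; move: hv h; lia.
Qed.

Lemma iterates_letters n i : (i < size (w n))%N -> nth c (w n) i = x i.
Proof.
move=> hi; have [N hN] := sigmaC i; have [v [Ev _]] := iterates_extend (leq_maxr N n).
have := hN _ (leq_maxl N n); rewrite -/(w _) Ev !onthE map_cat nth_cat size_map hi (nth_map c) //.
by case.
Qed.

Lemma iterates_size n : (n < size (w n))%N.
Proof. by have [v [_]] := iterates_extend (leq0n n); rewrite subn0 /=; lia. Qed.

Lemma morphism_growth : exists2 S : nat, (0 < S)%N & forall u, (size (sigma u) <= S * size u)%N.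
Proof.
exists (\max_(a : A) size (sigma [:: a])).+1 => // u; elim: u => [|a u IH].
  by case: sigmaM => ->.
rewrite -[a :: u]cat1s; case: sigmaM => _ ->; rewrite !size_cat mulnDr muln1; apply: leq_add => //.
by apply: leqW; apply: (leq_bigmax a).
Qed.

(** Recurrence gives a second occurrence of [c], at position [i > 0]; write the iterate [w i] as
    [u c v]. Applying the [n]-th iterate shows that the prefix [w n] recurs after the image of [u].
    As [u] begins with [c], this position is at least the size of [w n], and growth by at most a
    factor [S] per iteration keeps it proportional. *)
Lemma prefix_returns : exists C : nat, forall r0 : nat, (0 < r0)%N -> exists r l : nat,
  [/\ (r0 <= r <= C * r0)%N, (r <= l <= C * r)%N & forall i, (i < r)%N -> x (l + i)%N = x i].
Proof.
have [S S0 hS] := morphism_growth.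
have x0 : x 0%N = c by rewrite -(@iterates_letters 0%N 0%N).
have [i i0 xi] : exists2 i, (0 < i)%N & x i = c.
  have [i [j [ij xi xj]]] := xrec 0%N; rewrite x0 in xi xj.
  by case: i ij xi => [|i] ij xi; [exists j => //; case: j ij xj | exists i.+1].
pose u := take i (w i); pose v := drop i.+1 (w i).
have si := iterates_size i.
have wE : w i = u ++ [:: c] ++ v.
  rewrite -[LHS](cat_take_drop i) -/u; congr (_ ++ _); rewrite (drop_nth c) //.
  by rewrite iterates_letters // xi.
have uE : u = c :: behead u.
  have : size u = i by rewrite size_takel // ltnW.
  have : nth c u 0 = c by rewrite nth_take // iterates_letters // (leq_ltn_trans _ si).
  by case: (u) => [|b s] /= => [_ h|-> //]; move: i0; rewrite -h.
have gr n k : (size (w (n + k)%N) <= S ^ k * size (w n))%N.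
  elim: k => [|k IH]; first by rewrite addn0 mul1n.
  rewrite addnS /w iterS -/(w _); apply: (leq_trans (hS _)).
  by rewrite expnS -mulnA leq_mul2l IH orbT.
have S1 k : (0 < S ^ k)%N by rewrite expn_gt0 S0.
exists (S ^ i.+1)%N => r0 r00.
have ex : exists n, (r0 <= size (w n))%N by exists r0; apply: ltnW; exact: iterates_size.
(* Minimality of [n] bounds the prefix by [S * r0], so returns occur at every scale up to a constant
   factor. *)
case: (ex_minnP ex) => n hn nmin.
exists (size (w n)), (size (iter n sigma u)).
have wnE : w (n + i)%N = iter n sigma u ++ w n ++ iter n sigma v.
  by rewrite /w iterD -/(w i) wE !iter_morphism.
split.
- rewrite hn /=; case: n hn nmin {wnE} => [|n] hn nmin.
    by rewrite /= muln_gt0 S1.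
  have lt : (size (w n) < r0)%N by rewrite ltnNge; apply/negP => /nmin; rewrite ltnn.
  have := gr n 1%N; rewrite addn1 expn1 => h; apply: (leq_trans h).
  by apply: leq_mul; [rewrite expnS leq_pmulr | apply: ltnW].
- apply/andP; split.
    by rewrite uE -cat1s iter_morphism size_cat leq_addr.
  apply: (@leq_trans (size (w (n + i)%N))); first by rewrite wnE size_cat leq_addr.
  by apply: (leq_trans (gr n i)); rewrite leq_mul2r leq_pexp2l ?orbT.
move=> k kn; rewrite -(@iterates_letters (n + i)); last by rewrite wnE !size_cat; lia.
by rewrite wnE nth_cat ltnNge leq_addr /= addKn nth_cat kn iterates_letters.
Qed.
End Words.

Lemma recurrent_morphic_returns (b : nat -> int) : generated_by_recurrent_morphism b ->
  (exists M : nat, forall k, b k <= M%:Z) /\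
  exists C : nat, forall r0 : nat, (0 < r0)%N -> exists r l : nat,
  [/\ (r0 <= r <= C * r0)%N, (r <= l <= C * r)%N & forall i, (i < r)%N -> b (l + i)%N = b i].
Proof.
move=> [A [sigma [c [x [phi [h1 h2 h3 h4 hb]]]]]]; split.
  exists (\max_(a : A) `|phi a|%N)%N => k; rewrite hb.
  by have := @leq_bigmax _ (fun a => `|phi a|%N) (x k); lia.
have [C hC] := prefix_returns h1 h2 h3 h4; exists C => r0 r00.
have [r [l [hr hl hx]]] := hC _ r00; exists r, l; split=> // i ir.
by rewrite !hb hx.
Qed.

(** * Algebraic numbers *)

Lemma no_quadratic_relation (R : realType) (alpha : R) d (z p q r : int) :
  algebraic_of_degree alpha d -> (3 <= d)%N ->
  p%:~R + q%:~R * (alpha - z%:~R) + r%:~R * (alpha - z%:~R) ^+ 2 = 0 ->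
  [/\ p = 0, q = 0 & r = 0].
Proof.
move=> [P [[mon rt mn] sz]] hd h.
pose s : seq int := [:: p - q * z + r * z ^+ 2; q - 2 * r * z; r].
pose Q : {poly rat} := Poly [seq x%:~R | x <- s].
have rQ : root (map_poly ratr Q) alpha.
  have -> : map_poly ratr Q = Poly [seq x%:~R | x <- s] :> {poly R}.
    by apply/polyP => i; rewrite coef_map !coef_Poly /=; case: i => [|[|[|i]]] /=; rewrite ?nth_nil ?ratr_int ?rmorph0.
  rewrite rootE horner_Poly /= !(intrD, intrB, intrN, intrM, rmorphXn) /=.
  by rewrite -[X in _ == X]h; apply/eqP; ring.
have Q0 : Q = 0.
  apply/eqP; apply: contraT => Qn0; have := dvdp_leq Qn0 (mn _ rQ).
  rewrite sz => h1; have := leq_trans h1 (size_Poly _); rewrite size_map /= => h2.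
  by move: hd h2; clear; lia.
have cf i : s`_i = 0.
  have := congr1 (fun u : {poly rat} => u`_i) Q0; rewrite /= coef_Poly coef0.
  have [il|il] := ltnP i (size s); last by move=> _; rewrite nth_default.
  by rewrite (nth_map 0) // => /eqP; rewrite intr_eq0 => /eqP.
have r0 : r = 0 by exact: (cf 2%N).
have q0 : q = 0 by have := cf 1%N; rewrite /= r0 mulr0 mul0r subr0.
have p0 : p = 0 by have := cf 0%N; rewrite /= r0 q0 !mul0r subr0 addr0.
by [].
Qed.

Lemma integer_polynomial_root (R : realType) (alpha : R) d (z : int) :
  algebraic_of_degree alpha d ->
  exists2 f : {poly int}, f != 0 & root (map_poly intr f) (alpha - z%:~R)^-1.
Proof.
move=> [P [[mon rt mn] sz]].
have al : algebraicOver (@ratr R) alpha by exists P => //; exact: monic_neq0.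
have az : algebraicOver (@ratr R) z%:~R.
  by have := algebraic_id (@ratr R : {rmorphism rat -> R}) z%:~R; rewrite /= ratr_int.
have [Q Q0 rQ] := algebraic_inv (algebraic_sub al az).
have [f [c c0 E]] := rat_poly_scale Q.
exists f; first by apply: contraNneq Q0 => f0; rewrite E f0 map_poly0 scaler0.
move: rQ; rewrite E map_polyZ /= rootZ; last by rewrite fmorph_eq0 invr_eq0 intr_eq0.
rewrite -map_poly_comp; congr (root _ _); apply: eq_map_poly => x /=; exact: ratr_int.
Qed.

(** * Approximations from short vectors *)

Definition det3 (F : pzRingType) (a b d a' b' d' a'' b'' d'' : F) :=
  - (b * a' - a * b') * d'' + (d * a' - a * d') * b'' + (b * d' - d * b') * a''.

(** Cramer's rule tested against an arbitrary linear form: the three points span the space of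
    triples. *)
Lemma cramer3 (F : fieldType) (a b d a' b' d' a'' b'' d'' al be ga x y w : F) :
  det3 a b d a' b' d' a'' b'' d'' != 0 ->
  (al * a + be * b + ga * d) * (det3 x y w a' b' d' a'' b'' d'' / det3 a b d a' b' d' a'' b'' d'') +
  (al * a' + be * b' + ga * d') * (det3 a b d x y w a'' b'' d'' / det3 a b d a' b' d' a'' b'' d'') +
  (al * a'' + be * b'' + ga * d'') * (det3 a b d a' b' d' x y w / det3 a b d a' b' d' a'' b'' d'') =
  al * x + be * y + ga * w.
Proof.
set De := det3 a b d a' b' d' a'' b'' d'' => De0; rewrite !mulrA -!mulrDl.
apply: (mulIf De0); rewrite divfK // /De /det3; ring.
Qed.

Section Config.
Variables (R : realType) (th tl C : R) (A N Z : nat) (p p' q q' : int).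
Variables (a b d a' b' d' a'' b'' d'' : int).
Hypotheses (C1 : 1 <= C) (th1 : 1 <= th) (thA : th <= A%:R + 1) (tl1 : 1 <= tl) (tlA : tl <= A%:R + 1).
Hypotheses (q0 : 0 < q) (q'0 : 0 <= q') (q'q : q' <= q).
Hypothesis det1 : (p * q' - p' * q) ^+ 2 = 1.
Hypothesis thE : th * (q%:~R * tl + q'%:~R) = p%:~R * tl + p'%:~R.
Hypotheses (Z1 : (1 < Z)%N) (Zq : Z%:Z <= q) (qZ : q <= (Z ^ N)%N%:Z).
Hypothesis close : `|tl - th| * Z%:R ^+ 15 <= 1.
Hypothesis Zbig : ln ((A%:R + 3) * C) * 8 <= ln Z%:R.
Local Notation sh x y w := ([/\ `|x%:~R| <= C * Z%:R ^+ 11, `|th * x%:~R - y%:~R| <= C / Z%:R ^+ 4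
  & `|th * y%:~R + w%:~R| <= C / Z%:R ^+ 4]).
Hypotheses (sh1 : sh a b d) (sh2 : sh a' b' d') (sh3 : sh a'' b'' d'').
Hypothesis De0 : det3 a b d a' b' d' a'' b'' d'' != 0.

Let kap := ln ((A%:R + 3) * C).
Let zet : R := ln Z%:R.
Let L : R := ln q%:~R.
Let K0 := (A%:R + 3) * C.
Let tau := C / Z%:R ^+ 4.
Let D := q%:~R * tl + q'%:~R.

Let z0 : 0 < Z%:R :> R. Proof. by rewrite ltr0n; exact: ltnW. Qed.
Let z40 : 0 < Z%:R ^+ 4 :> R. Proof. by rewrite exprn_gt0. Qed.
Let qR1 : 1 <= q%:~R :> R.
Proof. by rewrite -[X in X <= _](_ : 1%:~R = _) // ler_int; move: q0; clear; lia. Qed.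
Let qR0 : 0 < q%:~R :> R. Proof. exact: lt_le_trans qR1. Qed.
Let q'R0 : 0 <= q'%:~R :> R. Proof. by rewrite ler0z. Qed.
Let q'qR : q'%:~R <= q%:~R :> R. Proof. by rewrite ler_int. Qed.
Let A3 : 3 <= A%:R + 3 :> R. Proof. by rewrite lerDr. Qed.
Let K01 : 1 <= K0. Proof. by rewrite /K0 mulr_ege1 //; have := A3; lra. Qed.
Let tau0 : 0 < tau. Proof. by rewrite divr_gt0 // (lt_le_trans _ C1). Qed.
Let Dq : q%:~R <= D.
Proof. by rewrite /D; apply: ler_wpDr => //; rewrite ler_peMr // ltW. Qed.
Let D0 : 0 < D. Proof. exact: lt_le_trans Dq. Qed.

Let kap0 : 0 <= kap. Proof. exact: ln_ge0. Qed.
Let zet0 : 0 <= zet. Proof. by apply: ln_ge0; rewrite ler1n; exact: ltnW. Qed.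
Let zetL : zet <= L.
Proof. by rewrite /zet /L ler_ln ?posrE // -[X in X <= _](_ : (Z%:Z)%:~R = _) // ler_int. Qed.
Let LN : L <= N%:R * zet.
Proof.
rewrite /zet mulr_natl -lnXn // /L ler_ln ?posrE ?exprn_gt0 // -natrX.
by rewrite -[X in _ <= X](_ : ((Z ^ N)%N%:Z)%:~R = _) // ler_int.
Qed.

(** In the sum the terms in [L] cancel and [4 * kap - zet] remains, since [- 3 * 4 + 11 = - 1]. *)
Let cs (i : nat) : R := nth 0 [:: kap - 4 * zet - L; kap - 4 * zet - L; kap - 4 * zet + L; kap + 11 * zet + L] i.

Let expK : expR kap = K0. Proof. by rewrite lnK // posrE (lt_le_trans _ K01). Qed.
Let expZ : expR zet = Z%:R. Proof. by rewrite lnK // posrE. Qed.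
Let expL : expR L = q%:~R. Proof. by rewrite lnK // posrE. Qed.

Let cs01 : expR (kap - 4 * zet - L) = (A%:R + 3) * tau / q%:~R.
Proof. by rewrite !expRD !expRN expRM_natl expK expZ expL /K0 /tau; ring. Qed.
Let cs2 : expR (kap - 4 * zet + L) = (A%:R + 3) * tau * q%:~R.
Proof. by rewrite !expRD !expRN expRM_natl expK expZ expL /K0 /tau; ring. Qed.
Let cs3 : expR (kap + 11 * zet + L) = (A%:R + 3) * (C * Z%:R ^+ 11) * q%:~R.
Proof. by rewrite !expRD expRM_natl expK expZ expL /K0; ring. Qed.

(** [gv] lists the entries of the inverse transpose of the matrix with rows [(p, p')] and [(q, q')],
    up to the sign of its determinant, times the trace-zero matrix with rows [(y, x)] and
    [(w, - y)]. The trace condition is orthogonality to [(q, q', p, p')]. *)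
Let ga (k : nat) : int := nth 0 [:: 0; - p'; 0; q'] k.
Let gb (k : nat) : int := nth 0 [:: - p'; - p; q'; q] k.
Let gd (k : nat) : int := nth 0 [:: p; 0; - q; 0] k.
Let gv (k : nat) (x y w : int) : int := ga k * x + gb k * y + gd k * w.
Let Lf (i : nat) (Y : nat -> R) : R :=
  nth 0 [:: Y 0%N - th * Y 1%N + th * Y 2%N - th ^+ 2 * Y 3%N; Y 1%N + th * Y 3%N; Y 2%N - th * Y 3%N; Y 3%N] i.

Let scaled (X W w : R) : D * X = (p * q' - p' * q)%:~R * W -> `|W| <= w -> `|X| <= w / q%:~R.
Proof.
move=> E hW; rewrite ler_pdivlMr //.
have ep1 : `|(p * q' - p' * q)%:~R| = 1 :> R.
  by move/eqP: det1; rewrite sqrf_eq1 => /orP[] /eqP ->; rewrite ?intrN ?normrN normr1.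
have := congr1 (fun u => `|u|) E; rewrite !normrM ep1 mul1r (gtr0_norm D0) => h.
by apply: le_trans hW; rewrite -h mulrC ler_wpM2r.
Qed.

(** Eliminating [p] and [p'] by [thE] turns the first two forms, up to sign, into
    [(e2 - tl * e1) / D] and [(tl * x - y) / D]: this is the gain [1 / q]. Replacing [tl] by [th] in
    the second costs [Z^-15 * Z^11 = Z^-4], whence the exponent 15 in [close]. *)
Lemma forms_bound (x y w : int) (i : nat) : sh x y w -> (i < 4)%N ->
  `|Lf i (fun k => (gv k x y w)%:~R)| <= expR (cs i).
Proof.
move=> [hx h1 h2]; rewrite -/tau in h1 h2.
set e1 := th * x%:~R - y%:~R in h1; set e2 := th * y%:~R + w%:~R in h2.
have tauA (c : R) : c <= A%:R + 3 -> c * tau <= (A%:R + 3) * tau by move=> h; rewrite ler_pM2r.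
have f1 : D * Lf 1 (fun k => (gv k x y w)%:~R) = (p * q' - p' * q)%:~R * (tl * x%:~R - y%:~R).
  rewrite /Lf /= mulrDr mulrA [D * th]mulrC thE /D /gv /ga /gb /gd /= !(intrD, intrN, intrM, mulr0z); ring.
case: i => [|[|[|[|//]]]] _; rewrite /cs /=.
- rewrite cs01; apply: (scaled (W := e2 - tl * e1)).
    transitivity (D * (gv 0 x y w)%:~R + (th * D) * (gv 2 x y w)%:~R
       - th * (D * Lf 1 (fun k => (gv k x y w)%:~R))); first by rewrite /Lf /=; ring.
    rewrite f1 thE /D /e1 /e2 /gv /ga /gb /gd /= !(intrD, intrN, intrM, mulr0z); ring.
  apply: (@le_trans _ _ ((1 + tl) * tau)); last by apply: tauA; have := tlA; lra.
  apply: (le_trans (ler_normB _ _)); rewrite normrM (ger0_norm (le_trans ler01 tl1)) mulrDl mul1r.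
  by apply: lerD => //; rewrite ler_wpM2l // (le_trans ler01).
- rewrite cs01; apply: (scaled (W := tl * x%:~R - y%:~R)) => //.
  have -> : tl * x%:~R - y%:~R = e1 + (tl - th) * x%:~R by rewrite /e1; ring.
  have hc : `|(tl - th) * x%:~R| <= tau.
    rewrite normrM /tau ler_pdivlMr //.
    apply: (@le_trans _ _ (`|tl - th| * (C * Z%:R ^+ 11) * Z%:R ^+ 4)).
      by rewrite ler_pM2r // ler_wpM2l.
    have -> : `|tl - th| * (C * Z%:R ^+ 11) * Z%:R ^+ 4 = C * (`|tl - th| * Z%:R ^+ 15) by ring.
    by rewrite -[leRHS]mulr1 ler_wpM2l // (le_trans ler01).
  apply: (@le_trans _ _ (2 * tau)); last by apply: tauA; have := A3; lra.
  by apply: (le_trans (ler_normD _ _)); lra.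
- rewrite cs2 /Lf /=.
  have -> : (gv 2 x y w)%:~R - th * (gv 3 x y w)%:~R = - (q'%:~R * e1 + q%:~R * e2).
    by rewrite /e1 /e2 /gv /ga /gb /gd /= !(intrD, intrN, intrM, mulr0z); ring.
  rewrite normrN; apply: (@le_trans _ _ (2 * tau * q%:~R)); last first.
    by rewrite ler_pM2r //; apply: tauA; have := A3; lra.
  apply: (le_trans (ler_normD _ _)); rewrite !normrM (ger0_norm q'R0) (gtr0_norm qR0).
  have m1 : q'%:~R * `|e1| <= q%:~R * tau by apply: ler_pM.
  have m2 : q%:~R * `|e2| <= q%:~R * tau by rewrite ler_pM2l.
  by lra.
- rewrite cs3 /Lf /=.
  have -> : (gv 3 x y w)%:~R = q'%:~R * x%:~R + q%:~R * y%:~R :> R.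
    by rewrite /gv /ga /gb /gd /= !(intrD, intrN, intrM, mulr0z); ring.
  set T := C * Z%:R ^+ 11 in hx *.
  have tauT : tau <= T.
    rewrite /tau /T ler_wpM2l ?(le_trans ler01) //; apply: (@le_trans _ _ 1).
      by rewrite invf_le1 // exprn_ege1 // ler1n ltnW.
    by rewrite exprn_ege1 // ler1n ltnW.
  have T0 : 0 <= T by apply: le_trans hx.
  have hy : `|y%:~R| <= (A%:R + 2) * T :> R.
    have -> : y%:~R = th * x%:~R - e1 by rewrite /e1; ring.
    apply: (le_trans (ler_normB _ _)); rewrite normrM (ger0_norm (le_trans ler01 th1)).
    have m1 : th * `|x%:~R| <= (A%:R + 1) * T by apply: ler_pM => //; apply: le_trans th1.
    by lra.
  apply: (le_trans (ler_normD _ _)); rewrite !normrM (ger0_norm q'R0) (gtr0_norm qR0).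
  have m1 : q'%:~R * `|x%:~R| <= q%:~R * T by apply: ler_pM.
  have m2 : q%:~R * `|y%:~R| <= q%:~R * ((A%:R + 2) * T) by rewrite ler_pM2l.
  by lra.
Qed.

Let Y (j : nat) : int * int * int :=
  nth (0, 0, 0) [:: (a, b, d); (a', b', d'); (a'', b'', d'')] j.
Let gn (k j : nat) : int :=
  if j == 3%N then (k == 0%N)%:R else gv k (Y j).1.1 (Y j).1.2 (Y j).2.
Let mn (k : nat) : int := nth 0 [:: q; q'; p; p'] k.
Let cn (k j : nat) : rat :=
  if k == 0%N then - (mn j.+1)%:~R else if k == j.+1 then (mn 0%N)%:~R else 0.
Let ep : rat := (p * q' - p' * q)%:~R.
(** [(tx j, ty j, tw j)] is the triple that [gv] sends to column [j] of [cn]; its coordinates on the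
    three short points form column [j] of [Tn]. *)
Let tx j := ep * (p%:~R * cn 3 j + q%:~R * cn 1 j).
Let ty j := ep * (p%:~R * cn 2 j + q%:~R * cn 0 j).
Let tw j := ep * (p'%:~R * cn 2 j + q'%:~R * cn 0 j).
Let De : rat := det3 a%:~R b%:~R d%:~R a'%:~R b'%:~R d'%:~R a''%:~R b''%:~R d''%:~R.
Let Tn (i j : nat) : rat :=
  if i == 3%N then (j == 3%N)%:R else if j == 3%N then 0 else
  nth 0 [:: det3 (tx j) (ty j) (tw j) a'%:~R b'%:~R d'%:~R a''%:~R b''%:~R d''%:~R / De;
            det3 a%:~R b%:~R d%:~R (tx j) (ty j) (tw j) a''%:~R b''%:~R d''%:~R / De;
            det3 a%:~R b%:~R d%:~R a'%:~R b'%:~R d'%:~R (tx j) (ty j) (tw j) / De] i.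

Let De0' : De != 0.
Proof.
have -> : De = (det3 a b d a' b' d' a'' b'' d'')%:~R.
  by rewrite /De /det3 !(intrD, intrN, intrM).
by rewrite intr_eq0.
Qed.

Let TnE (k j : nat) : (k < 4)%N -> (j < 3)%N ->
  cn k j = (gn k 0)%:~R * Tn 0 j + (gn k 1)%:~R * Tn 1 j + (gn k 2)%:~R * Tn 2 j + (gn k 3)%:~R * Tn 3 j.
Proof.
move=> k4 j3; have jn : (j == 3%N) = false by move: j3; case: j => [|[|[|]]].
rewrite /Tn jn /= mulr0 addr0 /gn /= /gv !intrD !intrM cramer3 //.
have ep2 : ep ^+ 2 = 1 by rewrite -[RHS](_ : 1%:~R = _) // -det1 /ep rmorphXn.
transitivity (ep ^+ 2 * cn k j); first by rewrite ep2 mul1r.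
rewrite /tx /ty /tw.
have epE : ep = p%:~R * q'%:~R - p'%:~R * q%:~R by rewrite /ep intrB !intrM.
move: k4 j3; case: k => [|[|[|[|//]]]] _; case: j {jn} => [|[|[|//]]] _;
  rewrite /cn /ga /gb /gd /mn /= ?intrN ?mulr0z epE; ring.
Qed.

(** The constant 13 covers [11 + 1] and the small [kap], as [zet <= L]. The logarithms sum to
    [4 * kap - zet], at most [- zet / 2] because [8 * kap <= zet], and [L <= N * zet] turns this
    into the exponent [1 / (2 N)]. *)
Lemma config_of_short_triple : exists c : config th 13 (2 * N%:R)^-1, cL c = ln q%:~R.
Proof.
pose cm (i : 'I_4) := mn i.
pose cg (k j : 'I_4) := gn k j.
pose cB (i j : 'I_4) := Lf i (fun k => (gn k j)%:~R).
pose cT (i j : 'I_4) := Tn i j.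
have H1 : 0 < cm ord0 by [].
have H2 : coprimez (cm (inord 1)) (cm ord0).
  apply/coprimezP; exists ((p * q' - p' * q) * p, - ((p * q' - p' * q) * p')).
  by rewrite /cm inordK //= /mn /= -[RHS]det1; ring.
have H3 k j : (cg k j)%:~R = \sum_i amat th k i * cB i j.
  rewrite !big_ord_recl big_ord0 /cB /cg /Lf /amat /asg /aex /=.
  have : forall k0 : nat, (gn k0 j)%:~R = (gn k0 j)%:~R :> R by [].
  by case: k => [[|[|[|[|//]]]] hk] _ /=; rewrite ?mulr0z ?mulr1z ?intrN /=; ring.
have hY j : (j < 3)%N -> sh (Y j).1.1 (Y j).1.2 (Y j).2 by case: j => [|[|[|]]].
have H4 (i j : 'I_4) : j != ord_max -> `|cB i j| <= expR (cs i).
  move=> jn; have j3 : (j < 3)%N.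
    have := ltn_ord j; rewrite ltnS leq_eqVlt => /orP[/eqP E|//].
    by case/eqP: jn; apply: val_inj.
  have E : (fun k => (gn k j)%:~R) = (fun k => (gv k (Y j).1.1 (Y j).1.2 (Y j).2)%:~R) :> (nat -> R).
    by apply/funext => k; rewrite /gn ltn_eqF.
  by rewrite /cB E; apply: forms_bound => //; exact: hY.
(* The last column is the first unit vector: form 0 takes the value 1 there and the others
   vanish. *)
have H5 (i : 'I_4) : `|cB i ord_max| <= expR (cs i + 13 * L).
  have L0 := le_trans zet0 zetL.
  case: i => [[|[|[|[|//]]]] hi]; rewrite /cB /Lf /gn /= ?mulr0 ?addr0 ?subr0 ?normr0 ?expR_ge0 //.
  rewrite normr1 -[X in X <= _]expR0 ler_expR /cs /=.
  by have := kap0; have := zetL; lra.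
have H6 (i : 'I_4) : `|cs i| <= 13 * L.
  have L0 := le_trans zet0 zetL; have := kap0; have := zetL; have := zet0 => g1 g2 g3.
  have g4 : kap <= L by have := Zbig; rewrite -/kap -/zet; lra.
  by case: i => [[|[|[|[|//]]]] hi]; rewrite /cs /= ler_norml; apply/andP; split; lra.
have H7 : \sum_(i < 4) cs i <= - (2 * N%:R)^-1 * L.
  rewrite !big_ord_recl big_ord0 /cs /=.
  have N0 : 0 < N%:R :> R.
    rewrite ltr0n lt0n; apply/eqP => N0; move: Zq qZ; rewrite N0 expn0; move: Z1; clear; lia.
  have : (2 * N%:R)^-1 * L <= zet / 2.
    rewrite mulrC ler_pdivrMr ?mulr_gt0 //; have -> : zet / 2 * (2 * N%:R) = N%:R * zet by field.
    exact: LN.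
  by have := Zbig; rewrite -/kap -/zet; lra.
have H8 k j : cmat cm k j = \sum_i (cg k i)%:~R * cT i j.
  rewrite !big_ord_recl big_ord0 addr0 !addrA /cg /cT /=.
  have [j3|j3] := eqVneq (j : nat) 3%N.
    by rewrite /cmat j3 /gn /Tn /= !mulr0 !add0r mulr1; case: (k : nat).
  have jl : (j < 3)%N by have := ltn_ord j; rewrite ltnS leq_eqVlt (negbTE j3).
  have := TnE (ltn_ord k) jl; rewrite /bump /= => <-.
  by rewrite /cmat (negbTE j3) /cn /cm inordK ?ltnS.
have H9 j : j != ord_max -> cT ord_max j = 0.
  by move=> jn; rewrite /cT /Tn /= (_ : (j == 3%N :> nat) = false) //; apply: negbTE.
by exists (@Config R th 13 (2 * N%:R)^-1 cm cg cB cT (fun i => cs i) H1 H2 H3 H4 H5 H6 H7 H8 H9).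
Qed.
End Config.

(** * Continued fractions *)

Local Open Scope classical_set_scope.

Lemma intr_ge1 (R : numDomainType) (z : int) : 0 < z -> 1 <= z%:~R :> R.
Proof. by move=> h; rewrite -[X in X <= _](_ : 1%:~R = _) // ler_int; lia. Qed.

(** With [y = 0], or with [x] and [y] of the same strict sign, the combination would be at least [Q]
    in absolute value. *)
Lemma small_combination (Q Q' x y : int) : 0 < Q -> 0 <= Q' -> Q * x + Q' * y != 0 ->
  `|Q * x + Q' * y| < Q -> y != 0 /\ x * y <= 0.
Proof.
move=> Q0 Q'0 n0 h; have y0 : y != 0.
  apply/eqP => y0; move: n0 h; rewrite y0 mulr0 addr0 normrM (gtr0_norm Q0) mulf_eq0 negb_or => /andP[_ x0].
  by rewrite -[ltRHS]mulr1 ltr_pM2l //; move: x0; clear; lia.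
split=> //; rewrite leNgt; apply/negP => xy.
have [xp|xn|x0] := ltgtP 0 x.
- rewrite pmulr_rgt0 // in xy.
  have h1 : Q <= Q * x by rewrite ler_peMr ?(ltW Q0) //; move: xp; clear; lia.
  have h2 : 0 <= Q' * y by rewrite mulr_ge0 // ltW.
  by move: h h1 h2; move: (Q * x) (Q' * y); clear; lia.
- rewrite nmulr_rgt0 // in xy.
  have h1 : Q <= Q * (- x) by rewrite ler_peMr ?(ltW Q0) //; move: xn; clear; lia.
  have h2 : Q' * y <= 0 by rewrite mulr_ge0_le0 // ltW.
  by move: h h1 h2; rewrite mulrN; move: (Q * x) (Q' * y); clear; lia.
- by move: xy; rewrite -x0 mul0r ltxx.
Qed.

Lemma norm_comb_ge1 (R : realFieldType) (t x y : R) : 1 <= t -> 1 <= `|y| -> x * y <= 0 ->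
  1 <= `|t * y - x|.
Proof.
move=> t1; have [y0|y0] := lerP 0 y => y1 xy; rewrite ler_normr; apply/orP.
  left; rewrite (ger0_norm y0) in y1; have yp : 0 < y by lra.
  by rewrite pmulr_lle0 // in xy; have := ler_peMl y0 t1; lra.
right; rewrite (ltr0_norm y0) in y1; rewrite nmulr_lle0 // in xy; have h : 0 <= - y by lra.
by have := ler_peMl h t1; lra.
Qed.

Lemma cfrac_bounds (R : realType) (a : nat -> int) n : (forall k, 0 < a k) ->
  (a 0%N)%:~R <= cfrac R a n <= (a 0%N)%:~R + 1.
Proof.
elim: n a => [|n IH] a h /=; first by apply/andP; split; lra.
have /andP[h1 _] := IH (fun i => a i.+1) (fun k => h k.+1).
have c1 := le_trans (intr_ge1 R (h 1%N)) h1.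
have i0 : 0 <= (cfrac R (fun i => a i.+1) n)^-1 by rewrite invr_ge0 (le_trans ler01).
have i1 : (cfrac R (fun i => a i.+1) n)^-1 <= 1 by rewrite invf_le1 // (lt_le_trans ltr01).
by apply/andP; split; lra.
Qed.

Lemma cfrac_limit_bounds (R : realType) (x : R) (a : nat -> int) : (forall k, 0 < a k) -> cfrac R a @ \oo --> x ->
  (a 0%N)%:~R <= x <= (a 0%N)%:~R + 1.
Proof.
move=> ha hx; apply/andP; split.
  by apply: (cvgr_to_ge hx); apply: nearW => n; have /andP[] := cfrac_bounds R n ha.
by apply: (cvgr_to_le hx); apply: nearW => n; have /andP[] := cfrac_bounds R n ha.
Qed.

Lemma continued_fraction_tail (R : realType) (x : R) a : continued_fraction x a ->
  continued_fraction (x - (a 0%N)%:~R)^-1 (fun i => a i.+1).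
Proof.
move=> [ha hx]; split; first by move=> n; exact: ha.
set s := fun i => a i.+1; have hs k : 0 < s k by exact: ha.
have cv1 : (fun n => (cfrac R s n)^-1) @ \oo --> x - (a 0%N)%:~R.
  have -> : (fun n => (cfrac R s n)^-1) = (fun n => cfrac R a n.+1 - (a 0%N)%:~R).
    by apply/funext => n /=; rewrite addrAC subrr add0r.
  by apply: cvgB; [move: hx; rewrite -(@cvg_shiftS _ (cfrac R a)) | exact: cvg_cst].
have s1 := intr_ge1 R (hs 0%N).
(* Passing to the inverse of the limit requires it to be nonzero; the tails are at most [s 0 + 1],
   which keeps their inverses away from 0. *)
have hpos : ((s 0%N)%:~R + 1)^-1 <= x - (a 0%N)%:~R.
  apply: (cvgr_to_ge cv1); apply: nearW => n; have /andP[h1 h2] := cfrac_bounds R n hs.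
  by rewrite lef_pV2 ?posrE //; lra.
have x0 : x - (a 0%N)%:~R != 0.
  by rewrite gt_eqF // (lt_le_trans _ hpos) // invr_gt0; lra.
have -> : cfrac R s = (fun n => ((cfrac R s n)^-1)^-1) by apply/funext => n; rewrite invrK.
exact: cvgV x0 cv1.
Qed.

Lemma complete_quotients (R : realType) (x : R) a : continued_fraction x a ->
  exists2 t : nat -> R, t 0%N = (x - (a 0%N)%:~R)^-1 &
    forall l, t l = (a l.+1)%:~R + (t l.+1)^-1 /\ (a l.+1)%:~R <= t l <= (a l.+1)%:~R + 1.
Proof.
move=> hx; pose t := fix t l := if l is l'.+1 then (t l' - (a l'.+1)%:~R)^-1 else (x - (a 0%N)%:~R)^-1.
have H l : continued_fraction (t l) (fun i => a (l + i).+1).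
  elim: l => [|l IH]; first exact: continued_fraction_tail hx.
  have := continued_fraction_tail IH; rewrite addn0.
  by have -> : (fun i => a (l + i.+1).+1) = (fun i => a (l.+1 + i).+1) by apply/funext => i; rewrite addnS addSn.
exists t => // l; split; first by rewrite /= invrK; ring.
have [h1 h2] := H l; have := @cfrac_limit_bounds R (t l) (fun i => a (l + i).+1).
rewrite addn0; apply=> // k; have := hx.1 (l + k)%N; by [].
Qed.

(** Started one step early, from [(1, 0)] for numerators and [(0, 1)] for denominators: at index
    [l.+1] the quotient is the convergent using [b 0] to [b l], and the denominator at index 0 is
    0. *)
Fixpoint convergent (b : nat -> int) (x x' : int) (l : nat) : int * int :=
  if l is l'.+1 then ((convergent b x x' l').1 * b l' + (convergent b x x' l').2, (convergent b x x' l').1)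
  else (x, x').

Section Convergents.
Variables (R : realType) (b : nat -> int) (t : nat -> R) (A : nat).
Hypothesis tE : forall l, t l = (b l)%:~R + (t l.+1)^-1.
Hypothesis tb : forall l, (b l)%:~R <= t l <= (b l)%:~R + 1.
Hypothesis b1 : forall l, 0 < b l.
Hypothesis bA : forall l, b l <= A%:Z.
Definition pn l := (convergent b 1 0 l).1.
Definition pn' l := (convergent b 1 0 l).2.
Definition qn l := (convergent b 0 1 l).1.
Definition qn' l := (convergent b 0 1 l).2.

Lemma pnS l : pn l.+1 = pn l * b l + pn' l. Proof. by []. Qed.
Lemma qnS l : qn l.+1 = qn l * b l + qn' l. Proof. by []. Qed.
Lemma pn'S l : pn' l.+1 = pn l. Proof. by []. Qed.
Lemma qn'S l : qn' l.+1 = qn l. Proof. by []. Qed.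

Lemma t_ge1 l : 1 <= t l.
Proof. by have /andP[h _] := tb l; apply: le_trans h; exact: intr_ge1. Qed.
Lemma t_gt0 l : 0 < t l. Proof. by apply: lt_le_trans (t_ge1 l). Qed.
Lemma t_le l : t l <= A%:R + 1.
Proof.
have /andP[_ h] := tb l; apply: (le_trans h); rewrite lerD2r.
by rewrite -[X in _ <= X](_ : (A%:Z)%:~R = _) // ler_int.
Qed.
Lemma A_gt0 : (0 < A)%N. Proof. by have := b1 0%N; have := bA 0%N; lia. Qed.

Lemma tM l : t l * t l.+1 = (b l)%:~R * t l.+1 + 1.
Proof. by rewrite {1}tE mulrDl mulVf // gt_eqF // t_gt0. Qed.

Lemma convergent_det l : (pn l * qn' l - pn' l * qn l) ^+ 2 = 1.
Proof.
elim: l => [|l IH]; first by rewrite /pn /qn' /pn' /qn /=.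
by rewrite -[RHS]IH pnS qnS pn'S qn'S; ring.
Qed.

Lemma convergent_tail l :
  t 0%N * ((qn l)%:~R * t l + (qn' l)%:~R) = (pn l)%:~R * t l + (pn' l)%:~R.
Proof.
elim: l => [|l IH]; first by rewrite /pn /qn' /pn' /qn /=; ring.
rewrite pnS qnS pn'S qn'S !intrD !intrM.
have h (x y : R) : (x * (b l)%:~R + y) * t l.+1 + x = (x * t l + y) * t l.+1.
  transitivity (x * ((b l)%:~R * t l.+1 + 1) + y * t l.+1); first by ring.
  by rewrite -tM; ring.
by rewrite !h mulrA IH.
Qed.

Lemma qn_ge0 l : 0 <= qn l /\ 0 <= qn' l.
Proof.
elim: l => [//|l [h1 h2]]; rewrite qnS qn'S; split=> //.
by apply: addr_ge0 => //; apply: mulr_ge0 => //; apply: ltW.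
Qed.

Lemma qn_nondecr l : qn l <= qn l.+1.
Proof. by have [h1 h2] := qn_ge0 l; rewrite qnS; have := b1 l; nia. Qed.

Lemma qn_homo l m : (l <= m)%N -> qn l <= qn m.
Proof.
move/subnKC <-; elim: (m - l)%N => [|k IH]; first by rewrite addn0.
by rewrite addnS; apply: le_trans IH (qn_nondecr _).
Qed.

Lemma qn_gt0 l : 0 < qn l.+1.
Proof. by apply: lt_le_trans (qn_homo (ltn0Sn l)); rewrite /qn /= mul0r add0r. Qed.

Lemma qn_growth k l : (k.*2 < l)%N -> (2 ^ k)%N%:Z <= qn l.
Proof.
move=> h; apply: le_trans (qn_homo h); elim: k {h} => [|k IH]; first by rewrite /qn /= mul0r add0r.
rewrite expnS doubleS; have := qn_nondecr k.*2.+1.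
rewrite (qnS k.*2.+2) qn'S => h1.
have b2 : 1 <= b k.*2.+2 by have := b1 k.*2.+2; clear; lia.
have h2 : qn k.*2.+2 <= qn k.*2.+2 * b k.*2.+2 by rewrite ler_peMr // (qn_ge0 _).1.
by rewrite PoszM; move: IH h1 h2; move: (qn k.*2.+2 * b k.*2.+2) (qn k.*2.+2) (qn k.*2.+1) (2 ^ k)%N; clear; lia.
Qed.

Lemma qn_upper l : qn l <= ((A.+1) ^ l)%N%:Z /\ qn' l <= ((A.+1) ^ l)%N%:Z.
Proof.
elim: l => [//|l [h1 h2]]; have [g1 g2] := qn_ge0 l; rewrite qnS qn'S expnS PoszM.
have := bA l; have := b1 l; move: ((A.+1 ^ l)%N%:Z) h1 h2 => X h1 h2 c1 c2.
by split; nia.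
Qed.

(** Take the least [l] whose next denominator exceeds [|s|] and write [(u, s)] on the basis of the
    two adjacent convergents. The coordinates cannot have the same strict sign, so
    [|t' * y - x| >= 1], and bounded partial quotients keep [D] within a constant multiple of
    [|s|]. *)
Lemma badly_approximable : exists2 c : R, 0 < c &
  forall s u : int, s != 0 -> c <= `|s%:~R| * `|t 0%N * s%:~R - u%:~R|.
Proof.
have A1 : 0 < (A%:R + 2) * (A%:R + 1) :> R by have := ler0n R A; nra.
exists ((A%:R + 2) * (A%:R + 1))^-1; first by rewrite invr_gt0.
move=> s u s0.
have ex : exists l, `|s| < qn l.
  exists (`|s|%N.*2.+1); apply: lt_le_trans (qn_growth (ltnSn _)).
  by have := ltn_expl `|s|%N (ltnSn 1); lia.
case: (ex_minnP ex) => -[|l] hl lmin; first by move: hl; rewrite /qn /=; lia.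
have hl' : qn l <= `|s| by rewrite leNgt; apply/negP => /lmin; rewrite ltnn.
set Q := qn l.+1 in hl *; set Q' := qn' l.+1; set P := pn l.+1; set P' := pn' l.+1.
have Q'E : Q' = qn l by [].
have det := convergent_det l.+1; rewrite -/P -/P' -/Q -/Q' in det.
set ep := P * Q' - P' * Q in det.
pose x := ep * (Q' * u - P' * s); pose y := ep * (P * s - Q * u).
have uE : u = P * x + P' * y.
  by transitivity (ep ^+ 2 * u); [rewrite det mul1r | rewrite /x /y /ep; ring].
have sE : s = Q * x + Q' * y.
  by transitivity (ep ^+ 2 * s); [rewrite det mul1r | rewrite /x /y /ep; ring].
have Q0 : 0 < Q by exact: qn_gt0.
have Q'0 : 0 <= Q' by rewrite Q'E; have [] := qn_ge0 l.
have [y0 xy] : y != 0 /\ x * y <= 0.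
  by apply: (small_combination Q0 Q'0); rewrite -sE.
pose t' := t l.+1; have t'1 : 1 <= t' by exact: t_ge1.
pose D : R := Q%:~R * t' + Q'%:~R.
have QR : 1 <= Q%:~R :> R by exact: intr_ge1.
have Q'R : 0 <= Q'%:~R :> R by rewrite ler0z.
have D0 : 0 < D.
  by rewrite /D; apply: ltr_pwDl => //; apply: mulr_gt0; [exact: lt_le_trans QR | exact: lt_le_trans t'1].
have epR : `|ep%:~R| = 1 :> R.
  by move/eqP: det; rewrite sqrf_eq1 => /orP[] /eqP ->; rewrite ?intrN ?normrN normr1.
have key : D * (t 0%N * s%:~R - u%:~R) = ep%:~R * (t' * y%:~R - x%:~R).
  have h := convergent_tail l.+1; rewrite -/P -/P' -/Q -/Q' -/t' -/D in h.
  have -> : s%:~R = Q%:~R * x%:~R + Q'%:~R * y%:~R :> R by rewrite -!intrM -intrD -sE.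
  have -> : u%:~R = P%:~R * x%:~R + P'%:~R * y%:~R :> R by rewrite -!intrM -intrD -uE.
  have -> : ep%:~R = P%:~R * Q'%:~R - P'%:~R * Q%:~R :> R by rewrite -!intrM -intrB.
  transitivity (t 0%N * D * (Q%:~R * x%:~R + Q'%:~R * y%:~R) - D * (P%:~R * x%:~R + P'%:~R * y%:~R)); first by ring.
  by rewrite h /D; ring.
have num : 1 <= `|t' * y%:~R - x%:~R|.
  have yR : 1 <= `|y%:~R| :> R by rewrite -intr_norm; apply: intr_ge1; rewrite normr_gt0.
  have xyR : x%:~R * y%:~R <= 0 :> R by rewrite -intrM lerz0.
  exact: norm_comb_ge1.
have DE : 1 <= D * `|t 0%N * s%:~R - u%:~R|.
  by rewrite -[D](gtr0_norm D0) -normrM key normrM epR mul1r.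
have DS : D <= (A%:R + 2) * (A%:R + 1) * `|s%:~R|.
  have QQ : Q <= (A%:Z + 1) * `|s|.
    have : Q = qn l * b l + qn' l by [].
    have [g1 g2] := qn_ge0 l; have := bA l; have := b1 l.
    have qq : qn' l <= `|s|.
      case: (l) hl' => [|m] hm; first by rewrite /qn' /=; move: s0; lia.
      by apply: le_trans hm; rewrite qn'S; exact: qn_nondecr.
    move=> c1 c2 ->; have := ler_pM g1 (ltW c1) hl' c2; move: qq.
    by move: (qn l * b l) (qn' l) (`|s|) (A%:Z); clear; lia.
  have QR' : Q%:~R <= (A%:R + 1) * `|s%:~R| :> R.
    have -> : A%:R + 1 = (A%:Z + 1)%:~R :> R by rewrite intrD.
    by rewrite -intr_norm -intrM ler_int.
  have Q'le : Q'%:~R <= Q%:~R :> R by rewrite ler_int Q'E; exact: qn_nondecr.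
  have tle : t' <= A%:R + 1 by exact: t_le.
  have DQ : D <= Q%:~R * (A%:R + 2).
    have -> : Q%:~R * (A%:R + 2) = Q%:~R * (A%:R + 1) + Q%:~R :> R by ring.
    by apply: lerD => //; rewrite ler_wpM2l // (le_trans ler01).
  apply: (le_trans DQ); rewrite mulrC -mulrA ler_wpM2l //; have := ler0n R A; lra.
rewrite -[leLHS]mul1r ler_pdivrMr //; apply: (le_trans DE).
apply: (le_trans (ler_wpM2r (normr_ge0 _) DS)).
by rewrite le_eqVlt; apply/orP; left; apply/eqP; ring.
Qed.

(** One common partial quotient divides the distance by [t l.+1 * t m.+1]. A product of two
    consecutive complete quotients is at least 2, so two common partial quotients gain a factor
    4. *)
Lemma tails_close k l m : (forall i, (i < k.*2)%N -> b (l + i)%N = b (m + i)%N) ->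
  `|t l - t m| * 4 ^+ k <= A%:R.
Proof.
elim: k l m => [|k IH] l m h.
  rewrite mulr1 ler_norml; have := t_ge1 l; have := t_ge1 m; have := t_le l; have := t_le m => *.
  by apply/andP; split; lra.
have st (i j : nat) : b i = b j -> `|t i - t j| * (t i.+1 * t j.+1) = `|t i.+1 - t j.+1|.
  move=> bij; have := t_gt0 i.+1; have := t_gt0 j.+1 => p1 p2.
  rewrite -[X in _ * X]gtr0_norm ?mulr_gt0 // -normrM (tE i) (tE j) bij.
  rewrite -[RHS]normrN; congr (`| _ |); field.
  by rewrite !gt_eqF.
have s1 := st l m; have s2 := st l.+1 m.+1.
have e0 : b l = b m by have := h 0%N; rewrite !addn0; apply.
have e1 : b l.+1 = b m.+1 by have := h 1%N; rewrite !addn1; apply.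
have {}IH : `|t l.+2 - t m.+2| * 4 ^+ k <= A%:R.
  by apply: IH => i ik; rewrite !addSnnS; apply: h; rewrite doubleS.
apply: le_trans IH; rewrite -(s2 e1) -(s1 e0) exprS.
have g (i : nat) : 2 <= t i * t i.+1.
  rewrite tM; have := intr_ge1 R (b1 i); have := t_ge1 i.+1; nra.
have : 4 <= (t l.+1 * t m.+1) * (t l.+2 * t m.+2).
  have -> : (t l.+1 * t m.+1) * (t l.+2 * t m.+2) = (t l.+1 * t l.+2) * (t m.+1 * t m.+2) by ring.
  by have := g l.+1; have := g m.+1; nra.
move=> h4; rewrite !mulrA ler_pM2r ?exprn_gt0 // -!mulrA ler_wpM2l // mulrA; exact: h4.
Qed.

(** Denominators grow at least like [2^(l/2)] and at most like [(A + 1)^l], while [r] and [l] are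
    proportional to [log Z]. All the quantities concerned are therefore powers of [Z] with bounded
    exponents. *)
Lemma good_index C : (forall r0 : nat, (0 < r0)%N -> exists r l : nat,
    [/\ (r0 <= r <= C * r0)%N, (r <= l <= C * r)%N & forall i, (i < r)%N -> b (l + i)%N = b i]) ->
  exists N : nat, forall Z : nat, (1 < Z)%N -> exists l : nat,
    [/\ Z%:Z <= qn l.+1, qn l.+1 <= (Z ^ N)%N%:Z & `|t l.+1 - t 0%N| * Z%:R ^+ 15 <= 1].
Proof.
move=> hC; pose s := up_log 2 A.+1.
have hs : (A.+1 <= 2 ^ s)%N by rewrite up_logP.
exists (2 * (s * (C * (C * (30 + 2 * s)))))%N => Z Z1.
pose n := up_log 2 Z; have /andP[n1 n2] := up_log_bounds (ltnSn 1) Z1; rewrite -/n in n1 n2.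
have n0 : (0 < n)%N by rewrite lt0n; apply/eqP => n0; move: n2; rewrite n0; lia.
have n3 : (2 ^ n <= Z ^ 2)%N.
  rewrite -(prednK n0) expnS; apply: (@leq_trans (2 * Z)); first by rewrite leq_mul2l ltnW.
  by rewrite expnS expn1 leq_mul2r Z1 orbT.
(* This many agreeing quotients bring a factor [4 ^ (15 n + s)], which covers [Z ^ 15] because
   [Z <= 2 ^ n], and [A] because [A < 2 ^ s]. *)
pose r0 := (15 * n + s).*2; have r00 : (0 < r0)%N by rewrite /r0; lia.
have [r [l [/andP[hr1 hr2] /andP[hl1 hl2] hb]]] := hC _ r00.
have l0 : (0 < l)%N by lia.
exists l.-1; rewrite prednK //; split.
- apply: le_trans (@qn_growth n l _); last by move: hr1 hl1; rewrite /r0; lia.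
  by rewrite lez_nat.
- have [h _] := qn_upper l; apply: (le_trans h); rewrite lez_nat.
  apply: (@leq_trans ((2 ^ s) ^ l)); first by rewrite leq_exp2r.
  rewrite -expnM [X in (_ <= X)%N]expnM; set M := (s * (C * _))%N.
  apply: (@leq_trans ((2 ^ n) ^ M)); last by case: (M) => // M'; rewrite leq_exp2r.
  rewrite -expnM leq_exp2l // /M mulnCA leq_mul2l; apply/orP; right.
  apply: (leq_trans hl2); rewrite mulnCA leq_mul2l; apply/orP; right.
  apply: (leq_trans hr2); rewrite mulnCA leq_mul2l; apply/orP; right.
  by move: n0; rewrite /r0; move: (n) (s) => n' s'; clear; nia.
have hk : `|t l - t 0%N| * 4 ^+ (15 * n + s) <= A%:R.
  by apply: tails_close => i hi; rewrite add0n; apply: hb; apply: leq_trans hi _.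
have AR : 0 < A%:R :> R by rewrite ltr0n A_gt0.
have h4 : Z%:R ^+ 15 * A%:R <= 4 ^+ (15 * n + s) :> R.
  rewrite -!natrX -natrM ler_nat expnD; apply: leq_mul.
    rewrite mulnC expnM leq_exp2r //; apply: (leq_trans n2); exact: leq_exp2r.
  apply: (leq_trans (leqnSn A)); apply: (leq_trans hs).
  by case: (s) => // s'; rewrite leq_exp2r.
rewrite -(ler_pM2r AR) mul1r -mulrA; apply: le_trans hk; rewrite ler_wpM2l //.
Qed.
End Convergents.

Theorem theorem3 (R : realType) (alpha : R) (d : nat) (a : nat -> int)
    (halg : algebraic_of_degree alpha d) (hd : (3 <= d)%N)
    (hcf : continued_fraction alpha a) :
  ~ generated_by_recurrent_morphism (fun l : nat => a l.+1).
Proof.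
move=> hgen; have [[M hM] [C hC]] := recurrent_morphic_returns hgen.
have [t t0E ht] := complete_quotients hcf.
pose b l := a l.+1.
have tE l : t l = (b l)%:~R + (t l.+1)^-1 by have [] := ht l.
have tb l : (b l)%:~R <= t l <= (b l)%:~R + 1 by have [] := ht l.
have b1 l : 0 < b l by exact: hcf.1.
have bM l : b l <= M%:Z by exact: hM.
have t1 l : 1 <= t l by exact: t_ge1 tb b1 l.
have tM l : t l <= M%:R + 1 by exact: t_le tb bM l.
have [c c0 hc] := badly_approximable tE tb b1 bM.
have irr p q r : nv (t 0%N) p q r = 0 -> [/\ p = 0, q = 0 & r = 0].
  move=> h; apply: (no_quadratic_relation (z := a 0%N) halg hd).
  have be0 : alpha - (a 0%N)%:~R != 0.
    by rewrite -invr_eq0 -t0E gt_eqF // (lt_le_trans ltr01).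
  transitivity ((alpha - (a 0%N)%:~R) ^+ 2 * nv (t 0%N) p q r); last by rewrite h mulr0.
  by rewrite /nv t0E; field.
have [f f0 rf] := integer_polynomial_root (a 0%N) halg; rewrite -t0E in rf.
have [dd [g0 [C0 pr]]] := power_reduction_exists f0 rf.
have [C1 C11 hZ] := short_triples_exist (t1 0%N) c0 hc irr.
have [N hN] := good_index tE tb b1 bM hC.
have N0 : (0 < N)%N.
  rewrite lt0n; apply/eqP => N0; have [l [h1 h2 _]] := hN 2%N isT.
  by move: (le_trans h1 h2); rewrite N0.
apply: (@no_configurations R (t 0%N) dd g0 C0 pr 13 (2 * N%:R)^-1).
- by [].
- by rewrite invr_gt0 mulr_gt0 // ltr0n.
move=> x; pose K := ln ((M%:R + 3) * C1) * 8.
(* [Z] is taken large enough both for the prescribed height [x] and for absorbing the constant [K]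
   of the forms. *)
have hB := archi_boundP (expR_ge0 (`|x| + `|K|)).
have [Z hZB [y1 [y2 [y3 [y1' [y2' [y3' [y1'' [y2'' [y3'' [s1 s2 s3 De]]]]]]]]]]] := hZ (Num.bound (expR (`|x| + `|K|))).+2.
have Z1 : (1 < Z)%N by apply: leq_trans hZB.
have Zp : 0 < Z%:R :> R by rewrite ltr0n ltnW.
have lnZ : `|x| + `|K| <= ln Z%:R.
  rewrite -[leLHS]expRK ler_ln ?posrE ?expR_gt0 //; apply: (le_trans (ltW hB)).
  by rewrite ler_nat (leq_trans _ hZB) // -addn2 leq_addr.
have [l [l1 l2 l3]] := hN Z Z1.
have [cc ccE] : exists cc : config (t 0%N) 13 (2 * N%:R)^-1, cL cc = ln (qn b l.+1)%:~R.
  apply: (@config_of_short_triple R (t 0%N) (t l.+1) C1 M N Z (pn b l.+1) (pn' b l.+1)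
    (qn b l.+1) (qn' b l.+1) y1 y2 y3 y1' y2' y3' y1'' y2'' y3'') => //.
  - exact: (qn_gt0 b1 l).
  - by rewrite qn'S; have [] := qn_ge0 b1 l.
  - by rewrite qn'S; exact: qn_nondecr.
  - exact: convergent_det.
  - exact: (convergent_tail tE tb b1).
  - by rewrite -/K; have := ler_norm K; have := normr_ge0 x; lra.
exists cc; rewrite ccE; apply: (@le_trans _ _ (ln Z%:R)).
  by have := ler_norm x; have := normr_ge0 K; lra.
have q1 : 0 < (qn b l.+1)%:~R :> R by rewrite ltr0z (qn_gt0 b1 l).
by rewrite ler_ln ?posrE // -[X in X <= _](_ : (Z%:Z)%:~R = _) // ler_int.
Qed.
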